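(* Let $k$ be a perfect large field. Let $C$ and $D$ be normal projective curves over $k$, and let $f \colon C \to D$ be a finite morphism. Suppose that the induced map on rational points $f_k \colon C(k) \to D(k)$ is not surjective. Then $|D(k) \setminus f_k(C(k))| = |k|$ (equality of cardinalities).
   Context: A field $k$ is called large if every irreducible $k$-curve that has a $k$-rational smooth point has infinitely many $k$-rational points. A normal projective curve over $k$ is meant in the sense of Q. Liu, ''Algebraic Geometry and Arithmetic Curves'': an integral normal projective scheme of dimension one over $k$ (so that it has a function field $k(C)$). $C(k)$ denotes the set of $k$-rational points of $C$. *)

(* Defs.v *)
(* Schemes on top of MathComp and MathComp-Analysis: a scheme is a topological
   space with a sheaf of commutative rings that is locally a prime spectrum.
   Rings of sections have type comPzRingType, since the sections over the empty
   set form the zero ring. *)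
From mathcomp Require Import all_boot all_algebra all_field.
From mathcomp Require Import all_classical topology.

Set Implicit Arguments.
Unset Strict Implicit.
Unset Printing Implicit Defensive.

Import GRing.Theory.
Local Open Scope classical_set_scope.
Local Open Scope ring_scope.

(** * Topology *)

Identity Coercion fun_of_set : set >-> Funclass.

Record opens (X : topologicalType) := Opens {
  oset :> set X;
  open_oset : open oset }.

Definition opensT (X : topologicalType) : opens X := Opens (@openT X).

Definition opensI (X : topologicalType) (U V : opens X) : opens X :=
  Opens (openI (open_oset U) (open_oset V)).

Definition open_preim (X Y : topologicalType) (f : X -> Y) (cf : continuous f)
    (V : opens Y) : opens X :=
  Opens (proj1 (continuousP f) cf V (open_oset V)).

Definition irreducible_set (X : topologicalType) (Z : set X) : Prop :=
  Z !=set0 /\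
  forall F G : set X, closed F -> closed G ->
    Z `<=` F `|` G -> Z `<=` F \/ Z `<=` G.

Definition irreducible_chain (X : topologicalType) (n : nat) : Prop :=
  exists Z : nat -> set X,
    (forall i, (i <= n)%N -> closed (Z i) /\ irreducible_set (Z i)) /\
    (forall i, (i < n)%N -> Z i `<` Z i.+1).

Definition krull_dim (X : topologicalType) (n : nat) : Prop :=
  irreducible_chain X n /\ ~ irreducible_chain X n.+1.

(** * Ringed spaces *)

Record ringed_space := RingedSpace {
  points :> topologicalType;
  sec : opens points -> comPzRingType;
  res : forall U V : opens points, V `<=` U -> {rmorphism sec U -> sec V};
  res_id : forall (U : opens points) (h : U `<=` U) (s : sec U), res h s = s;
  res_comp : forall (U V W : opens points)
      (hUV : V `<=` U) (hVW : W `<=` V) (hUW : W `<=` U) (s : sec U),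
    res hVW (res hUV s) = res hUW s;
  sheaf_separated : forall (U : opens points) (I : Type)
      (V : I -> opens points) (hV : forall i, V i `<=` U),
    (forall x, U x -> exists i, V i x) ->
    forall s t : sec U, (forall i, res (hV i) s = res (hV i) t) -> s = t;
  sheaf_glue : forall (U : opens points) (I : Type)
      (V : I -> opens points) (hV : forall i, V i `<=` U),
    (forall x, U x -> exists i, V i x) ->
    forall s : forall i, sec (V i),
      (forall i j (W : opens points) (hi : W `<=` V i) (hj : W `<=` V j),
         res hi (s i) = res hj (s j)) ->
      exists t : sec U, forall i, res (hV i) t = s i }.

Arguments sec : clear implicits.

Section RingedSpace.
Variable X : ringed_space.
Implicit Types (x : X) (U V W : opens X).

(* The germ of s at x is zero in the stalk at x. *)
Definition germ_zero U (s : sec X U) x : Prop :=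
  exists V (h : V `<=` U), V x /\ res h s = 0.

(* The germ of s at x is a unit of the stalk at x; when the stalk is local,
   the negation says that s vanishes in the residue field at x. *)
Definition germ_unit U (s : sec X U) x : Prop :=
  exists V (h : V `<=` U), V x /\ exists t : sec X V, t * res h s = 1.

Definition nonvanishing U (s : sec X U) : set X :=
  [set x | U x /\ germ_unit s x].

Lemma open_nonvanishing U (s : sec X U) : open (nonvanishing s).
Proof.
rewrite openE => x [Ux [V [h [Vx [t Ht]]]]].
rewrite /interior nbhsE; exists (V : set X); first by split=> //; exact: open_oset.
move=> y Vy; split; first by apply: (h).
by exists V, h; split=> //; exists t.
Qed.

Definition basic_open U (s : sec X U) : opens X := Opens (open_nonvanishing s).

Lemma basic_open_sub U (s : sec X U) : basic_open s `<=` U.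
Proof. by move=> x []. Qed.

End RingedSpace.

Record prime_ideal (A : comPzRingType) (P : set A) : Prop := PrimeIdeal {
  prime_ideal0 : P 0;
  prime_idealD : forall a b, P a -> P b -> P (a + b);
  prime_idealM : forall a b, P b -> P (a * b);
  prime_ideal1 : ~ P 1;
  prime_idealP : forall a b, P (a * b) -> P a \/ P b }.

Record is_localization (A B : comPzRingType) (s : A) (r : {rmorphism A -> B}) :
    Prop := IsLocalization {
  loc_unit : exists t, t * r s = 1;
  loc_frac : forall b : B, exists (n : nat) (a : A), r (s ^+ n) * b = r a;
  loc_zero : forall a : A, r a = 0 -> exists n : nat, s ^+ n * a = 0 }.

(* The canonical map from U, with the restricted sheaf, to Spec of its ring of
   sections A (sending x to the ideal of sections vanishing at x) is an
   isomorphism: it is a bijection onto the primes of A, the sets D(s) form a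
   basis of the topology of U, and the sections over D(s) are A[1/s]. *)
Record affine (X : ringed_space) (U : opens X) : Prop := Affine {
  affine_prime : forall x : X, U x ->
    prime_ideal [set s : sec X U | ~ germ_unit s x];
  affine_bij : forall P : set (sec X U), prime_ideal P ->
    exists! x : X, U x /\ P = [set s : sec X U | ~ germ_unit s x];
  affine_basis : forall (W : opens X) (x : X), W `<=` U -> W x ->
    exists s : sec X U, basic_open s x /\ basic_open s `<=` W;
  affine_loc : forall s : sec X U,
    is_localization s (res (@basic_open_sub X U s)) }.

(** * Schemes *)

(* The stalks are local rings because they are localizations at primes. *)
Record scheme := Scheme {
  scheme_space :> ringed_space;
  scheme_affine : forall x : scheme_space,
    exists U : opens scheme_space, affine U /\ U x }.

Record morphism (X Y : scheme) := Morphism {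
  mor :> X -> Y;
  mor_cont : continuous mor;
  comor : forall V : opens Y, {rmorphism sec Y V -> sec X (open_preim mor_cont V)};
  comor_res : forall (V V' : opens Y) (h : V' `<=` V)
      (h' : open_preim mor_cont V' `<=` open_preim mor_cont V) (s : sec Y V),
    comor V' (res h s) = res h' (comor V s);
  comor_local : forall (V : opens Y) (s : sec Y V) (x : X),
    V (mor x) -> germ_unit (comor V s) x -> germ_unit s (mor x) }.

Definition mpreim (X Y : scheme) (f : morphism X Y) : opens Y -> opens X :=
  open_preim (mor_cont (m := f)).

Definition module_finite (A B : comPzRingType) (r : {rmorphism A -> B}) : Prop :=
  exists (n : nat) (b : 'I_n -> B),
    forall t : B, exists a : 'I_n -> A, t = \sum_(i < n) r (a i) * b i.

Definition finite_morphism (X Y : scheme) (f : morphism X Y) : Prop :=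
  forall V : opens Y, affine V ->
    affine (mpreim f V) /\ module_finite (comor f V).

(* A topological closed embedding that is surjective on stalks. *)
Record closed_immersion (X Y : scheme) (f : morphism X Y) : Prop :=
    ClosedImmersion {
  cimm_inj : injective f;
  cimm_closed : closed (range f);
  cimm_embed : forall U : opens X, exists V : opens Y, f @^-1` V = U;
  cimm_surj : forall (x : X) (U : opens X) (t : sec X U), U x ->
    exists (V : opens Y) (s : sec Y V) (W : opens X)
           (hU : W `<=` U) (hV : W `<=` mpreim f V),
      W x /\ res hV (comor f V s) = res hU t }.

Definition irreducible (X : scheme) : Prop := irreducible_set [set: X].

Definition reduced (X : scheme) : Prop :=
  forall (U : opens X) (s : sec X U) (n : nat), s ^+ n = 0 -> s = 0.

Definition integral_scheme (X : scheme) : Prop := irreducible X /\ reduced X.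

(* The stalk at x is an integral domain that is integrally closed in its field
   of fractions; finitely many germs at x are represented on a common U, and
   a root a / b of a monic polynomial is tested after clearing denominators. *)
Record normal_at (X : scheme) (x : X) : Prop := NormalAt {
  normal_domain : forall (U : opens X) (s t : sec X U), U x ->
    germ_zero (s * t) x -> germ_zero s x \/ germ_zero t x;
  normal_closed : forall (U : opens X) (a b : sec X U), U x ->
    ~ germ_zero b x ->
    forall (n : nat) (c : 'I_n -> sec X U),
      germ_zero (a ^+ n + \sum_(i < n) c i * a ^+ i * b ^+ (n - i)) x ->
      exists (V : opens X) (h : V `<=` U) (d : sec X V),
        V x /\ res h a = d * res h b }.

Definition normal_scheme (X : scheme) : Prop := forall x : X, normal_at x.

(** * Schemes over a field *)

(* A morphism from X to Spec k amounts to a ring morphism from k to the global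
   sections of X. *)
Record kscheme (k : fieldType) := KScheme {
  kscheme_scheme :> scheme;
  kscheme_struct : {rmorphism k -> sec kscheme_scheme (opensT kscheme_scheme)} }.

Section OverField.
Variable k : fieldType.
Implicit Types X Y P : kscheme k.

Definition kconst X (U : opens X) (c : k) : sec X U :=
  @res X (opensT X) U (fun x _ => I) (kscheme_struct X c).

Definition over_k X Y (f : morphism X Y) : Prop :=
  forall (V : opens Y) (c : k), comor f V (kconst V c) = kconst (mpreim f V) c.

(* The points with residue field k, i.e. the sections of X -> Spec k. *)
Definition rational_points X : set X :=
  [set x | forall (U : opens X) (s : sec X U), U x ->
     exists c : k, ~ germ_unit (s - kconst U c) x].

Definition finitely_generated X (U : opens X) : Prop :=
  exists (m : nat) (g : 'I_m -> sec X U),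
    forall S : set (sec X U),
      (forall c, S (kconst U c)) -> (forall i, S (g i)) ->
      (forall s t, S s -> S t -> S (s + t)) ->
      (forall s t, S s -> S t -> S (s * t)) ->
      forall s, S s.

Definition finite_type X : Prop :=
  exists (m : nat) (U : 'I_m -> opens X),
    (forall x : X, exists i, U i x) /\
    (forall i, affine (U i) /\ finitely_generated (U i)).

(* The infinitesimal lifting property for the k-algebra O(U). *)
Definition formally_smooth X (U : opens X) : Prop :=
  forall (A B : comPzRingType) (q : {rmorphism A -> B})
      (u : {rmorphism k -> A}) (g : {rmorphism sec X U -> B}),
    (forall b : B, exists a : A, q a = b) ->
    (forall a b : A, q a = 0 -> q b = 0 -> a * b = 0) ->
    (forall c : k, g (kconst U c) = q (u c)) ->
    exists h : {rmorphism sec X U -> A},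
      (forall c : k, h (kconst U c) = u c) /\ (forall s, q (h s) = g s).

(* To be used on schemes of finite type, where formal smoothness near x is
   smoothness at x. *)
Definition smooth_at X (x : X) : Prop :=
  exists U : opens X, [/\ affine U, U x & formally_smooth U].

(* P is projective n-space: it is covered by affine charts U i, where O(U i) is
   the polynomial ring over k in the t i j = T_j / T_i with j != i, stated by
   its universal property, and U i, U j are glued along D(t i j) by
   t i j * t j l = t i l. *)
Definition is_proj_space P (n : nat) : Prop :=
  exists (U : 'I_n.+1 -> opens P)
         (t : forall i : 'I_n.+1, 'I_n.+1 -> sec P (U i)),
    [/\ (forall x : P, exists i, U i x),
        (forall i, affine (U i)),
        (forall i, t i i = 1 /\
           forall (A : comPzRingType) (u : {rmorphism k -> A})
                  (a : 'I_n.+1 -> A), a i = 1 ->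
             (exists g : {rmorphism sec P (U i) -> A},
               (forall c, g (kconst (U i) c) = u c) /\
               (forall j, g (t i j) = a j)) /\
             (forall g g' : {rmorphism sec P (U i) -> A},
               (forall c, g (kconst (U i) c) = g' (kconst (U i) c)) ->
               (forall j, g (t i j) = g' (t i j)) -> g =1 g')),
        (forall i j, basic_open (t i j) = U i `&` U j :> set P) &
        (forall i j l (hi : opensI (U i) (U j) `<=` U i)
                      (hj : opensI (U i) (U j) `<=` U j),
           res hi (t i j) * res hj (t j l) = res hi (t i l))].

Definition projective X : Prop :=
  exists (n : nat) (P : kscheme k) (i : morphism X P),
    [/\ is_proj_space P n, over_k i & closed_immersion i].

Definition normal_projective_curve X : Prop :=
  [/\ integral_scheme X, normal_scheme X, projective X & krull_dim X 1].

Definition irreducible_curve X : Prop :=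
  [/\ finite_type X, irreducible X & krull_dim X 1].

End OverField.

Arguments rational_points {k} X.

(** * Fields *)

Definition perfect_field (k : fieldType) : Prop :=
  forall p : {poly k}, irreducible_poly p -> separable_poly p.

Definition large_field (k : fieldType) : Prop :=
  forall X : kscheme k, irreducible_curve X ->
    (exists x : X, rational_points X x /\ smooth_at x) ->
    infinite_set (rational_points X).

(* Main.v *)
(* Let P be a rational point of D that is not in f(C(k)), and t a uniformizer
   at P. The coordinates of D near P satisfy a system z_i = c_i + t p_i(z) with
   polynomials p_i over k; its unique solution in k[[t]] generates a subring of
   a field of dimension one over k which is smooth at the point c, so that k,
   being large, has infinitely many points at which all the polynomial relations
   of the power series solution hold. These points give rational points of D near
   P. Applied to the system together with its image under t |-> d t, this
   shows that every d in k is a quotient of two values of t.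
   The new points are again missed by f. Since k is perfect and no point of C(k)
   lies above P, there are an element b of the algebra of the fibre of f and a
   separable polynomial h without roots in k such that h(b) is nilpotent in the
   fibre at P. By Cayley-Hamilton, b is a root near P of some chi congruent to
   h^M modulo t^2. By Newton approximation, h has a root modulo chi over k[[t]],
   whose coefficients are added to the unknowns of the system; at the new points
   h has a root modulo chi over k, hence chi has no root in k.
   If S is the set of missed points, then k embeds in S x S, hence in the
   infinite set S, and S embeds in k through the homogeneous coordinates. *)
Require Import Defs.
From mathcomp Require Import all_boot all_algebra all_field.
From HB Require Import structures.
From mathcomp Require Import mpoly ring.
From mathcomp Require Import all_classical topology.
Set Implicit Arguments.
Unset Strict Implicit.
Unset Printing Implicit Defensive.
Import GRing.Theory.
Local Open Scope classical_set_scope.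
Local Open Scope ring_scope.

(** Systems z = c + t p(z) suit the argument because at t = 0 their Jacobian matrix is the identity,
    so power series solutions and infinitesimal lifts come for free, and because unknowns can be
    added and t rescaled within the class. The price is that the equations may define more than the
    wanted branch. The curve is therefore defined by all relations of the solution, and two
    determinants with value 1 at c are inverted: one makes the equations generate the relations, the
    other is the Jacobian. Dimension one rests on the algebraicity of the solution over k(t). Direct
    elimination can fail, as the leading terms of the p_i are arbitrary; dominant terms e z_i^(d+1)
    with a parameter e are added, and e is set to 0 at the end. The matrix by which h(b)^N acts on
    module generators has entries divisible by t, its square entries divisible by t^2. Both factors
    are spent: one in Y = Y0 + t delta, one because the Newton equation must again read delta = t
    (...). Infinitely many missed points alone would not give the cardinality |k|, whence the
    prescribed ratios. *)

(** * Comparison of cardinals *)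

Definition embeds (T U : Type) (A : set T) (B : set U) : Prop :=
  exists f : T -> U, (forall x, A x -> B (f x)) /\
    (forall x y, A x -> A y -> f x = f y -> x = y).

Lemma embeds_trans (T U V : Type) (A : set T) (B : set U) (C : set V) :
  embeds A B -> embeds B C -> embeds A C.
Proof.
move=> [f [fB fI]] [g [gC gI]]; exists (g \o f); split=> [x Ax|x y Ax Ay /= e].
  exact/gC/fB.
by apply: fI => //; apply: gI => //; exact: fB.
Qed.

Lemma embedsX (T U T' U' : Type) (A : set T) (B : set U) (A' : set T')
    (B' : set U') : embeds A B -> embeds A' B' -> embeds (A `*` A') (B `*` B').
Proof.
move=> [f [fB fI]] [g [gB gI]]; exists (fun p => (f p.1, g p.2)).
split=> [[x y] [/= Ax Ay]|[x y] [x' y'] [/= Ax Ay] [/= Ax' Ay'] [e1 e2]].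
  by split; [exact: fB|exact: gB].
by congr pair; [exact: fI|exact: gI].
Qed.

Lemma embeds_card_le (T U : Type) (A : set T) (B : set U) :
  embeds A B -> (A #<= B)%card.
Proof.
move=> [f [fB fI]]; have [g] : $|{injfun A >-> B}|.
  apply/injfunPex; exists f => // x y xA yA; apply: fI; exact: set_mem.
exact: inj_card_le.
Qed.

(** Only injectivity in the first argument is asked of [H]; choice makes it a function. The element
    of [U] is the value outside [A]. *)
Lemma graph_embeds (T U : Type) (A : set T) (B : set U) (H : set (T * U)) :
  (forall x, A x -> exists2 y, B y & H (x, y)) ->
  (forall x x' y, H (x, y) -> H (x', y) -> x = x') -> U -> embeds A B.
Proof.
move=> tot inj y0.
have /choice[f fP] : forall x, exists y, A x -> B y /\ H (x, y).
  move=> x; have [/tot[y By Hy]|nA] := pselect (A x); first by exists y.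
  by exists y0.
exists f; split=> [x /fP[]//|x y /fP[_ Hx] /fP[_ Hy] e].
by apply: inj Hx _; rewrite e.
Qed.

(** A maximal partial injection, given by Zorn's lemma, exhausts [A] or [B], since otherwise one
    more pair could be added to its graph. *)
Lemma embeds_total (T U : Type) (A : set T) (B : set U) (x0 : T) (y0 : U) :
  embeds A B \/ embeds B A.
Proof.
pose P (H : set (T * U)) := [/\ forall x y, H (x, y) -> A x /\ B y,
  forall x y y', H (x, y) -> H (x, y') -> y = y' &
  forall x x' y, H (x, y) -> H (x', y) -> x = x'].
have [F FP tF|H [[HAB Hf Hi] Hmax]] := @Zorn_bigcup _ P.
  have two p q : (\bigcup_(X in F) X) p -> (\bigcup_(X in F) X) q ->
      exists X, [/\ F X, X p & X q].
    move=> [X FX Xp] [Y FY Yq]; have [/(_ p)XY|/(_ q)YX] := tF _ _ FX FY.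
      by exists Y; split=> //; exact: XY.
    by exists X; split=> //; exact: YX.
  split=> [x y [X FX /= Xp]|x y y' h h'|x x' y h h'].
  - by have [+ _ _] := FP X FX; apply; exact: Xp.
  - have [X [FX h1 h2]] := two _ _ h h'.
    by have [_ + _] := FP X FX => /(_ _ _ _ h1 h2).
  - have [X [FX h1 h2]] := two _ _ h h'.
    by have [_ _] := FP X FX => /(_ _ _ _ h1 h2).
have [totA|/existsNP[x /not_implyP[Ax nx]]] :=
    pselect (forall x, A x -> exists2 y, B y & H (x, y)).
  by left; exact: graph_embeds totA Hi y0.
have [totB|/existsNP[y /not_implyP[By ny]]] :=
    pselect (forall y, B y -> exists2 x, A x & H (x, y)).
  right; apply: (@graph_embeds _ _ B A (fun p => H (p.2, p.1))) => // a b z.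
  exact: Hf.
case: (Hmax (H `|` [set (x, y)])).
  split=> [p|/(_ (x, y) (or_intror erefl)) Hxy]; first by left.
  by apply: nx; exists y.
have nHx y' : ~ H (x, y') by move=> h; apply: nx; exists y'; have [] := HAB _ _ h.
have nHy x' : ~ H (x', y) by move=> h; apply: ny; exists x'; have [] := HAB _ _ h.
split=> [a b [/HAB//|[-> ->//]]|a b b'|a a' b].
- move=> [h1|E1] [h2|E2]; first exact: Hf h1 h2.
  + by case: (nHx b); case: E2 => <- _.
  + by case: (nHx b'); case: E1 => <- _.
  + by case: E1 E2 => _ -> [_ ->].
- move=> [h1|E1] [h2|E2]; first exact: Hi h1 h2.
  + by case: (nHy a); case: E2 => _ <-.
  + by case: (nHy a'); case: E1 => _ <-.
  + by case: E1 E2 => -> _ [-> _].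
Qed.

Lemma infinite_embeds_nat (T : Type) (A : set T) :
  infinite_set A -> embeds [set: nat] A.
Proof.
move=> infA; have [a0 Aa0] := infinite_setN0 infA.
have /infiniteP := infA; elim/Ppointed: T => T in A infA a0 Aa0 *.
  by case: (no a0).
move=> /pcard_leP[f]; exists f; split=> [x _|x y _ _]; first exact: funS.
by apply: inj; exact: mem_set.
Qed.

(** Zorn's lemma gives a maximal injection Y x Y -> Y with Y an infinite subset of [A]. If Y were
    too small, Y would have a disjoint copy in [A], and the injection would extend to the union. *)
Lemma embeds_square (T : Type) (A : set T) :
  infinite_set A -> embeds (A `*` A) A.
Proof.
move=> infA; have [a0 Aa0] := infinite_setN0 infA.
have [f0 [f0A f0I]] := infinite_embeds_nat infA.
pose h0 (p : nat * nat) := pickle p.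
have h0I : injective h0 by exact: (pcan_inj pickleK).
pose G0 : set (T * T * T) :=
  [set q | exists i j, q = (f0 i, f0 j, f0 (h0 (i, j)))].
(* [X G] is the set Y on which [G] is an operation, read off the diagonal. *)
pose X (G : set (T * T * T)) : set T := [set x | exists y, G (x, x, y)].
pose good G := [/\ forall p y y', G (p, y) -> G (p, y') -> y = y',
  forall p p' y, G (p, y) -> G (p', y) -> p = p',
  forall x x', X G x -> X G x' -> exists y, G (x, x', y),
  forall x x' y, G (x, x', y) -> [/\ X G x, X G x' & X G y] &
  X G `<=` A].
(* The countable seed [G0] is added inside [P] because the empty chain must have an upper bound
   too. *)
pose P G := good (G0 `|` G).
have XS G G' : G `<=` G' -> X G `<=` X G'.
  by move=> GG' x [y h]; exists y; exact: GG'.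
have f0E i j : f0 i = f0 j -> i = j by exact: f0I.
have good0 : good G0.
  have X0 i : X G0 (f0 i) by exists (f0 (h0 (i, i))), i, i.
  split=> [p y y' [i [j [-> ->]]] [i' [j' [/f0E-> /f0E-> ->]]]//| | | |].
  - move=> p p' y [i [j [-> ->]]] [i' [j' [-> /f0E/h0I[-> ->]]]] //.
  - move=> x x' [y [i [_ [-> _ _]]]] [y' [j [_ [-> _ _]]]].
    by exists (f0 (h0 (i, j))), i, j.
  - by move=> x x' y [i [j [-> -> ->]]].
  - by move=> x [y [i [j [-> _ _]]]]; exact: f0A.
have [F FP tF|G [PG Gmax]] := @Zorn_bigcup _ P.
  have [->|[Z0 FZ0]] : F = set0 \/ F !=set0.
    by have [->|/set0P] := eqVneq F set0; [left|right].
    by rewrite /P bigcup_set0 setU0.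
  have sub Z : F Z -> G0 `|` Z `<=` G0 `|` \bigcup_(Y in F) Y.
    by move=> FZ q [|h]; [left|right; exists Z].
  have one q : (G0 `|` \bigcup_(Y in F) Y) q -> exists2 Z, F Z & (G0 `|` Z) q.
    by move=> [h|[Z FZ Zq]]; [exists Z0 => //; left|exists Z => //; right].
  have two q q' : (G0 `|` \bigcup_(Y in F) Y) q ->
      (G0 `|` \bigcup_(Y in F) Y) q' ->
      exists Z, [/\ F Z, (G0 `|` Z) q & (G0 `|` Z) q'].
    move=> /one[Z FZ Zq] /one[Y FY Yq]; have [h|h] := tF _ _ FZ FY.
      exists Y; split=> //; exact: setUS h _ Zq.
    exists Z; split=> //; exact: setUS h _ Yq.
  split=> [p y y' /two h /h[Z [FZ h1 h2]]|p p' y /two h /h[Z [FZ h1 h2]]| | |].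
  - by have [+ _ _ _ _] := FP Z FZ => /(_ _ _ _ h1 h2).
  - by have [_ + _ _ _] := FP Z FZ => /(_ _ _ _ h1 h2).
  - move=> x x' [y /two h] [y' /h[Z [FZ h1 h2]]].
    have [_ _ + _ _] := FP Z FZ => /(_ x x').
    by case; [exists y|exists y'|move=> z hz; exists z; exact: sub hz].
  - move=> x x' y /one[Z FZ h]; have [_ _ _ + _] := FP Z FZ => /(_ _ _ _ h)[].
    by move=> h1 h2 h3; split; apply: XS; try exact: (sub Z).
  - move=> x [y /one[Z FZ h]]; have [_ _ _ _ +] := FP Z FZ; apply.
    by exists y.
pose H := G0 `|` G; pose Y := X H.
have [Hf Hi Hd HX YA] : good H by [].
have Y0 i : Y (f0 i) by apply: (XS G0) => [q|]; [left|exists (f0 (h0 (i, i))), i, i].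
have YY : embeds (Y `*` Y) Y.
  apply: (@graph_embeds _ _ _ _ H _ Hi a0) => -[x x'] [/= Yx Yx'].
  by have [y h] := Hd _ _ Yx Yx'; exists y => //; have [] := HX _ _ _ h.
(* In the first case [A] embeds in Y x Y, hence in Y. In the second one [B], the image of Y, is the
   disjoint copy. *)
have [[g [gY gI]]|[g [gA gI]]] := embeds_total (A `\` Y) Y a0 a0.
  have AY : embeds A (Y `*` Y).
    exists (fun x => if pselect (Y x) then (f0 0%N, x) else (f0 1%N, g x)).
    split=> [x Ax|x y Ax Ay].
      by case: pselect => h; split=> //=; apply: gY.
    by do 2 case: pselect => ? [] //; try move/f0E => //; move=> ?; exact: gI.
  have AA := embeds_trans AY YY.
  apply: embeds_trans (embedsX AA AA) (embeds_trans YY _).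
  by exists id; split=> // x; exact: YA.
have [e3 [e3Y e3I]] : embeds (`I_3 `*` (Y `*` Y)) Y.
  apply: embeds_trans (embedsX _ YY) YY.
  by exists f0; split=> // x y _ _; exact: f0E.
pose B := g @` Y.
have [m [mY mI]] : embeds B Y.
  apply: (@graph_embeds _ _ _ _ (fun p => Y p.2 /\ g p.2 = p.1) _ _ a0).
    by move=> _ [x Yx <-]; exists x.
  by move=> x x' y /= [_ <-] [_ <-].
have BY x : B x -> ~ Y x by move=> [y Yy <-]; have [] := gA y Yy.
have BA x : B x -> A x by move=> [y Yy <-]; have [] := gA y Yy.
pose Z := Y `|` B.
(* A pair of Z x Z outside Y x Y lies in Y x B, B x Y or B x B. [lab] records which, together with a
   pair of Y x Y; hence all new pairs embed in Y, and through [g] in [B]. *)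
pose lab (p : T * T) : nat * (T * T) :=
  if pselect (Y p.1) then (0%N, (p.1, m p.2)) else
  if pselect (Y p.2) then (1%N, (m p.1, p.2)) else (2%N, (m p.1, m p.2)).
pose N := [set p : T * T | [/\ Z p.1, Z p.2 & ~ (Y p.1 /\ Y p.2)]].
have BZ x : Z x -> ~ Y x -> B x by case.
have labY p : N p -> (`I_3 `*` (Y `*` Y)) (lab p).
  move=> [Z1 Z2 nY]; rewrite /lab; case: pselect => h1.
    by split=> //; split=> //; apply/mY/BZ => // h2; exact: nY.
  by case: pselect => h2; split=> //; split=> //; apply/mY/BZ.
have labI p q : N p -> N q -> lab p = lab q -> p = q.
  case: p q => [x y] [x' y'] [/= Z1 Z2 nY] [/= Z1' Z2' nY']; rewrite /lab /=.
  do 4?[case: pselect => ?] => // -[] e1 e2; congr pair => //; apply: mI => //;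
    apply: BZ => // ?; by [apply: nY|apply: nY'].
pose ext p := g (e3 (lab p)).
have extB p : N p -> B (ext p).
  by move=> Np; exists (e3 (lab p)) => //; exact/e3Y/labY.
pose G' := G `|` [set q | N q.1 /\ q.2 = ext q.1].
have HE : G0 `|` G' = H `|` [set q | N q.1 /\ q.2 = ext q.1].
  by rewrite /G' setUA.
have HN p y : H (p, y) -> ~ N p.
  by case: p => a b h [_ _]; apply; have [] := HX _ _ _ h.
have XE x : X (G0 `|` G') x <-> Z x.
  rewrite HE; split=> [[y [h|[[//]]]]|Zx]; first by left; have [] := HX _ _ _ h.
  have [[y h]|nY] := pselect (Y x); first by exists y; left.
  by exists (ext (x, x)); right; split=> //; split=> // -[].
exfalso; apply: (Gmax G').
  split=> [q|GG']; first by left.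
  have : Z (g (f0 0%N)) by right; exists (f0 0%N) => //; exact: Y0.
  have gN : ~ Y (g (f0 0%N)) by have [] := gA _ (Y0 0%N).
  move=> Zg; apply: (gN).
  have : N (g (f0 0%N), g (f0 0%N)) by split=> // -[].
  move=> Ng; have /GG' h : G' (g (f0 0%N), g (f0 0%N), ext (g (f0 0%N), g (f0 0%N))).
    by right.
  by have /HX[] : H (g (f0 0%N), g (f0 0%N), ext (g (f0 0%N), g (f0 0%N))) by right.
rewrite /P; split=> [p y y'|p p' y|x x'|x x' y|x].
- rewrite HE => -[h1|[/= n1 ->]] [h2|[/= n2 ->]] //; first exact: Hf h1 h2.
    by case: (HN _ _ h1).
  by case: (HN _ _ h2).
- have HY q : H (q, y) -> Y y by case: q => a b /HX[].
  rewrite HE => -[h1|[/= n1 e1]] [h2|[/= n2 e2]] //; first exact: Hi h1 h2.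
  + by case: (BY y); [rewrite e2; exact: extB|exact: HY h1].
  + by case: (BY y); [rewrite e1; exact: extB|exact: HY h2].
  + apply: labI => //; apply: e3I; [exact: labY|exact: labY|].
    by apply: gI; [exact/e3Y/labY|exact/e3Y/labY|rewrite -/(ext p) -/(ext p') -e1].
- move=> /XE Zx /XE Zx'; rewrite HE.
  have [[Yx Yx']|n] := pselect (Y x /\ Y x').
    by have [y h] := Hd _ _ Yx Yx'; exists y; left.
  by exists (ext (x, x')); right.
- rewrite [X in X _]HE => -[/HX[h1 h2 h3]|[/= n e]].
    by split; apply/XE; left.
  by have [Z1 Z2 _] := n; split; apply/XE => //; right; rewrite e; exact: extB.
- by move=> /XE[/YA|/BA].
Qed.

Lemma embeds_ffun (T : Type) (m : nat) :
  infinite_set [set: T] -> embeds [set: 'I_m -> T] [set: T].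
Proof.
move=> infT; have [t0 _] := infinite_setN0 infT.
have TT := embeds_square infT; rewrite setXTT in TT.
elim: m => [|m IHm].
  by exists (fun _ => t0); split=> // x y _ _ _; apply/funext => -[].
apply: embeds_trans TT.
have [f [_ fI]] := IHm.
exists (fun h => (h ord0, f (fun i => h (lift ord0 i)))); split=> // x y _ _ [e0 e].
apply/funext => i; case: (unliftP ord0 i) => [j|] -> //.
by have /(congr1 (fun h => h j)) := fI _ _ I I e.
Qed.

(** A name of its own, so that the product on it is the Cauchy product and not the pointwise one. *)
Definition pser (R : Type) : Type := nat -> R.

(** * Power series *)

Section PowerSeriesRing.
Variable R : comNzRingType.
Implicit Types f g h : pser R.

HB.instance Definition _ := gen_eqMixin (pser R).
HB.instance Definition _ := gen_choiceMixin (pser R).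

Definition ps_add f g : pser R := fun n => f n + g n.
Definition ps_opp f : pser R := fun n => - f n.
Definition ps_zero : pser R := fun _ => 0.
Definition ps_one : pser R := fun n => (n == 0)%:R.
Definition ps_mul f g : pser R := fun n => \sum_(i < n.+1) f i * g (n - i)%N.

Fact ps_addA : associative ps_add.
Proof. by move=> f g h; apply/funext => n; exact: addrA. Qed.
Fact ps_addC : commutative ps_add.
Proof. by move=> f g; apply/funext => n; exact: addrC. Qed.
Fact ps_add0 : left_id ps_zero ps_add.
Proof. by move=> f; apply/funext => n; exact: add0r. Qed.
Fact ps_addN : left_inverse ps_zero ps_opp ps_add.
Proof. by move=> f; apply/funext => n; exact: addNr. Qed.

HB.instance Definition _ :=
  GRing.isZmodule.Build (pser R) ps_addA ps_addC ps_add0 ps_addN.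

Definition ps_trunc N f : {poly R} := \poly_(i < N) f i.

(** Coefficients below [N] see only truncations, so the ring axioms are inherited from
    polynomials. *)
Lemma ps_mul_trunc N f g n :
  (n < N)%N -> ps_mul f g n = (ps_trunc N f * ps_trunc N g)`_n.
Proof.
move=> nN; rewrite coefM; apply: eq_bigr => i _; rewrite !coef_poly.
by rewrite !(leq_ltn_trans _ nN) ?leq_subr // -ltnS ltn_ord.
Qed.

Lemma coefM_congr (p p' q : {poly R}) n :
  (forall i, (i <= n)%N -> p`_i = p'`_i) -> (p * q)`_n = (p' * q)`_n.
Proof.
by move=> e; rewrite !coefM; apply: eq_bigr => i _; rewrite e // -ltnS ltn_ord.
Qed.

Fact ps_mulC : commutative ps_mul.
Proof.
by move=> f g; apply/funext => n; rewrite !(@ps_mul_trunc n.+1) // mulrC.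
Qed.

Fact ps_mulA : associative ps_mul.
Proof.
have tr f g h n : ps_mul (ps_mul f g) h n =
    (ps_trunc n.+1 f * ps_trunc n.+1 g * ps_trunc n.+1 h)`_n.
  rewrite (@ps_mul_trunc n.+1) //; apply: coefM_congr => i le_in.
  by rewrite coef_poly ltnS le_in (@ps_mul_trunc n.+1) // ltnS.
move=> f g h; apply/funext => n; rewrite tr ps_mulC tr.
by rewrite mulrC mulrA.
Qed.

Fact ps_mul1 : left_id ps_one ps_mul.
Proof.
move=> f; apply/funext => n; rewrite /ps_mul big_ord_recl subn0 mul1r.
by rewrite big1 ?addr0 // => i _; rewrite mul0r.
Qed.

Fact ps_mulDl : left_distributive ps_mul ps_add.
Proof.
move=> f g h; apply/funext => n; rewrite /ps_mul /ps_add -big_split /=.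
by apply: eq_bigr => i _; rewrite mulrDl.
Qed.

Fact ps_one_neq0 : ps_one != ps_zero.
Proof.
by apply/eqP => /(congr1 (fun f => f 0%N))/eqP; rewrite /= oner_eq0.
Qed.

HB.instance Definition _ := GRing.Zmodule_isComNzRing.Build (pser R)
  ps_mulA ps_mulC ps_mul1 ps_mulDl ps_one_neq0.

Lemma psD f g n : (f + g) n = f n + g n. Proof. by []. Qed.
Lemma psB f g n : (f - g) n = f n - g n. Proof. by []. Qed.
Lemma ps0 n : (0 : pser R) n = 0. Proof. by []. Qed.
Lemma ps1 n : (1 : pser R) n = (n == 0)%:R. Proof. by []. Qed.
Lemma psM f g n : (f * g) n = \sum_(i < n.+1) f i * g (n - i)%N.
Proof. by []. Qed.
Lemma psM0 f g : (f * g) 0%N = f 0%N * g 0%N.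
Proof. by rewrite psM big_ord1. Qed.

Definition ps_coef0 f : R := f 0%N.
Fact ps_coef0_zmod : zmod_morphism ps_coef0.
Proof. by []. Qed.
Fact ps_coef0_monoid : monoid_morphism ps_coef0.
Proof. by split=> // f g; exact: psM0. Qed.
HB.instance Definition _ :=
  GRing.isZmodMorphism.Build (pser R) R ps_coef0 ps_coef0_zmod.
HB.instance Definition _ :=
  GRing.isMonoidMorphism.Build (pser R) R ps_coef0 ps_coef0_monoid.

Definition ps_poly (p : {poly R}) : pser R := fun n => p`_n.
Fact ps_poly_zmod : zmod_morphism ps_poly.
Proof. by move=> p q; apply/funext => n; rewrite /ps_poly coefB. Qed.
Fact ps_poly_monoid : monoid_morphism ps_poly.
Proof.
split=> [|p q]; apply/funext => n; rewrite /ps_poly; first by rewrite coef1 ps1.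
by rewrite coefM psM.
Qed.
HB.instance Definition _ :=
  GRing.isZmodMorphism.Build {poly R} (pser R) ps_poly ps_poly_zmod.
HB.instance Definition _ :=
  GRing.isMonoidMorphism.Build {poly R} (pser R) ps_poly ps_poly_monoid.

Lemma ps_poly_inj : injective ps_poly.
Proof.
by move=> p q e; apply/polyP => n; exact: (congr1 (fun f : pser R => f n) e).
Qed.

Definition ps_X : pser R := ps_poly 'X.
Definition ps_C : {rmorphism R -> pser R} := ps_poly \o polyC.

Lemma ps_CE c n : ps_C c n = if n == 0%N then c else 0.
Proof. exact: coefC. Qed.

Lemma ps_CM c f n : (ps_C c * f) n = c * f n.
Proof.
rewrite psM big_ord_recl ps_CE subn0 big1 ?addr0 // => i _.
by rewrite ps_CE mul0r.
Qed.

Lemma ps_XM f n : (ps_X * f) n = if n is m.+1 then f m else 0.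
Proof.
have XE i : ps_X i = (i == 1%N)%:R by rewrite /ps_X /ps_poly coefX.
rewrite psM; case: n => [|n]; first by rewrite big_ord1 XE mul0r.
rewrite big_ord_recl XE mul0r add0r big_ord_recl XE mul1r subSS subn0.
by rewrite big1 ?addr0 // => i _; rewrite XE mul0r.
Qed.

Lemma ps_XI : injective (fun f => ps_X * f).
Proof.
move=> f g e; apply/funext => n.
by have := congr1 (fun h : pser R => h n.+1) e; rewrite !ps_XM.
Qed.

(** The substitution t |-> c t. *)
Definition ps_scale (c : R) f : pser R := fun n => c ^+ n * f n.

Fact ps_scale_zmod c : zmod_morphism (ps_scale c).
Proof. by move=> f g; apply/funext => n; rewrite /ps_scale psB mulrBr. Qed.
Fact ps_scale_monoid c : monoid_morphism (ps_scale c).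
Proof.
split=> [|f g]; apply/funext => n; rewrite /ps_scale.
  by rewrite ps1; case: n => [|n]; rewrite ?expr0 ?mulr1 ?mulr0.
rewrite !psM mulr_sumr; apply: eq_bigr => i _.
by rewrite mulrACA -exprD subnKC // -ltnS ltn_ord.
Qed.
HB.instance Definition _ c :=
  GRing.isZmodMorphism.Build (pser R) (pser R) (ps_scale c) (ps_scale_zmod c).
HB.instance Definition _ c :=
  GRing.isMonoidMorphism.Build (pser R) (pser R) (ps_scale c) (ps_scale_monoid c).

Lemma ps_scaleC c d : ps_scale c (ps_C d) = ps_C d.
Proof.
apply/funext => n; rewrite /ps_scale ps_CE.
by case: n => [|n]; rewrite ?mul1r ?mulr0.
Qed.

Lemma ps_scaleX c : ps_scale c ps_X = ps_C c * ps_X.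
Proof.
apply/funext => n; rewrite ps_CM /ps_scale /ps_X /ps_poly coefX.
by case: n => [|[|n]]; rewrite ?mulr0 ?expr1.
Qed.

End PowerSeriesRing.

Section PowerSeriesMap.
Variables (R S : comNzRingType) (phi : {rmorphism R -> S}).

Definition ps_map (f : pser R) : pser S := fun n => phi (f n).
Fact ps_map_zmod : zmod_morphism ps_map.
Proof. by move=> f g; apply/funext => n; rewrite /ps_map psB rmorphB. Qed.
Fact ps_map_monoid : monoid_morphism ps_map.
Proof.
split=> [|f g]; apply/funext => n; rewrite /ps_map ?psM ?ps1 ?rmorph_nat //.
by rewrite rmorph_sum; apply: eq_bigr => i _; rewrite rmorphM.
Qed.
HB.instance Definition _ :=
  GRing.isZmodMorphism.Build (pser R) (pser S) ps_map ps_map_zmod.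
HB.instance Definition _ :=
  GRing.isMonoidMorphism.Build (pser R) (pser S) ps_map ps_map_monoid.

Lemma ps_map_poly p : ps_map (ps_poly p) = ps_poly (map_poly phi p).
Proof. by apply/funext => n; rewrite /ps_map /ps_poly coef_map. Qed.

Lemma ps_mapX : ps_map (ps_X R) = ps_X S.
Proof. by rewrite ps_map_poly map_polyX. Qed.

Lemma ps_mapC c : ps_map (ps_C R c) = ps_C S (phi c).
Proof. by rewrite ps_map_poly map_polyC. Qed.

End PowerSeriesMap.

Section ClassicalUnits.
Variable R : comNzRingType.

(** Inverses are chosen classically. They serve to make power series an integral domain, which then
    has a field of fractions. *)
Definition cl_unit : pred R := fun x => `[< exists y, y * x = 1 >].
Definition cl_inv (x : R) : R :=
  if pselect (exists y, y * x = 1) is left h then projT1 (cid h) else x.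

Fact cl_mulV : {in cl_unit, left_inverse 1 cl_inv *%R}.
Proof.
move=> x /asboolP h; rewrite /cl_inv; case: pselect => // h'.
by case: (cid h').
Qed.
Fact cl_unitP (x y : R) : y * x = 1 -> cl_unit x.
Proof. by move=> e; apply/asboolP; exists y. Qed.
Fact cl_inv_out : {in [predC cl_unit], cl_inv =1 id}.
Proof.
by move=> x /asboolP h; rewrite /cl_inv; case: pselect.
Qed.
End ClassicalUnits.

HB.instance Definition _ (R : comNzRingType) :=
  GRing.ComNzRing_hasMulInverse.Build (pser R)
    (@cl_mulV (pser R)) (@cl_unitP (pser R)) (@cl_inv_out (pser R)).

(** If [m] is the order of [f] and the coefficients of [g] below n vanish, then coefficient m + n of
    the product is f_m g_n. *)
Fact ps_integral (R : idomainType) (f g : pser R) :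
  f * g = 0 -> (f == 0) || (g == 0).
Proof.
move=> fg0; apply/orP; have [_|f0] := eqVneq f 0; [by left|right].
have fx : exists n, f n != 0.
  apply: contrapT => nf; case/eqP: f0; apply/funext => n.
  by apply/eqP/negPn/negP => h; apply: nf; exists n.
case: (ex_minnP fx) => m fm mmin.
apply/eqP/funext => n; elim/ltn_ind: n => n IHn.
have := congr1 (fun u : pser R => u (m + n)%N) fg0; rewrite psM.
have lt : (m < (m + n).+1)%N by rewrite ltnS leq_addr.
rewrite (bigD1 (Ordinal lt)) //= addKn big1 ?addr0.
  by move/eqP; rewrite mulf_eq0 (negPf fm) /= => /eqP.
move=> i /eqP ne; have [im|mi] := ltnP i m.
  have [->|fi] := eqVneq (f i) 0; first by rewrite mul0r.
  by have := mmin _ fi; rewrite leqNgt im.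
rewrite [g _]IHn ?mulr0 ?ps0 // ltn_subLR; last by rewrite -ltnS ltn_ord.
rewrite ltn_add2r ltn_neqAle mi andbT; apply/eqP => e; apply: ne.
exact: val_inj.
Qed.
HB.instance Definition _ (R : idomainType) :=
  GRing.ComUnitRing_isIntegral.Build (pser R) (@ps_integral R).

Section MpolyBasics.
Variable n : nat.

Lemma mpoly_alg_ind (R : comNzRingType) (P : {mpoly R[n]} -> Prop) :
  (forall c, P c%:MP) -> (forall i, P 'X_i) ->
  (forall p q, P p -> P q -> P (p + q)) ->
  (forall p q, P p -> P q -> P (p * q)) -> forall p, P p.
Proof.
move=> PC PX PD PM p; rewrite (mpolyE p).
have P1 : P 1 by rewrite -mpolyC1.
elim/big_ind: _ => [||m _]; [by rewrite -mpolyC0|exact: PD|].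
rewrite -mul_mpolyC; apply: (PM) => //; rewrite mpolyXE_id.
elim/big_ind: _ => [||i _]; [by []|exact: PM|].
by elim: (m i) => [|d IHd]; [rewrite expr0|rewrite exprS; exact: PM].
Qed.

Lemma rmorph_mmap (R S S' : comNzRingType) (f : {rmorphism R -> S})
    (g : {rmorphism S -> S'}) (f' : {rmorphism R -> S'}) (h : 'I_n -> S)
    (h' : 'I_n -> S') :
  (forall c, g (f c) = f' c) -> (forall i, g (h i) = h' i) ->
  forall p, g (mmap f h p) = mmap f' h' p.
Proof.
move=> ef eh; apply: mpoly_alg_ind => [c|i|p q Hp Hq|p q Hp Hq].
- by rewrite !mmapC ?ef.
- by rewrite !mmapX !mmap1U eh.
- by rewrite !rmorphD Hp Hq.
- by rewrite !rmorphM Hp Hq.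
Qed.

Lemma mmap_XU (R S : comNzRingType) (f : {rmorphism R -> S}) (h : 'I_n -> S) i :
  mmap f h 'X_i = h i.
Proof. by rewrite mmapX mmap1U. Qed.

End MpolyBasics.

(** * Systems z = c + t p(z) *)

Section NormalSystem.
Variables (R : comNzRingType) (n : nat) (c : 'I_n -> R) (p : 'I_n -> {mpoly R[n]}).

Definition ps_system (z : 'I_n -> pser R) : Prop :=
  forall i, z i = ps_C R (c i) + ps_X R * mmap (ps_C R) z (p i).

Definition ps_agree (m : nat) (f g : pser R) : Prop :=
  forall i, (i < m)%N -> f i = g i.

Lemma ps_agree_mmap m (u v : 'I_n -> pser R) (q : {mpoly R[n]}) :
  (forall i, ps_agree m (u i) (v i)) ->
  ps_agree m (mmap (ps_C R) u q) (mmap (ps_C R) v q).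
Proof.
move=> uv; elim/mpoly_alg_ind: q => [d|i|q r Hq Hr|q r Hq Hr] j jm.
- by rewrite !mmapC ?ef.
- by rewrite !mmap_XU; exact: uv.
- by rewrite !rmorphD /= !psD Hq ?Hr.
- rewrite !rmorphM /= !psM; apply: eq_bigr => l _.
  rewrite Hq ?Hr //; first exact: leq_ltn_trans (leq_subr _ _) jm.
  by rewrite (leq_ltn_trans _ jm) // -ltnS ltn_ord.
Qed.

(** The factor t gains one coefficient: the right-hand side of the system is a t-adic contraction,
    whence existence and uniqueness of the solution. *)
Lemma ps_agreeS m (u v : 'I_n -> pser R) (q : {mpoly R[n]}) (d : R) :
  (forall i, ps_agree m (u i) (v i)) ->
  ps_agree m.+1 (ps_C R d + ps_X R * mmap (ps_C R) u q)
                (ps_C R d + ps_X R * mmap (ps_C R) v q).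
Proof.
move=> uv [|j] jm; rewrite !psD !ps_XM //; congr (_ + _).
exact: ps_agree_mmap uv _ _.
Qed.

Lemma ps_system_unique (u v : 'I_n -> pser R) :
  ps_system u -> ps_system v -> u = v.
Proof.
move=> su sv; have uv m : forall i, ps_agree m (u i) (v i).
  elim: m => [//|m IHm] i; rewrite su sv; exact: ps_agreeS.
by apply/funext => i; apply/funext => m; apply: (uv m.+1).
Qed.

Lemma ps_system_exists : exists z, ps_system z.
Proof.
pose step (u : 'I_n -> pser R) i := ps_C R (c i) + ps_X R * mmap (ps_C R) u (p i).
pose it m := iter m step (fun i => ps_C R (c i)).
have itS m : forall i, ps_agree m (it m i) (it m.+1 i).
  elim: m => [//|m IHm] i; exact: ps_agreeS.
have itD m l : forall i, ps_agree m (it m i) (it (m + l)%N i).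
  elim: l => [|l IHl] i; first by rewrite addn0.
  move=> j jm; rewrite IHl // addnS; apply: itS.
  exact: leq_trans jm (leq_addr _ _).
(* Coefficient [m] no longer changes from iterate m + 1 on. *)
exists (fun i m => it m.+1 i m) => i; apply/funext => m.
have e : forall i, ps_agree m (it m i) (fun l => it l.+1 i l).
  move=> {}i j jm /=; have := itD j.+1 (m - j.+1)%N i j (ltnSn j).
  by rewrite subnKC.
by have := @ps_agreeS m _ _ (p i) (c i) e m (ltnSn m).
Qed.

End NormalSystem.

(** * Hilbert's basis theorem *)

Section Ideals.
Variable A : comNzRingType.

Definition is_ideal (J : A -> Prop) : Prop :=
  [/\ J 0, forall x y, J x -> J y -> J (x + y) & forall a x, J x -> J (a * x)].

(** As an intersection of ideals, so that induction on generated elements amounts to the choice of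
    [J]. *)
Definition ideal_gen (S : A -> Prop) (x : A) : Prop :=
  forall J, is_ideal J -> (forall y, S y -> J y) -> J x.

Definition noetherian_ring : Prop :=
  forall J, is_ideal J -> exists s : seq A,
    (forall x, x \in s -> J x) /\ forall x, J x -> ideal_gen (fun y => y \in s) x.

Lemma is_ideal_gen S : is_ideal (ideal_gen S).
Proof.
split=> [J [J0 _ _]//|x y gx gy J HJ SJ|a x gx J HJ SJ].
- by have [_ JD _] := HJ; apply: JD; [exact: gx|exact: gy].
- by have [_ _ JM] := HJ; apply: JM; exact: gx.
Qed.

Lemma ideal_gen_sub (S : A -> Prop) x : S x -> ideal_gen S x.
Proof. by move=> Sx J _; apply. Qed.

Lemma ideal_sum (J : A -> Prop) (I : finType) (F : I -> A) :
  is_ideal J -> (forall i, J (F i)) -> J (\sum_i F i).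
Proof. by move=> [J0 JD _] JF; elim/big_ind: _. Qed.

Lemma ideal_opp (J : A -> Prop) x : is_ideal J -> J x -> J (- x).
Proof. by move=> [_ _ JM] Jx; rewrite -mulN1r; exact: JM. Qed.

Lemma ideal_genP (s : seq A) x : ideal_gen (fun y => y \in s) x ->
  exists a : 'I_(size s) -> A, x = \sum_i a i * s`_i.
Proof.
move/(_ (fun x => exists a : 'I_(size s) -> A, x = \sum_i a i * s`_i)).
apply=> [|y ys]; first split.
- by exists (fun=> 0); rewrite big1 // => i _; rewrite mul0r.
- move=> y z [a ->] [b ->]; exists (fun i => a i + b i).
  by rewrite -big_split; apply: eq_bigr => i _; rewrite mulrDl.
- move=> b y [a ->]; exists (fun i => b * a i).
  by rewrite mulr_sumr; apply: eq_bigr => i _; rewrite mulrA.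
have lt : (index y s < size s)%N by rewrite index_mem.
exists (fun i => (i == Ordinal lt)%:R).
rewrite (bigD1 (Ordinal lt)) //= eqxx mul1r nth_index // big1 ?addr0 // => i.
by move=> /negPf->; rewrite mul0r.
Qed.

End Ideals.

Lemma noetherian_surj (A B : comNzRingType) (phi : {rmorphism A -> B}) :
  (forall b, exists a, phi a = b) -> noetherian_ring A -> noetherian_ring B.
Proof.
move=> surj nA J HJ; have [J0 JD JM] := HJ.
have HI : is_ideal (fun a => J (phi a)).
  split=> [|x y Jx Jy|a x Jx]; rewrite ?rmorph0 ?rmorphD ?rmorphM //.
    exact: JD.
  exact: JM.
have [s [sJ sgen]] := nA _ HI; exists [seq phi a | a <- s]; split.
  by move=> _ /mapP[a /sJ Ja ->].
move=> x; have [a <-] := surj x => /sgen.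
move/(_ (fun a => ideal_gen (fun y => y \in [seq phi a | a <- s]) (phi a))).
apply.
  have [g0 gD gM] := is_ideal_gen (fun y => y \in [seq phi a | a <- s]).
  split=> [|u v gu gv|b u gu]; rewrite ?rmorph0 ?rmorphD ?rmorphM //.
    exact: gD.
  exact: gM.
by move=> y ys; apply: ideal_gen_sub; exact: map_f.
Qed.

Lemma noetherian_field (k : fieldType) : noetherian_ring k.
Proof.
move=> J HJ; have [J0 JD JM] := HJ.
have [[x [Jx x0]]|nJ] := pselect (exists x, J x /\ x != 0).
  exists [:: x]; split=> [y|y _ I [_ _ IM] sI]; first by rewrite inE => /eqP->.
  by rewrite -[y](mulfVK x0); apply/IM/sI; rewrite inE.
exists [::]; split=> // x Jx I [I0 _ _] _.
have [->//|x0] := eqVneq x 0; by case: nJ; exists x.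
Qed.

(* Generators of the ideal of leading coefficients handle all large degrees at
   once; the finitely many small degrees d are handled one by one. *)
Lemma noetherian_poly (A : comNzRingType) :
  noetherian_ring A -> noetherian_ring {poly A}.
Proof.
move=> nA J HJ; have [J0 JD JM] := HJ.
pose L d (a : A) := exists2 f : {poly A}, J f & (size f <= d.+1)%N /\ f`_d = a.
have LI (K : {poly A} -> Prop) d : is_ideal K ->
    is_ideal (fun a => exists2 f : {poly A}, K f & (size f <= d.+1)%N /\ f`_d = a).
  move=> [K0 KD KM]; split=> [|x y [f Kf [sf fd]] [g Kg [sg gd]]|a x [f Kf [sf fd]]].
  - by exists 0 => //; rewrite size_poly0 coef0.
  - exists (f + g); first exact: KD.
    by rewrite coefD fd gd (leq_trans (size_polyD _ _)) // geq_max sf.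
  - exists (a%:P * f); first exact: KM.
    by rewrite coefCM fd mul_polyC (leq_trans (size_scale_leq _ _)).
have Lsub d e a : (d <= e)%N -> L d a -> L e a.
  move=> de [f Jf [sf <-]]; exists ('X^(e - d) * f); first exact: JM.
  split; last by rewrite coefXnM ltnNge leq_subr /= subKn.
  rewrite (leq_trans (size_polyMleq _ _)) // size_polyXn addSn /=.
  by rewrite -[X in (_ <= X.+1)%N](subnK de) -addnS leq_add2l.
have LU : is_ideal (fun a => exists d, L d a).
  split=> [|x y [d Lx] [e Ly]|a x [d Lx]].
  - by exists 0%N; have [+ _ _] := LI J 0%N HJ.
  - exists (maxn d e); have [_ + _] := LI J (maxn d e) HJ; apply.
      by apply: Lsub Lx; rewrite leq_maxl.
    by apply: Lsub Ly; rewrite leq_maxr.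
  - by exists d; have [_ _ +] := LI J d HJ; apply.
have [s [sL sgen]] := nA _ LU.
have /choice[dg dgP] : forall a, exists d, a \in s -> L d a.
  by move=> a; case: (boolP (a \in s)) => [/sL[d]|]; [exists d|exists 0%N].
pose N := \max_(a <- s) dg a.
have /choice[F FP] : forall a, exists f : {poly A}, a \in s ->
    [/\ J f, (size f <= N.+1)%N & f`_N = a].
  move=> a; case: (boolP (a \in s)) => [as_|]; last by exists 0.
  have [f Jf [sf fd]] : L N a.
    by apply: Lsub (dgP _ as_); apply: leq_bigmax_seq.
  by exists f.
have /choice[t tP] : forall d, exists t : seq {poly A},
    (forall f, f \in t -> J f) /\ forall a, L d a ->
     exists2 f, ideal_gen (fun y => y \in t) f & (size f <= d.+1)%N /\ f`_d = a.
  move=> d; have [u [uL ugen]] := nA _ (LI J d HJ).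
  have /choice[G GP] : forall a, exists f : {poly A}, a \in u ->
      [/\ J f, (size f <= d.+1)%N & f`_d = a].
    move=> a; case: (boolP (a \in u)) => [/uL[f Jf [sf fd]]|]; last by exists 0.
    by exists f.
  exists [seq G a | a <- u]; split=> [f /mapP[a /GP[Jf _ _] ->]//|a /ugen].
  move/(_ (fun a => exists2 f, ideal_gen (fun y => y \in [seq G a | a <- u]) f &
    (size f <= d.+1)%N /\ f`_d = a)).
  apply; first exact/LI/is_ideal_gen.
  move=> y yu; have [_ sf fd] := GP _ yu; exists (G y) => //.
  by apply: ideal_gen_sub; exact: map_f.
pose S := [seq F a | a <- s] ++ flatten [seq t d | d <- iota 0 N].
have gS := is_ideal_gen (fun y : {poly A} => y \in S).
have [g0 gD gM] := gS.
have red d a : L d a ->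
    exists2 f, ideal_gen (fun y => y \in S) f & (size f <= d.+1)%N /\ f`_d = a.
  move=> La; have [dN|Nd] := ltnP d N.
    have [_ /(_ _ La)[f fg sf]] := tP d; exists f => //.
    apply: fg => // y yt; apply: ideal_gen_sub; rewrite mem_cat; apply/orP; right.
    by apply/flattenP; exists (t d) => //; apply: map_f; rewrite mem_iota.
  have /sgen : exists d, L d a by exists d.
  move/(_ (fun a => exists2 f, ideal_gen (fun y => y \in S) f &
    (size f <= d.+1)%N /\ f`_d = a)).
  apply; first exact: LI.
  move=> y ys; have [Jf sf fd] := FP _ ys.
  exists ('X^(d - N) * F y).
    apply: gM; apply: ideal_gen_sub; rewrite mem_cat; apply/orP; left.
    exact: map_f.
  split; last by rewrite coefXnM ltnNge leq_subr /= subKn.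
  rewrite (leq_trans (size_polyMleq _ _)) // size_polyXn addSn /=.
  by rewrite -[X in (_ <= X.+1)%N](subnK Nd) -addnS leq_add2l.
exists S; split.
  move=> x; rewrite mem_cat => /orP[/mapP[a /FP[Jf _ _] ->]//|].
  by move=> /flattenP[u /mapP[d _ ->]]; have [+ _] := tP d; apply.
suff H n (f : {poly A}) : (size f <= n)%N -> J f -> ideal_gen (fun y => y \in S) f.
  by move=> x Jx; exact: H (leqnn _) Jx.
elim: n f => [|n IHn] f sf Jf.
  by move: sf; rewrite leqn0 size_poly_eq0 => /eqP->.
have [|g gg [sg gn]] := red n f`_n; first by exists f.
rewrite -[f](subrK g) addrC; apply: gD => //; apply: IHn.
  apply/leq_sizeP => j; rewrite leq_eqVlt => /orP[/eqP<-|nj].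
    by rewrite coefB gn subrr.
  by rewrite coefB !nth_default ?subrr // (leq_trans _ nj).
rewrite addrC; apply: JD => //; apply: (ideal_opp HJ); apply: gg => //.
move=> y; rewrite mem_cat => /orP[/mapP[a /FP[Ja _ _] ->]//|].
by move=> /flattenP[u /mapP[d _ ->]]; have [+ _] := tP d; apply.
Qed.

Lemma noetherian_mpoly (k : fieldType) n : noetherian_ring {mpoly k[n]}.
Proof.
elim: n => [|n IHn].
  apply: (@noetherian_surj _ _ (mpolyC 0 (R := k))) (@noetherian_field k) => p.
  elim/mpoly_alg_ind: p => [c|[]//|p q [a <-] [b <-]|p q [a <-] [b <-]].
  - by exists c.
  - by exists (a + b); rewrite rmorphD.
  - by exists (a * b); rewrite rmorphM.
pose phi : {rmorphism {poly {mpoly k[n]}} -> {mpoly k[n.+1]}} :=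
  horner_eval 'X_ord_max \o map_poly (@mwiden n k).
apply: (@noetherian_surj _ _ phi) (noetherian_poly IHn) => p.
elim/mpoly_alg_ind: p => [c|i|p q [a <-] [b <-]|p q [a <-] [b <-]].
- exists (c%:MP)%:P; rewrite /phi /= map_polyC /horner_eval hornerC.
  by rewrite /= mwidenC.
- case: (unliftP ord_max i) => [j ->|->].
    exists ('X_j)%:P; rewrite /phi /= map_polyC /horner_eval hornerC /=.
    rewrite mwidenX mnmwiden1; congr 'X_[U_(_)]; apply: val_inj.
    by rewrite /= /bump leqNgt ltn_ord.
  by exists 'X; rewrite /phi /= map_polyX /horner_eval hornerX.
- by exists (a + b); rewrite rmorphD.
- by exists (a * b); rewrite rmorphM.
Qed.

(** * Relations of the solution and infinitesimal lifting *)

Section SystemIdeal.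
Variables (k : fieldType) (n : nat) (c : 'I_n.+1 -> k).
Variable p : 'I_n.+1 -> {mpoly k[n.+1]}.
Hypotheses (c0 : c ord0 = 0) (p0 : p ord0 = 1).

(** X_0 takes the place of t. By [c0] and [p0] the equation of index 0 is trivial, so n equations in
    n + 1 unknowns remain. *)
Definition sys_eq (i : 'I_n.+1) : {mpoly k[n.+1]} :=
  'X_i - (c i)%:MP - 'X_ord0 * p i.

Definition sys_ideal : {mpoly k[n.+1]} -> Prop :=
  ideal_gen (fun q => exists i, q = sys_eq i).

(** Modulo the equations each X_i is c_i plus a multiple of X_0, and this passes to sums and
    products. *)
Lemma sys_ideal_divX (q : {mpoly k[n.+1]}) :
  exists q', sys_ideal (q - (meval c q)%:MP - 'X_ord0 * q').
Proof.
have HI : is_ideal sys_ideal by exact: is_ideal_gen.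
have [I0 ID IM] := HI.
elim/mpoly_alg_ind: q => [d|i|q r [q' Hq] [r' Hr]|q r [q' Hq] [r' Hr]].
- by exists 0; rewrite mevalC subrr mulr0 subr0.
- by exists (p i); rewrite mevalXU; apply: ideal_gen_sub; exists i.
- exists (q' + r'); rewrite mevalD.
  by have := ID _ _ Hq Hr; congr sys_ideal; rewrite rmorphD /=; ring.
- exists (q' * r + (meval c q)%:MP * r'); rewrite mevalM.
  have := ID _ _ (IM r _ Hq) (IM (meval c q)%:MP _ Hr).
  by congr sys_ideal; rewrite rmorphM /=; ring.
Qed.

Lemma sys_root0 (S : comNzRingType) (f : {rmorphism k -> S}) (g : 'I_n.+1 -> S) q :
  (forall i, g i = f (c i) + g ord0 * mmap f g (p i)) ->
  sys_ideal q -> mmap f g q = 0.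
Proof.
move=> sys /(_ (fun q => mmap f g q = 0)); apply.
  split=> [|x y ex ey|a x ex]; first by rewrite rmorph0.
    by rewrite rmorphD /= ex ey addr0.
  by rewrite rmorphM /= ex mulr0.
move=> _ [i ->]; rewrite !rmorphB rmorphM /= !mmap_XU mmapC {1}sys.
by ring.
Qed.

Lemma mmap_divX (S : comNzRingType) (f : {rmorphism k -> S}) (g : 'I_n.+1 -> S) q q' :
  (forall i, g i = f (c i) + g ord0 * mmap f g (p i)) ->
  sys_ideal (q - (meval c q)%:MP - 'X_ord0 * q') ->
  mmap f g q = f (meval c q) + g ord0 * mmap f g q'.
Proof.
move=> sys /(sys_root0 sys); rewrite !rmorphB rmorphM /= mmapC mmap_XU.
by move=> /eqP; rewrite subr_eq0 subr_eq addrC => /eqP.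
Qed.

Variables (z : 'I_n.+1 -> pser k).
Hypothesis z_sys : ps_system c p z.

Lemma sys_z0 : z ord0 = ps_X k.
Proof. by rewrite z_sys c0 p0 rmorph0 add0r rmorph1 mulr1. Qed.

Lemma sys_zP i : z i = ps_C k (c i) + z ord0 * mmap (ps_C k) z (p i).
Proof. by rewrite sys_z0; exact: z_sys. Qed.

Definition sys_rel (q : {mpoly k[n.+1]}) : Prop := mmap (ps_C k) z q = 0.

Lemma sys_coef0 q : ps_coef0 (mmap (ps_C k) z q) = meval c q.
Proof.
have [q' Hq] := sys_ideal_divX q.
rewrite (mmap_divX sys_zP Hq) sys_z0 /ps_coef0 psD ps_CE ps_XM /= addr0.
by [].
Qed.

(** A relation has q(c) = 0, so it is X_0 q' modulo the equations; as t can be cancelled in k[[t]],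
    q' is again a relation. *)
Lemma sys_rel_divX q : sys_rel q -> exists2 q', sys_rel q' &
  sys_ideal (q - 'X_ord0 * q').
Proof.
move=> rq; have [q' Hq] := sys_ideal_divX q.
have qc : meval c q = 0 by rewrite -sys_coef0 rq rmorph0.
exists q'; last by move: Hq; rewrite qc rmorph0 subr0.
have := mmap_divX sys_zP Hq; rewrite rq qc rmorph0 add0r sys_z0 => e.
by apply: (@ps_XI k); rewrite -e mulr0.
Qed.

(* Nakayama: modulo the equations, the ideal of relations equals X_0 times
   itself. *)
Lemma sys_rel_annihilator :
  exists2 w, meval c w = 1 & forall q, sys_rel q -> sys_ideal (w * q).
Proof.
have relI : is_ideal sys_rel.
  rewrite /sys_rel; split=> [|x y ex ey|a x ex]; first by rewrite rmorph0.
    by rewrite rmorphD /= ex ey addr0.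
  by rewrite rmorphM /= ex mulr0.
have [s [srel sgen]] := noetherian_mpoly relI.
have HI : is_ideal sys_ideal by exact: is_ideal_gen.
have [I0 ID IM] := HI.
set m := size s in sgen *.
have /choice[N NP] : forall i : 'I_m, exists a : 'I_m -> {mpoly k[n.+1]},
    sys_ideal (s`_i - 'X_ord0 * \sum_j a j * s`_j).
  move=> i; have /sys_rel_divX[q' rq' Hq'] : sys_rel s`_i by apply/srel/mem_nth.
  by have [a ea] := ideal_genP (sgen _ rq'); exists a; rewrite -ea.
pose M : 'M[{mpoly k[n.+1]}]_m := 1%:M - 'X_ord0 *: \matrix_(i, j) N i j.
pose v : 'cV[{mpoly k[n.+1]}]_m := \col_j s`_j.
have Mv i : sys_ideal ((M *m v) i 0).
  have := NP i; congr sys_ideal; rewrite mulmxBl mul1mx -scalemxAl !mxE.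
  by congr (_ - _ * _); apply: eq_bigr => j _; rewrite !mxE.
(* By Cramer [\det M] kills the generators modulo the equations. Its value at c is 1 because X_0
   vanishes there. *)
exists (\det M).
  rewrite -det_map_mx /M map_mxB map_mx1 map_mxZ /= mevalXU c0 scale0r subr0.
  exact: det1.
move=> q /sgen /(_ (fun q => sys_ideal (\det M * q))); apply.
  split=> [|x y ex ey|a x ex]; first by rewrite mulr0.
    by rewrite mulrDr; exact: ID.
  by rewrite mulrCA; exact: IM.
move=> y ys; have lt : (index y s < m)%N by rewrite index_mem.
have -> : \det M * y = (\adj M *m (M *m v)) (Ordinal lt) 0.
  by rewrite mulmxA mul_adj_mx mul_scalar_mx !mxE /= nth_index.
rewrite mxE; apply: ideal_sum => // j; exact: IM.
Qed.

(* A regular element vanishing at a rational point plays the role of X_0; then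
   the truncations of z are determined by g modulo its powers. *)
Lemma sys_rel_of_point (S : comNzRingType) (f : {rmorphism k -> S})
    (e : {rmorphism S -> k}) (g : 'I_n.+1 -> S) (q : {mpoly k[n.+1]}) :
  (forall a, e (f a) = a) -> e (g ord0) = 0 ->
  (forall a, g ord0 * a = 0 -> a = 0) ->
  (forall i, g i = f (c i) + g ord0 * mmap f g (p i)) ->
  mmap f g q = 0 -> sys_rel q.
Proof.
move=> ef eg reg sys gq; apply/funext => m; elim: m q gq => [|m IHm] q gq.
  all: have [q' Hq] := sys_ideal_divX q; have := mmap_divX sys Hq.
  all: rewrite gq => /esym Hg; have := congr1 e Hg.
  all: rewrite rmorphD rmorphM /= ef eg mul0r addr0 rmorph0 => q0.
  by rewrite -/(ps_coef0 _) sys_coef0.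
rewrite (mmap_divX sys_zP Hq) q0 rmorph0 add0r sys_z0 ps_XM IHm //.
by apply: reg; move: Hg; rewrite q0 rmorph0 add0r.
Qed.

End SystemIdeal.

(** The d_i are the partial derivatives. They do not depend on [S], so that the Jacobian of a system
    is a matrix of polynomials. *)
Lemma mpoly_taylor (k : comNzRingType) n (q : {mpoly k[n]}) :
  exists d : 'I_n -> {mpoly k[n]},
    forall (S : comNzRingType) (f : {rmorphism k -> S}) (g e : 'I_n -> S),
    (forall i j, e i * e j = 0) ->
    mmap f (fun i => g i + e i) q = mmap f g q + \sum_i mmap f g (d i) * e i.
Proof.
elim/mpoly_alg_ind: q => [c|i|q r [d Hd] [d' Hd']|q r [d Hd] [d' Hd']].
- exists (fun=> 0) => S f g e _.
  by rewrite !mmapC big1 ?addr0 // => i _ /=; rewrite rmorph0 mul0r.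
- exists (fun j => (j == i)%:R) => S f g e _.
  rewrite !mmap_XU (bigD1 i) //= eqxx rmorph1 mul1r big1 ?addr0 // => j /negPf-> /=.
  by rewrite rmorph0 mul0r.
- exists (fun i => d i + d' i) => S f g e He; rewrite !rmorphD /= Hd ?Hd' //.
  rewrite addrACA -big_split; congr (_ + _); apply: eq_bigr => i _.
  by rewrite rmorphD mulrDl.
- exists (fun i => d i * r + q * d' i) => S f g e He; rewrite !rmorphM /= Hd ?Hd' //.
  have -> : \sum_i mmap f g (d i * r + q * d' i) * e i =
      (\sum_i mmap f g (d i) * e i) * mmap f g r +
      mmap f g q * (\sum_i mmap f g (d' i) * e i).
    rewrite mulr_suml mulr_sumr -big_split; apply: eq_bigr => i _ /=.
    by rewrite rmorphD !rmorphM /=; ring.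
  have ee : (\sum_i mmap f g (d i) * e i) * (\sum_i mmap f g (d' i) * e i) = 0.
    rewrite mulr_suml big1 // => i _; rewrite mulr_sumr big1 // => j _.
    by rewrite mulrACA He mulr0.
  rewrite mulrDl !mulrDr ee; ring.
Qed.

(** One Newton step: as [J] has square zero, the correction solves a linear system whose matrix is
    the Jacobian, and [w] is its determinant. *)
Lemma sys_lift (k : fieldType) n (c : 'I_n.+1 -> k)
    (p : 'I_n.+1 -> {mpoly k[n.+1]}) : c ord0 = 0 -> p ord0 = 1 ->
  exists2 w, meval c w = 1 &
    forall (S : comNzRingType) (f : {rmorphism k -> S}) (J : S -> Prop)
      (g : 'I_n.+1 -> S),
    is_ideal J -> (forall a b, J a -> J b -> a * b = 0) ->
    (forall i, J (mmap f g (sys_eq c p i))) ->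
    (exists u, u * mmap f g w = 1) ->
    exists2 g', forall i, J (g' i - g i) &
      forall i, g' i = f (c i) + g' ord0 * mmap f g' (p i).
Proof.
move=> c0 p0.
have /choice[d dP] := fun i => mpoly_taylor (p i).
(* Row 0 is zero, so the correction of unknown 0 is 0; the derivative of the factor X_0 can
   therefore be left out of the other rows. *)
pose D : 'M[{mpoly k[n.+1]}]_n.+1 := \matrix_(i, j) if i == ord0 then 0 else d i j.
pose M := 1%:M - 'X_ord0 *: D.
exists (\det M).
  rewrite -det_map_mx /M map_mxB map_mx1 map_mxZ /= mevalXU c0 scale0r subr0.
  exact: det1.
move=> S f J g HJ J2 Jg [u Hu].
have [J0 JD JM] := HJ.
pose v : 'cV[S]_n.+1 := \col_i - mmap f g (sys_eq c p i).
pose Mg : 'M[S]_n.+1 := map_mx (mmap f g) M.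
have uM : u * \det Mg = 1 by rewrite -Hu -det_map_mx.
pose e := u *: (\adj Mg *m v).
have Me : Mg *m e = v.
  by rewrite -scalemxAr mulmxA mul_mx_adj mul_scalar_mx scalerA uM scale1r.
have Je i : J (e i 0).
  rewrite !mxE; apply: (JM); apply: ideal_sum => // j; apply: (JM).
  rewrite mxE; exact: ideal_opp.
have sysE i : mmap f g (sys_eq c p i) =
    g i - f (c i) - g ord0 * mmap f g (p i).
  by rewrite !rmorphB rmorphM /= !mmap_XU mmapC.
have MgE i : (Mg *m e) i 0 = e i 0 - g ord0 * \sum_j mmap f g (D i j) * e j 0.
  rewrite /Mg map_mxB map_mx1 map_mxZ /= mmap_XU mulmxBl mul1mx -scalemxAl !mxE.
  by congr (_ - _ * _); apply: eq_bigr => j _; rewrite !mxE.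
have e0 : e ord0 0 = 0.
  have := MgE ord0; rewrite Me big1 ?mulr0 ?subr0 => [<-|j _].
    by rewrite mxE sysE c0 p0 rmorph0 rmorph1; ring.
  by rewrite !mxE eqxx rmorph0 mul0r.
exists (fun i => g i + e i 0) => i; first by rewrite addrAC subrr add0r.
have [->|i0] := eqVneq i ord0.
  by rewrite e0 p0 c0 rmorph1 rmorph0 add0r mulr1.
rewrite e0 addr0 dP; last by move=> ? ?; exact: J2.
have := MgE i; rewrite Me mxE sysE.
under eq_bigr do rewrite mxE (negPf i0).
set sm := \sum_j _ => E.
have -> : e i 0 = - (g i - f (c i) - g ord0 * mmap f g (p i)) + g ord0 * sm.
  by rewrite E; ring.
ring.
Qed.

(** * Algebraicity of the solution over k(t) *)

Lemma mmap_sum_msupp n (R S : comNzRingType) (f : {rmorphism R -> S})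
    (h : 'I_n -> S) (q : {mpoly R[n]}) :
  mmap f h q = \sum_(m <- msupp q) f q@_m * mmap1 h m.
Proof. by []. Qed.

Lemma mmap1D n (S : comNzRingType) (h : 'I_n -> S) (m m' : 'X_{1..n}) :
  mmap1 h (m + m')%MM = mmap1 h m * mmap1 h m'.
Proof.
by rewrite /mmap1 -big_split; apply: eq_bigr => i _; rewrite mnmDE exprD.
Qed.

(* Specialize the parameter e at 0, after dividing by the largest possible
   power of e. *)
Lemma algebraic_specialize (k : fieldType) (a : pser {poly k})
    (G : {poly {poly {poly k}}})
    (h0 : {rmorphism {poly k} -> k} := horner_eval 0) :
  G != 0 -> (map_poly (@ps_poly {poly k}) G).[a] = 0 ->
  exists2 H : {poly {poly k}}, H != 0 &
    (map_poly (@ps_poly k) H).[ps_map h0 a] = 0.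
Proof.
pose sp : {rmorphism {poly {poly k}} -> {poly k}} := map_poly h0.
move=> G0.
have [i Gi] : exists i, G`_i != 0.
  by exists (size G).-1; rewrite -lead_coefE lead_coef_eq0.
have [j Gij] : exists j, G`_i`_j != 0.
  by exists (size G`_i).-1; rewrite -lead_coefE lead_coef_eq0.
(* Descent on the degree in e of one nonzero coefficient, which drops at each division by e. *)
have [N] := ubnP (size G`_i`_j).
elim: N => // N IHN in G G0 Gi Gij *; rewrite ltnS => sN Ga.
have [spG|] := eqVneq (map_poly sp G) 0; last first.
  move=> spG; exists (map_poly sp G) => //.
  have := congr1 (ps_map h0) Ga; rewrite rmorph0 -horner_map /=.
  rewrite -!map_poly_comp => <-; congr (_.[_]); apply: eq_map_poly => u.
  by rewrite /= ps_map_poly.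
have Gx u v : G`_u`_v = (G`_u`_v %/ 'X) * 'X.
  have := congr1 (fun f : {poly {poly k}} => f`_u`_v) spG.
  rewrite !coef_map /= !coef0 /horner_eval => Guv.
  by rewrite divpK // -['X]subr0 -polyC0 dvdp_XsubCl /root Guv.
pose G' := map_poly (map_poly (fun q : {poly k} => q %/ 'X)) G.
have G'E u v : G'`_u`_v = G`_u`_v %/ 'X.
  by rewrite coef_map_id0 ?map_poly0 // coef_map_id0 ?div0p.
have GG' : G = ('X%:P)%:P * G'.
  by apply/polyP => u; apply/polyP => v; rewrite !coefCM G'E mulrC -Gx.
have G'ij : G'`_i`_j != 0.
  by apply: contraNneq Gij => e; rewrite Gx -G'E e mul0r.
apply: (IHN G').
- by apply: contraNneq G'ij => ->; rewrite !coef0.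
- by apply: contraNneq G'ij => ->; rewrite !coef0.
- by [].
- apply: leq_trans sN; rewrite [in X in (_ < X)%N]Gx -G'E size_mulX //.
- move: Ga; rewrite GG' rmorphM /= map_polyC /= hornerM hornerC => /eqP.
  rewrite mulf_eq0 => /orP[|/eqP//].
  rewrite -(rmorph0 (@ps_poly {poly k})) => /eqP/ps_poly_inj/eqP.
  by rewrite polyC_eq0 polyX_eq0.
Qed.

Lemma root_scale (A S : comNzRingType) (f : {rmorphism A -> S}) (P : {poly A})
    (N t : nat) (u : A) (a : S) : (size P <= N)%N ->
  (map_poly f P).[f u ^+ t * a] = 0 ->
  (map_poly f (\poly_(i < N) (P`_i * u ^+ (t * i)))).[a] = 0.
Proof.
move=> sP <-; rewrite !(@horner_coef_wide _ N) ?(leq_trans (size_poly _ _)) //.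
  apply: eq_bigr => i _; rewrite !coef_map coef_poly ltn_ord /= rmorphM rmorphXn.
  by rewrite exprMn exprM mulrA.
Qed.

Section Deformation.
Variables (k : fieldType) (n : nat) (c : 'I_n.+1 -> k).
Variable p : 'I_n.+1 -> {mpoly k[n.+1]}.
Hypotheses (c0 : c ord0 = 0) (p0 : p ord0 = 1).
Variables (z : 'I_n.+1 -> pser k).
Hypothesis z_sys : ps_system c p z.

Local Notation R := {poly k}.
Let d := (\sum_i msize (p i)).+1.
Let incl : {rmorphism {mpoly k[n.+1]} -> {mpoly R[n.+1]}} :=
  mmap (mpolyC n.+1 (R := R) \o polyC) (fun i => 'X_i).
Let c1 i : R := (c i)%:P.
(** ['X : R] is the parameter e. Since d + 1 exceeds the degrees of the p_i, the new equation
    expresses e t z_i^(d+1) by monomials of degree at most d and makes the coordinates integral once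
    e t is inverted. At e = 0 the old system returns. *)
Let p1 i : {mpoly R[n.+1]} :=
  incl (p i) + (if i == ord0 then 0 else ('X : R)%:MP * 'X_i ^+ d.+1).

Let z1 := sval (cid (ps_system_exists c1 p1)).
Let z1_sys : ps_system c1 p1 z1 := svalP (cid (ps_system_exists c1 p1)).
Let h0 : {rmorphism {poly k} -> k} := horner_eval 0.
Let iota : {rmorphism {poly R} -> pser R} := @ps_poly R.
Let ck : {rmorphism k -> pser R} := ps_C R \o polyC.

Let mmap_incl h (q : {mpoly k[n.+1]}) : mmap (ps_C R) h (incl q) = mmap ck h q.
Proof.
rewrite /incl /=; apply: (rmorph_mmap (g := mmap (ps_C R) h)) => [a|i].
  by rewrite /= mmapC.
exact: mmap_XU.
Qed.

Let mD (f : {rmorphism R -> pser R}) h (x y : {mpoly R[n.+1]}) :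
  mmap f h (x + y) = mmap f h x + mmap f h y.
Proof. exact: rmorphD. Qed.
Let mM (f : {rmorphism R -> pser R}) h (x y : {mpoly R[n.+1]}) :
  mmap f h (x * y) = mmap f h x * mmap f h y.
Proof. exact: rmorphM. Qed.
Let m0 (f : {rmorphism R -> pser R}) h : mmap f h (0 : {mpoly R[n.+1]}) = 0.
Proof. exact: rmorph0. Qed.
Let mX (f : {rmorphism R -> pser R}) h i m :
  mmap f h ('X_i ^+ m : {mpoly R[n.+1]}) = h i ^+ m.
Proof. by rewrite rmorphXn; congr (_ ^+ _); exact: mmap_XU. Qed.

Let z1_0 : z1 ord0 = ps_X R.
Proof.
rewrite z1_sys /p1 eqxx addr0 p0 rmorph1 /c1 c0 polyC0 rmorph0 add0r.
by rewrite rmorph1 mulr1.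
Qed.

Let map_ck a : ps_map h0 (ck a) = ps_C k a.
Proof. by have := ps_mapC h0 a%:P; rewrite [h0 _]hornerC. Qed.

Let z1_spec i : ps_map h0 (z1 i) = z i.
Proof.
have e : ps_system c p (fun i => ps_map h0 (z1 i)).
  have spD x y : ps_map h0 (x + y) =
      ps_map h0 x + ps_map h0 y :> pser k.
    by rewrite rmorphD.
  have spM x y : ps_map h0 (x * y) =
      ps_map h0 x * ps_map h0 y :> pser k.
    by rewrite rmorphM.
  move=> {}i; rewrite {1}z1_sys spD spM ps_mapX ps_mapC /p1 mD mmap_incl spD.
  have -> : h0 (c1 i) = c i by rewrite /h0 /= /horner_eval /c1 hornerC.
  rewrite [X in _ * (_ + X)](_ : _ = 0); last first.
    case: ifP => _; first by rewrite m0 rmorph0.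
    rewrite mM spM mmapC ps_mapC.
    have -> : h0 'X = 0 by rewrite /h0 /= /horner_eval hornerX.
    by rewrite rmorph0 mul0r.
  rewrite addr0; congr (_ + _ * _).
  exact: (rmorph_mmap (g := ps_map h0)).
by have := ps_system_unique e z_sys => /(congr1 (fun f => f i)).
Qed.

(** The product e t: the inner variable is e, the outer one t. *)
Let theta : {poly R} := ('X : R)%:P * 'X.

Let z1_pow i : i != ord0 -> iota theta * z1 i ^+ d.+1 =
  z1 i - ck (c i) - iota 'X * mmap ck z1 (p i).
Proof.
move=> i0; rewrite {2}(z1_sys i) /p1 (negPf i0) mD mmap_incl mM mmapC mX.
have -> : iota theta = ps_C R 'X * ps_X R by exact: (rmorphM iota).
have -> : ck (c i) = ps_C R (c1 i) by [].
have -> : iota 'X = ps_X R by [].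
have alg (a b x y w : pser R) : a * x * w = b + x * (y + a * w) - b - x * y.
  ring.
exact: alg.
Qed.

Let B : finType := {ffun 'I_n.+1 -> 'I_d.+1}.
Let bv (a : B) : pser R := \prod_i z1 i ^+ (a i).
Let span x := exists a : B -> {poly R}, x = \sum_b iota (a b) * bv b.
(** Membership in the span over k[e, t][1/(e t)] of the monomials in z with all exponents at most
    d. *)
Let E x := exists s, span (iota theta ^+ s * x).

Let spanD x y : span x -> span y -> span (x + y).
Proof.
move=> [a ->] [b ->]; exists (fun i => a i + b i).
by rewrite -big_split; apply: eq_bigr => i _; rewrite rmorphD mulrDl.
Qed.

Let spanM u x : span x -> span (iota u * x).
Proof.
move=> [a ->]; exists (fun i => u * a i).
by rewrite mulr_sumr; apply: eq_bigr => i _; rewrite rmorphM mulrA.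
Qed.

Let E_le x s : span (iota theta ^+ s * x) ->
  forall t, (s <= t)%N -> span (iota theta ^+ t * x).
Proof.
move=> h t st; rewrite -(subnK st) exprD -mulrA -rmorphXn; exact: spanM.
Qed.

Let ED x y : E x -> E y -> E (x + y).
Proof.
move=> [s hs] [t ht]; exists (maxn s t); rewrite mulrDr; apply: spanD.
  by apply: E_le hs _ _; rewrite leq_maxl.
by apply: E_le ht _ _; rewrite leq_maxr.
Qed.

Let EM u x : E x -> E (iota u * x).
Proof. by move=> [s hs]; exists s; rewrite mulrCA; exact: spanM. Qed.

Let E0 : E 0.
Proof.
exists 0%N, (fun=> 0); rewrite mulr0 big1 // => b _.
by rewrite rmorph0 mul0r.
Qed.

Let E_theta x : E (iota theta * x) -> E x.
Proof. by move=> [s h]; exists s.+1; rewrite exprSr -mulrA. Qed.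

Let E_ck a x : E x -> E (ck a * x).
Proof. exact: (@EM (a%:P)%:P). Qed.

Let E_opp x : E x -> E (- x).
Proof. by move=> /(@EM (-1)); rewrite rmorphN1 mulN1r. Qed.

(** Induction on the degree. A factor z_0 is the scalar t; a factor z_i^(d+1) with i != 0 is
    replaced, at the price of one [theta], by terms of lower degree. *)
Let E_mon (m : 'X_{1..n.+1}) : E (mmap1 z1 m).
Proof.
have [N] := ubnP (mdeg m); elim: N => // N IHN in m *; rewrite ltnS => mN.
have [small|] := boolP [forall i, (m i < d.+1)%N].
  pose a : B := [ffun i => inord (m i)].
  exists 0%N, (fun b => (b == a)%:R); rewrite expr0 mul1r (bigD1 a) //= eqxx.
  rewrite rmorph1 mul1r big1 ?addr0 => [|b /negPf->]; last first.
    by rewrite rmorph0 mul0r.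
  rewrite /bv /mmap1; apply: eq_bigr => i _; rewrite ffunE inordK //.
  exact: (forallP small).
rewrite negb_forall => /existsP[i]; rewrite -leqNgt => mi.
have [i0|i0] := eqVneq i ord0.
  have le : (U_(i) <= m)%MM by rewrite lep1mP -lt0n (leq_trans _ mi).
  have -> : mmap1 z1 m = iota 'X * mmap1 z1 (m - U_(i))%MM.
    by rewrite -{1}(submK le) mmap1D mmap1U {2}i0 z1_0 mulrC.
  apply/EM/IHN; move: mN; rewrite -{1}(submK le) mdegD mdeg1 addn1.
  by [].
have le : (U_(i) *+ d.+1 <= m)%MM.
  apply/mnm_lepP => j; rewrite mulmnE mnm1E.
  by case: eqP => [<-|_]; rewrite ?mul1n ?mul0n.
set m' := (m - U_(i) *+ d.+1)%MM.
have mE : m = (m' + U_(i) *+ d.+1)%MM by rewrite submK.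
have zU : mmap1 z1 (U_(i) *+ d.+1)%MM = z1 i ^+ d.+1.
  rewrite /mmap1 (bigD1 i) //= mulmnE mnm1E eqxx mul1n big1 ?mulr1 // => j ji.
  by rewrite mulmnE mnm1E eq_sym (negPf ji) mul0n expr0.
have dm : mdeg m = (mdeg m' + d.+1)%N by rewrite mE mdegD mdegMn mdeg1 mul1n.
have IH' (l : 'X_{1..n.+1}) : (mdeg l <= d)%N -> E (mmap1 z1 m' * mmap1 z1 l).
  move=> ld; rewrite -mmap1D; apply: IHN; rewrite mdegD.
  by rewrite (leq_trans _ mN) // dm ltn_add2l ltnS.
apply: E_theta; rewrite mE mmap1D zU mulrCA z1_pow // !mulrBr.
apply: (ED (ED _ (E_opp _)) (E_opp _)).
- by rewrite -(mmap1U z1); apply: IH'; rewrite mdeg1.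
- by rewrite mulrC; apply: E_ck; rewrite -[mmap1 _ _]mulr1 -(mmap11 z1);
    apply: IH'; rewrite mdeg0.
rewrite mulrCA; apply: EM; rewrite mmap_sum_msupp mulr_sumr big_seq.
elim/big_ind: _ => [||l lp]; [exact: E0|exact: ED|].
rewrite mulrCA; apply: E_ck; apply: IH'.
rewrite -ltnS (leq_trans (msize_mdeg_lt lp)) // leqW // leqW //.
by rewrite (bigD1 i) //= leq_addr.
Qed.

Let E_poly (q : {mpoly k[n.+1]}) (b : B) : E (mmap ck z1 q * bv b).
Proof.
have -> : bv b = mmap1 z1 [multinom (b i : nat) | i < n.+1]%MM.
  by rewrite /mmap1; apply: eq_bigr => i _; rewrite mnmE.
rewrite mmap_sum_msupp mulr_suml.
elim/big_ind: _ => [||l _]; [exact: E0|exact: ED|].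
by rewrite -mulrA -mmap1D; apply/E_ck/E_mon.
Qed.

(** Multiplication by [theta ^+ t * a] maps the finitely many small monomials into their span over
    k[e, t]; by Cayley-Hamilton it is a root of a characteristic polynomial over k[e, t]. Then e is
    specialized to 0. *)
Lemma sys_algebraic (q : {mpoly k[n.+1]}) :
  exists2 H : {poly {poly k}}, H != 0 &
    (map_poly (@ps_poly k) H).[mmap (ps_C k) z q] = 0.
Proof.
pose a := mmap ck z1 q.
have -> : mmap (ps_C k) z q = ps_map h0 a.
  exact/esym/(rmorph_mmap (g := ps_map h0)).
have /choice[s sP] : forall b, exists s, span (iota theta ^+ s * (a * bv b)).
  by move=> b; exact: E_poly.
pose t := \max_b s b.
have /choice[M MP] : forall b, exists l : B -> {poly R},
    iota theta ^+ t * (a * bv b) = \sum_b' iota (l b') * bv b'.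
  by move=> b; apply: E_le (sP b) _ _; exact: leq_bigmax.
pose N := #|B|.
pose A : 'M[{poly R}]_N := \matrix_(i, j) M (enum_val i) (enum_val j).
pose v : 'cV[pser R]_N := \col_i bv (enum_val i).
pose y := iota theta ^+ t * a.
have yv : (y%:M - map_mx iota A) *m v = 0.
  apply/matrixP => i j0; rewrite mulmxBl mul_scalar_mx !mxE.
  rewrite -mulrA MP (reindex (@enum_val B (mem B))) /=; last first.
    exact/onW_bij/enum_val_bij.
  by apply/eqP; rewrite subr_eq0; apply/eqP/eq_bigr => j _; rewrite !mxE.
have det0 : \det (y%:M - map_mx iota A) = 0.
  have := congr1 (mulmx (\adj (y%:M - map_mx iota A))) yv.
  rewrite mulmxA mul_adj_mx mulmx0 mul_scalar_mx.
  move=> /matrixP/(_ (enum_rank [ffun=> ord0]) 0); rewrite !mxE enum_rankK.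
  by rewrite [bv _]big1 ?mulr1 // => i _; rewrite ffunE expr0.
have chy : (map_poly iota (char_poly A)).[y] = 0.
  rewrite map_char_poly /char_poly -/(horner_eval y _) -det_map_mx -det0.
  congr (\det _); apply/matrixP => i j; rewrite !mxE rmorphB rmorphMn /=.
  by rewrite /horner_eval hornerX hornerC.
(* The characteristic polynomial rewritten as an equation for [a] itself; its leading coefficient is
   a power of [theta], hence nonzero. *)
pose G := \poly_(i < size (char_poly A)) ((char_poly A)`_i * theta ^+ (t * i)).
have szA : size (char_poly A) = N.+1 by exact: size_char_poly.
apply: (@algebraic_specialize k a G).
  apply/eqP => /(congr1 (fun f : {poly {poly R}} => f`_N))/eqP.
  rewrite coef_poly szA ltnSn coef0 mulf_eq0 expf_eq0 mulf_eq0 polyC_eq0 !polyX_eq0.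
  rewrite andbF orbF -[N in _`_N]/(N.+1.-1) -szA -lead_coefE.
  by rewrite (monicP (char_poly_monic _)) oner_eq0.
apply: (root_scale (leqnn _) chy).
Qed.
End Deformation.

(* The ideals and primes are those of the subring R of A, so that the lemma
   applies to a subring of a field as well as to a whole ring. *)
(** * Spectra of subrings of a field *)

Lemma prime_avoiding (A : comPzRingType) (R J M : set A) :
  R 1 -> (forall x y, R x -> R y -> R (x + y)) ->
  (forall x y, R x -> R y -> R (x * y)) ->
  J `<=` R -> J 0 -> (forall x y, J x -> J y -> J (x + y)) ->
  (forall a x, R a -> J x -> J (a * x)) ->
  M 1 -> (forall x y, M x -> M y -> M (x * y)) ->
  (forall x, J x -> ~ M x) ->
  exists P : set A, [/\ J `<=` P, P `<=` R, (forall x, P x -> ~ M x),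
    [/\ P 0, (forall x y, P x -> P y -> P (x + y)) &
        (forall a x, R a -> P x -> P (a * x))] &
    (forall a b, R a -> R b -> P (a * b) -> P a \/ P b)].
Proof.
move=> R1 RD RM JR J0 JD JM M1 MM JMd.
pose good (P : set A) := [/\ P `<=` R, forall x, P x -> ~ M x,
  forall x y, P x -> P y -> P (x + y) & forall a x, R a -> P x -> P (a * x)].
(* [J] is joined to [X] because the property must also hold for the union of the empty chain. *)
have [F FP tF|X [PX Xmax]] := @Zorn_bigcup _ (fun X => good (J `|` X)).
  have [->|/set0P[Z0 FZ0]] := eqVneq F set0.
    by rewrite bigcup_set0 setU0.
  have sub Z : F Z -> J `|` Z `<=` J `|` \bigcup_(Y in F) Y.
    by move=> FZ q [|h]; [left|right; exists Z].
  have one q : (J `|` \bigcup_(Y in F) Y) q -> exists2 Z, F Z & (J `|` Z) q.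
    by move=> [h|[Z FZ Zq]]; [exists Z0 => //; left|exists Z => //; right].
  have two q q' : (J `|` \bigcup_(Y in F) Y) q ->
      (J `|` \bigcup_(Y in F) Y) q' ->
      exists Z, [/\ F Z, (J `|` Z) q & (J `|` Z) q'].
    move=> /one[Z FZ Zq] /one[Y FY Yq]; have [h|h] := tF _ _ FZ FY.
      exists Y; split=> //; exact: setUS h _ Zq.
    exists Z; split=> //; exact: setUS h _ Yq.
  split=> [x /one[Z FZ Zx]|x /one[Z FZ Zx]|x y hx hy|a x Ra /one[Z FZ Zx]].
  - by have [+ _ _ _] := FP Z FZ; apply.
  - by have [_ + _ _] := FP Z FZ; apply.
  - have [Z [FZ Zx Zy]] := two _ _ hx hy.
    by apply: (sub Z FZ); have [_ _ + _] := FP Z FZ; apply.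
  - by apply: (sub Z FZ); have [_ _ _ +] := FP Z FZ; apply.
have [PR PM PD Pmul] := PX; set P := J `|` X in PR PM PD Pmul PX.
have R0 : R 0 by exact: JR.
have ext a : R a -> ~ P a -> exists x b, [/\ P x, R b & M (x + b * a)].
  move=> Ra Pa; apply: contrapT => nM.
  pose Q := [set y | exists x b, [/\ P x, R b & y = x + b * a]].
  have Qa : Q a by exists 0, 1; rewrite mul1r add0r; split=> //; left.
  have PQ : P `<=` Q by move=> x Px; exists x, 0; rewrite mul0r addr0; split.
  apply: (Xmax Q); first split.
  - by move=> x Xx; apply: PQ; right.
  - by move=> QX; apply: Pa; right; exact: QX.
  have -> : J `|` Q = Q by apply/setUidPr => x Jx; apply: PQ; left.
  split=> [_ [x [b [Px Rb ->]]]|_ [x [b [Px Rb ->]]] h|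
           _ _ [x [b [Px Rb ->]]] [x' [b' [Px' Rb' ->]]]|r _ Rr [x [b [Px Rb ->]]]].
  - by apply: RD; [exact: PR|exact: RM].
  - by apply: nM; exists x, b.
  - exists (x + x'), (b + b'); split; [exact: PD|exact: RD|].
    by rewrite mulrDl addrACA.
  - exists (r * x), (r * b); split; [exact: Pmul|exact: RM|].
    by rewrite mulrDr mulrA.
exists P; split=> //; first by move=> x Jx; left.
  by split=> //; left.
move=> a b Ra Rb Pab; apply/or_asboolP; apply: contrapT => /negP.
rewrite negb_or => /andP[/asboolP nPa /asboolP nPb].
have [x [r [Px Rr Mx]]] := ext a Ra nPa.
have [y [s [Py Rs My]]] := ext b Rb nPb.
have := MM _ _ Mx My; apply: PM.
rewrite mulrDl !mulrDr; apply: (PD); apply: (PD).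
- by apply: Pmul => //; exact: PR.
- by rewrite mulrC; apply: Pmul => //; exact: RM.
- by apply: Pmul => //; exact: RM.
- by rewrite mulrACA; apply: Pmul => //; exact: RM.
Qed.

Record subring_of (K : fieldType) := SubringOf {
  subring_set :> set K;
  subring1 : subring_set 1;
  subringB : forall x y, subring_set x -> subring_set y -> subring_set (x - y);
  subringM : forall x y, subring_set x -> subring_set y -> subring_set (x * y) }.

Section SubringTheory.
Variables (K : fieldType) (R : subring_of K).

Lemma subring0 : R 0.
Proof. by rewrite -(subrr 1); apply: subringB; exact: subring1. Qed.
Lemma subringN x : R x -> R (- x).
Proof. by move=> Rx; rewrite -sub0r; apply: subringB => //; exact: subring0. Qed.
Lemma subringD x y : R x -> R y -> R (x + y).
Proof.
by move=> Rx Ry; rewrite -[y]opprK; apply: subringB => //; exact: subringN.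
Qed.

Record prime_of := PrimeOf {
  prime_set :> set K;
  prime_sub : prime_set `<=` R;
  prime0 : prime_set 0;
  primeD : forall x y, prime_set x -> prime_set y -> prime_set (x + y);
  primeM : forall a x, R a -> prime_set x -> prime_set (a * x);
  prime1 : ~ prime_set 1;
  primeP : forall a b, R a -> R b -> prime_set (a * b) ->
    prime_set a \/ prime_set b }.

Lemma prime_ext (p q : prime_of) : (forall x, p x <-> q x) -> p = q.
Proof.
move: p q => [p h1 h2 h3 h4 h5 h6] [q g1 g2 g3 g4 g5 g6] /= pq.
have e : p = q by apply/funext => x; apply/propext.
move: e h1 h2 h3 h4 h5 h6 {pq} => -> *; f_equal; exact: Prop_irrelevance.
Qed.

Lemma prime_neq0 (p : prime_of) x : ~ p x -> x != 0.
Proof. by move=> px; apply/eqP => x0; apply: px; rewrite x0; exact: prime0. Qed.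

Lemma prime_mul (p : prime_of) x y : R x -> R y -> ~ p x -> ~ p y -> ~ p (x * y).
Proof. by move=> Rx Ry px py /primeP[]. Qed.

Definition generic_prime : prime_of.
Proof.
exists [set 0] => //=.
- by move=> _ ->; exact: subring0.
- by move=> x y -> ->; rewrite addr0.
- by move=> a x _ ->; rewrite mulr0.
- by apply/eqP; exact: oner_neq0.
- by move=> a b _ _ /eqP; rewrite mulf_eq0 => /orP[] /eqP; [left|right].
Defined.

HB.instance Definition _ := gen_eqMixin prime_of.
HB.instance Definition _ := gen_choiceMixin prime_of.

Definition spec_open (U : set prime_of) : Prop := forall p, U p ->
  exists f, [/\ R f, ~ p f & forall q : prime_of, ~ q f -> U q].

Fact spec_openT : spec_open setT.
Proof. by move=> p _; exists 1; split=> //; [exact: subring1|exact: prime1]. Qed.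

Fact spec_openI : setI_closed spec_open.
Proof.
move=> U V oU oV p [/oU[f [Rf pf fU]] /oV[g [Rg pg gV]]].
exists (f * g); split; [exact: subringM|exact: prime_mul|].
move=> q qfg; split; [apply: fU|apply: gV] => h; apply: qfg; last exact: primeM.
by rewrite mulrC; exact: primeM.
Qed.

Fact spec_open_bigU (I : Type) (f : I -> set prime_of) :
  (forall i, spec_open (f i)) -> spec_open (\bigcup_i f i).
Proof.
move=> of_ p [i _ fip]; have [g [Rg pg gf]] := of_ i _ fip.
by exists g; split=> // q /gf; exists i.
Qed.

HB.instance Definition _ :=
  isOpenTopological.Build prime_of spec_openT spec_openI spec_open_bigU.

Lemma openP (U : set prime_of) : open U <-> spec_open U.
Proof.
rewrite openE; split=> [oU p /oU|oU p Up].
  rewrite /interior => -[B [oB Bp BU]]; have [f [Rf pf fB]] := oB _ Bp.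
  by exists f; split=> // q /fB/BU.
by rewrite /interior; exists U; split.
Qed.

Lemma spec_D_open (f : K) : R f -> open [set p : prime_of | ~ p f].
Proof. by move=> Rf; apply/openP => p pf; exists f. Qed.

Lemma open_generic (U : set prime_of) p : open U -> U p -> U generic_prime.
Proof.
move=> /openP oU /oU[f [Rf pf fU]]; apply: fU => /= f0.
by move: pf; rewrite f0; apply; exact: prime0.
Qed.

Definition prime_loc (p : prime_of) (x : K) : Prop :=
  exists a b, [/\ R a, R b, ~ p b & x = a / b].

Lemma prime_locR p x : R x -> prime_loc p x.
Proof.
by move=> Rx; exists x, 1; rewrite divr1; split=> //; [exact: subring1|exact: prime1].
Qed.

Lemma prime_locB p x y : prime_loc p x -> prime_loc p y -> prime_loc p (x - y).
Proof.
move=> [a [b [Ra Rb pb ->]]] [c [d [Rc Rd pd ->]]].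
exists (a * d - c * b), (b * d); split.
- by apply: subringB; exact: subringM.
- exact: subringM.
- exact: prime_mul.
- by rewrite -mulNr addf_div ?mulNr //; [exact: prime_neq0 pb|exact: prime_neq0 pd].
Qed.

Lemma prime_locM p x y : prime_loc p x -> prime_loc p y -> prime_loc p (x * y).
Proof.
move=> [a [b [Ra Rb pb ->]]] [c [d [Rc Rd pd ->]]].
exists (a * c), (b * d); split; [exact: subringM|exact: subringM|exact: prime_mul|].
by rewrite mulf_div.
Qed.

(* Otherwise some prime avoiding f contains the ideal of denominators of x. *)
Lemma loc_all_fraction f x : R f -> (forall p : prime_of, ~ p f -> prime_loc p x) ->
  exists m, R (f ^+ m * x).
Proof.
move=> Rf hx; apply: contrapT => nm.
have [//|//|//||||||||P [JP PR PM [P0 PD PMul] PP]] := @prime_avoiding K R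
    [set d | R d /\ R (d * x)] [set y | exists m, y = f ^+ m].
- exact: subring1.
- exact: subringD.
- exact: subringM.
- by move=> d [].
- by rewrite /= mul0r; split; exact: subring0.
- move=> d e [Rd Rdx] [Re Rex]; rewrite /= mulrDl.
  by split; exact: subringD.
- move=> a d Ra [Rd Rdx]; rewrite /= -mulrA; by split; exact: subringM.
- by exists 0%N.
- by move=> _ _ [m ->] [l ->]; exists (m + l)%N; rewrite exprD.
- by move=> y [_ Ryx] [m ym]; apply: nm; exists m; rewrite -ym.
have P1 : ~ P 1 by move=> /PM; apply; exists 0%N.
pose p := PrimeOf PR P0 PD PMul P1 PP.
have [|a [b [Ra Rb pb xE]]] := hx p.
  by move=> /PM; apply; exists 1%N; rewrite expr1.
have b0 := prime_neq0 pb; apply: pb; apply: JP; split=> //.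
by rewrite /= xE mulrC divfK.
Qed.

Lemma loc_all_subring x : (forall p, prime_loc p x) -> R x.
Proof.
move=> hx; have [m|m] := @loc_all_fraction 1 x (@subring1 _ R); first by [].
by rewrite expr1n mul1r.
Qed.

End SubringTheory.

Section SpecSheaf.
Variables (K : fieldType) (R : subring_of K).
Local Notation X := (prime_of R).

(** Over a nonempty [U] this is one element of K lying in all R_p, p in [U]. Taking constant
    functions on [U] rather than elements of K makes the ring over the empty set zero, as the sheaf
    axioms demand. *)
Record spec_sec (U : opens X) := SpecSec {
  spec_val :> {p : X | U p} -> K;
  spec_val_loc : forall p, prime_loc (sval p) (spec_val p);
  spec_val_const : forall p q, spec_val p = spec_val q }.

Section SpecSecRing.
Variable U : opens X.
Implicit Types s t : spec_sec U.

Lemma spec_sec_ext s t : (forall p, s p = t p) -> s = t.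
Proof.
case: s t => [s h1 h2] [t g1 g2] /= /funext e.
move: e h1 h2 => -> *; f_equal; exact: Prop_irrelevance.
Qed.

HB.instance Definition _ := gen_eqMixin (spec_sec U).
HB.instance Definition _ := gen_choiceMixin (spec_sec U).

Definition spec_const (x : K) (hx : forall p, U p -> prime_loc p x) : spec_sec U :=
  @SpecSec U (fun _ => x) (fun p => hx _ (svalP p)) (fun _ _ => erefl).

Lemma prime_loc_const (x : K) : R x -> forall p, U p -> prime_loc p x.
Proof. by move=> Rx p _; exact: prime_locR. Qed.

Definition spec_zero := spec_const (prime_loc_const (subring0 R)).
Definition spec_one := spec_const (prime_loc_const (subring1 R)).
Definition spec_sub s t : spec_sec U := @SpecSec U (fun p => s p - t p)
  (fun p => prime_locB (spec_val_loc s p) (spec_val_loc t p))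
  (fun p q => congr2 (fun x y => x - y) (spec_val_const s p q) (spec_val_const t p q)).
Definition spec_mul s t : spec_sec U := @SpecSec U (fun p => s p * t p)
  (fun p => prime_locM (spec_val_loc s p) (spec_val_loc t p))
  (fun p q => congr2 (fun x y => x * y) (spec_val_const s p q) (spec_val_const t p q)).
Definition spec_opp s := spec_sub spec_zero s.
Definition spec_add s t := spec_sub s (spec_opp t).

Fact spec_addA : associative spec_add.
Proof. by move=> s t u; apply: spec_sec_ext => p /=; ring. Qed.
Fact spec_addC : commutative spec_add.
Proof. by move=> s t; apply: spec_sec_ext => p /=; ring. Qed.
Fact spec_add0 : left_id spec_zero spec_add.
Proof. by move=> s; apply: spec_sec_ext => p /=; ring. Qed.
Fact spec_addN : left_inverse spec_zero spec_opp spec_add.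
Proof. by move=> s; apply: spec_sec_ext => p /=; ring. Qed.
HB.instance Definition _ := GRing.isZmodule.Build (spec_sec U)
  spec_addA spec_addC spec_add0 spec_addN.

Fact spec_mulA : associative spec_mul.
Proof. by move=> s t u; apply: spec_sec_ext => p /=; exact: mulrA. Qed.
Fact spec_mulC : commutative spec_mul.
Proof. by move=> s t; apply: spec_sec_ext => p /=; exact: mulrC. Qed.
Fact spec_mul1 : left_id spec_one spec_mul.
Proof. by move=> s; apply: spec_sec_ext => p /=; exact: mul1r. Qed.
Fact spec_mulDl : left_distributive spec_mul spec_add.
Proof. by move=> s t u; apply: spec_sec_ext => p /=; ring. Qed.
HB.instance Definition _ := GRing.Zmodule_isComPzRing.Build (spec_sec U)
  spec_mulA spec_mulC spec_mul1 spec_mulDl.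

Lemma spec_valD s t p : (s + t) p = s p + t p.
Proof. by change (s p - (0 - t p) = s p + t p); rewrite sub0r opprK. Qed.
Lemma spec_valB s t p : (s - t) p = s p - t p.
Proof. by rewrite spec_valD; congr (_ + _); exact: sub0r. Qed.
Lemma spec_valM s t p : (s * t) p = s p * t p. Proof. by []. Qed.
Lemma spec_val1 p : (1 : spec_sec U) p = 1. Proof. by []. Qed.
Lemma spec_valX s m p : (s ^+ m) p = s p ^+ m.
Proof. by elim: m => [|m IHm]; rewrite ?expr0 // !exprS spec_valM IHm. Qed.

End SpecSecRing.

Definition spec_pt_incl (U V : opens X) (h : V `<=` U) (p : {p : X | V p}) :
  {p : X | U p} := exist _ (sval p) (h _ (svalP p)).

Definition spec_restr (U V : opens X) (h : V `<=` U) (s : spec_sec U) : spec_sec V :=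
  @SpecSec V (fun p => s (spec_pt_incl h p))
    (fun p => spec_val_loc s (spec_pt_incl h p))
    (fun p q => spec_val_const s (spec_pt_incl h p) (spec_pt_incl h q)).

Fact spec_restr_zmod U V h : zmod_morphism (@spec_restr U V h).
Proof. by move=> s t; apply: spec_sec_ext => p; rewrite [RHS]spec_valB; exact: spec_valB. Qed.
Fact spec_restr_monoid U V h : monoid_morphism (@spec_restr U V h).
Proof. by split=> [|s t]; apply: spec_sec_ext. Qed.
HB.instance Definition _ U V h := GRing.isZmodMorphism.Build
  (spec_sec U) (spec_sec V) (@spec_restr U V h) (spec_restr_zmod h).
HB.instance Definition _ U V h := GRing.isMonoidMorphism.Build
  (spec_sec U) (spec_sec V) (@spec_restr U V h) (spec_restr_monoid h).

Lemma spec_val_at (U : opens X) (s : spec_sec U) (x : X) (h h' : U x) :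
  s (exist _ x h) = s (exist _ x h').
Proof. exact: spec_val_const. Qed.

Definition spec_ringed_space : ringed_space.
Proof.
refine (@RingedSpace X (fun U => spec_sec U : comPzRingType)
  (fun U V h => @spec_restr U V h) _ _ _ _).
- by move=> U h s; apply: spec_sec_ext => -[x Ux]; exact: (spec_val_const s).
- move=> U V W hUV hVW hUW s; apply: spec_sec_ext => -[x Wx].
  exact: (spec_val_const s).
- move=> U I V hV cov s t st; apply: spec_sec_ext => -[x Ux].
  have [i Vx] := cov x Ux.
  have := congr1 (fun u : spec_sec (V i) => u (exist _ x Vx)) (st i) => /=.
  by rewrite /spec_pt_incl /= (spec_val_at s _ Ux) (spec_val_at t _ Ux).
- move=> U I V hV cov s ags.
  pose ix (p : {p : X | U p}) := cid (cov _ (svalP p)).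
  pose v p := s (sval (ix p)) (exist _ (sval p) (svalP (ix p))).
  (* Nonempty open sets all contain the generic point, where the two values can be compared. *)
  have eqv i j (p : {p : X | V i p}) (q : {p : X | V j p}) : s i p = s j q.
    have gV l (r : {p : X | V l p}) : V l (generic_prime R).
      exact: open_generic (open_oset (V l)) (svalP r).
    have gW : opensI (V i) (V j) (generic_prime R) by split; [exact: gV p|exact: gV q].
    have := ags i j (opensI (V i) (V j)) (fun x h => proj1 h) (fun x h => proj2 h).
    move=> /(congr1 (fun u : spec_sec (opensI (V i) (V j)) => u (exist _ _ gW))) /= e.
    exact: etrans (spec_val_const (s i) p _) (etrans e (spec_val_const (s j) _ q)).
  have vl p : prime_loc (sval p) (v p).
    exact: (spec_val_loc (s (sval (ix p))) (exist _ (sval p) (svalP (ix p)))).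
  have vc p q : v p = v q by exact: eqv.
  exists (@SpecSec U v vl vc).
  by move=> i; apply: spec_sec_ext => p; exact: eqv.
Defined.

Lemma spec_germ_unit (U : opens spec_ringed_space)
    (s : sec spec_ringed_space U) (x : X) (Ux : U x) :
  germ_unit s x <-> exists a b, [/\ R a, R b, ~ x a, ~ x b &
    (s : spec_sec U) (exist _ x Ux) = a / b].
Proof.
split=> [[V [h [Vx [t Ht]]]]|[a [b [Ra Rb xa xb sE]]]].
  have := congr1 (fun u : spec_sec V => u (exist _ x Vx)) Ht.
  rewrite spec_valM spec_val1 /= (spec_val_at _ _ Ux) => ts.
  have [a [b [Ra Rb xb sE]]] := spec_val_loc (s : spec_sec U) (exist _ x Ux).
  have [c [d [Rc Rd xd tE]]] := spec_val_loc (t : spec_sec V) (exist _ x Vx).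
  exists a, b; split=> // xa.
  have b0 := prime_neq0 xb; have d0 := prime_neq0 xd.
  have db : d * b = c * a.
    have := ts; rewrite tE sE => e.
    rewrite -[LHS]mulr1 -e; field; by rewrite b0 d0.
  apply: (prime_mul (p := x) Rd Rb xd xb); rewrite db; exact: primeM.
have oW : open [set p : X | U p /\ ~ p a].
  have -> : [set p : X | U p /\ ~ p a] = U `&` [set p | ~ p a] by [].
  by apply: openI; [exact: open_oset|exact: spec_D_open].
pose W : opens X := Opens oW.
have hW : W `<=` U by move=> p [].
have hl p : W p -> prime_loc p (b / a) by move=> [_ pa]; exists b, a.
exists W, hW; split; first by split.
exists (spec_const hl); apply: spec_sec_ext => p; rewrite spec_valM spec_val1 /=.
rewrite (spec_val_const _ _ (exist _ x Ux)) sE.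
by field; rewrite (prime_neq0 xa) (prime_neq0 xb).
Qed.

Lemma spec_germ_unitR (U : opens spec_ringed_space)
    (s : sec spec_ringed_space U) (x : X) (Ux : U x) :
  R ((s : spec_sec U) (exist _ x Ux)) ->
  germ_unit s x <-> ~ x ((s : spec_sec U) (exist _ x Ux)).
Proof.
set y := (X in R X) => Ry; rewrite (spec_germ_unit s Ux) -/y.
split=> [[a [b [Ra Rb xa xb yE]]] xy|xy].
  apply: xa; have -> : a = b * y by rewrite yE mulrC divfK // (prime_neq0 xb).
  exact: primeM.
exists y, 1; rewrite divr1; split=> //; [exact: subring1|exact: prime1].
Qed.

Definition spec_glob (x : K) (Rx : R x) :
  sec spec_ringed_space (opensT spec_ringed_space) := spec_const (prime_loc_const Rx).

Definition glob_val (s : sec spec_ringed_space (opensT spec_ringed_space)) : K :=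
  (s : spec_sec _) (exist _ (generic_prime R) I).

Lemma glob_valR s : R (glob_val s).
Proof.
apply: loc_all_subring => p.
have -> : glob_val s = (s : spec_sec (opensT spec_ringed_space)) (exist _ p I).
  exact: spec_val_const.
exact: (@spec_val_loc (opensT spec_ringed_space) s (exist _ p I)).
Qed.

Lemma glob_valE s (q : {p : X | opensT spec_ringed_space p}) :
  (s : spec_sec (opensT spec_ringed_space)) q = glob_val s.
Proof. exact: spec_val_const. Qed.

Lemma glob_val_inj s t : glob_val s = glob_val t -> s = t.
Proof. by move=> e; apply: spec_sec_ext => p; rewrite !glob_valE e. Qed.

Lemma glob_valK x (Rx : R x) : glob_val (spec_glob Rx) = x. Proof. by []. Qed.

Lemma glob_valD s t : glob_val (s + t) = glob_val s + glob_val t.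
Proof. exact: (@spec_valD (opensT spec_ringed_space)). Qed.
Lemma glob_valB s t : glob_val (s - t) = glob_val s - glob_val t.
Proof. exact: (@spec_valB (opensT spec_ringed_space)). Qed.
Lemma glob_valM s t : glob_val (s * t) = glob_val s * glob_val t.
Proof. by []. Qed.
Lemma glob_valX s m : glob_val (s ^+ m) = glob_val s ^+ m.
Proof. exact: (@spec_valX (opensT spec_ringed_space)). Qed.

Lemma glob_unit s (x : X) :
  @germ_unit spec_ringed_space _ s x <-> ~ x (glob_val s).
Proof.
have := @spec_germ_unitR (opensT spec_ringed_space) s x I.
by rewrite glob_valE => /(_ (glob_valR s)).
Qed.

Lemma spec_affine : affine (opensT spec_ringed_space).
Proof.
have NE (x : X) : [set s | ~ germ_unit s (x : spec_ringed_space)] =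
    [set s : sec spec_ringed_space (opensT spec_ringed_space) | x (glob_val s)].
  apply/funext => s; apply/propext; rewrite /= glob_unit.
  by split=> [/contrapT//|h /(_ h)].
split.
- move=> x _; rewrite NE; split.
  + exact: prime0.
  + move=> a b xa xb; have := primeD xa xb; by rewrite -glob_valD.
  + by move=> a b xb; have := primeM (glob_valR a) xb; rewrite -glob_valM.
  + exact: prime1.
  + by move=> a b; apply: (@primeP _ _ x); exact: glob_valR.
- move=> P [P0 PD PM P1 PP].
  pose Q := [set x : K | exists2 s, P s & glob_val s = x].
  have QE s : Q (glob_val s) <-> P s.
    by split=> [[t Pt /glob_val_inj <-]//|Ps]; exists s.
  have [] : [/\ Q `<=` R, Q 0, forall x y, Q x -> Q y -> Q (x + y),
     forall a x, R a -> Q x -> Q (a * x) & ~ Q 1].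
    split.
    + by move=> _ [s _ <-]; exact: glob_valR.
    + by exists 0.
    + move=> _ _ [s Ps <-] [t Pt <-]; exists (s + t); first exact: PD.
      by rewrite glob_valD.
    + by move=> a _ Ra [s Ps <-]; exists (spec_glob Ra * s); first exact: PM.
    + by move=> [s Ps e]; apply: P1; rewrite (_ : 1 = s) //; exact: glob_val_inj.
  move=> QR Q0 QD QM Q1.
  have QP a b : R a -> R b -> Q (a * b) -> Q a \/ Q b.
    move=> Ra Rb; rewrite -[a * b]/(glob_val (spec_glob Ra * spec_glob Rb)).
    move=> /QE /PP[h|h]; [left|right].
      by exists (spec_glob Ra).
    by exists (spec_glob Rb).
  exists (PrimeOf QR Q0 QD QM Q1 QP); split.
    split=> //; rewrite NE; apply/funext => s; apply/propext => /=.
    by rewrite QE.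
  move=> y [_ Py]; apply: prime_ext => x /=; split=> [[s Ps <-]|yx].
    by move: Ps; rewrite Py NE.
  have Rx : R x by exact: prime_sub yx.
  by exists (spec_glob Rx) => //; rewrite Py NE.
- move=> W x _ Wx; have /openP oW := open_oset W.
  have [f [Rf xf fW]] := oW x Wx.
  exists (spec_glob Rf); split; first by split=> //; apply/glob_unit.
  by move=> q [_ /glob_unit]; exact: fW.
(* For s = 0 the basic open set is empty and has no generic point at which to evaluate. *)
- move=> s; have [s0|s0] := eqVneq (glob_val s) 0.
    have sz : s = 0 by exact: glob_val_inj.
    have emp (p : {p : X | basic_open s p}) : False.
      by case: p => p [_ /glob_unit]; rewrite s0; apply; exact: prime0.
    split.
    + by exists 0; apply: spec_sec_ext => p; case: (emp p).
    + by move=> b; exists 0%N, 0; apply: spec_sec_ext => p; case: (emp p).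
    + by move=> a _; exists 1%N; rewrite expr1 sz mul0r.
  have gD : basic_open s (generic_prime R).
    by split=> //; apply/glob_unit => /= e; rewrite e eqxx in s0.
  split.
  + have hl p : basic_open s p -> prime_loc p (glob_val s)^-1.
      move=> [_ /glob_unit ps]; exists 1, (glob_val s); rewrite div1r.
      by split=> //; [exact: subring1|exact: glob_valR].
    exists (spec_const hl); apply: spec_sec_ext => p; rewrite spec_valM spec_val1 /=.
    by rewrite glob_valE mulVf.
  + move=> b; pose x := (b : spec_sec _) (exist _ _ gD).
    have [m Rm] : exists m, R (glob_val s ^+ m * x).
      apply: loc_all_fraction; first exact: glob_valR.
      move=> p ps; have Dp : basic_open s p by split=> //; apply/glob_unit.
      rewrite /x (@spec_val_const (basic_open s) b _ (exist _ _ Dp)).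
      exact: (@spec_val_loc (basic_open s) b (exist _ _ Dp)).
    exists m, (spec_glob Rm); apply: spec_sec_ext => p.
    rewrite spec_valM /= (@spec_val_const (basic_open s) b _ (exist _ _ gD)) -/x.
    congr (_ * _).
    by rewrite spec_valX; congr (_ ^+ _); exact: glob_valE.
  + move=> a /(congr1 (fun u : spec_sec (basic_open s) => u (exist _ _ gD))).
    move=> a0; exists 0%N; rewrite expr0 mul1r; apply: glob_val_inj.
    by apply: etrans a0; exact: (esym (glob_valE a _)).
Qed.

Definition spec_scheme : scheme :=
  @Scheme spec_ringed_space (fun x => ex_intro _ _ (conj spec_affine I)).

End SpecSheaf.

Section SpecTopology.
Variables (K : fieldType) (R : subring_of K).
Local Notation X := (prime_of R).

Lemma spec_closedP (F : set X) (p : X) : closed F -> ~ F p ->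
  exists f, [/\ R f, ~ p f & forall q : X, F q -> q f].
Proof.
move=> /closed_openC/openP oF /oF[f [Rf pf fF]]; exists f; split=> // q Fq.
by apply: contrapT => /fF.
Qed.

Lemma closed_specialization (F : set X) (p q : X) :
  closed F -> F p -> p `<=` q -> F q.
Proof.
move=> cF Fp pq; apply: contrapT => /(spec_closedP cF)[f [_ qf fF]].
exact/qf/pq/fF.
Qed.

Definition spec_V (p : X) : set X := [set q | p `<=` q].

Lemma spec_V_closed p : closed (spec_V p).
Proof.
rewrite -[spec_V p]setCK; apply: open_closedC; apply/openP => q.
move=> /existsNP[f /not_implyP[pf qf]].
exists f; split=> // [|r rf /(_ f pf)//]; exact: prime_sub pf.
Qed.

Lemma spec_V_irreducible p : irreducible_set (spec_V p).
Proof.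
split=> [|F G cF cG h]; first by exists p.
by have [Fp|Gp] := h p (fun x => id); [left|right] => q; exact: closed_specialization.
Qed.

Lemma spec_V_generic : spec_V (generic_prime R) = [set: X].
Proof. by apply/seteqP; split=> // q _ x /= ->; exact: prime0. Qed.

Lemma closed_irreducible_V (Z : set X) : closed Z -> irreducible_set Z ->
  exists p, Z = spec_V p.
Proof.
move=> cZ [[z Zz] irr].
pose P := [set a : K | R a /\ forall q : X, Z q -> q a].
have cV (f : K) : R f -> closed [set q : X | q f].
  move=> Rf; rewrite -[X in closed X]setCK; apply: open_closedC.
  exact: spec_D_open.
have [] : [/\ P `<=` R, P 0, forall x y, P x -> P y -> P (x + y),
   forall a x, R a -> P x -> P (a * x) & ~ P 1].
  split.
  - by move=> a [].
  - by split=> [|q _]; [exact: subring0|exact: prime0].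
  - move=> x y [Rx Px] [Ry Py]; split=> [|q Zq]; first exact: subringD.
    by apply: primeD; [exact: Px|exact: Py].
  - move=> a x Ra [Rx Px]; split=> [|q Zq]; first exact: subringM.
    by apply: primeM => //; exact: Px.
  - by move=> [_ /(_ z Zz)]; exact: prime1.
move=> PR P0 PD PM P1.
have PP a b : R a -> R b -> P (a * b) -> P a \/ P b.
  move=> Ra Rb [_ Pab].
  have [|h|h] := irr _ _ (cV a Ra) (cV b Rb).
  - by move=> q /Pab/primeP; apply.
  - by left.
  - by right.
exists (PrimeOf PR P0 PD PM P1 PP); apply/seteqP; split=> [q Zq a [_]|q /= Pq].
  exact.
apply: contrapT => /(spec_closedP cZ)[f [Rf qf fZ]]; exact/qf/Pq.
Qed.

Lemma spec_irreducible : irreducible (spec_scheme R).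
Proof. by rewrite /irreducible -spec_V_generic; exact: spec_V_irreducible. Qed.

(** In a chain of length 2 the middle closed set is not the whole space, so its prime is nonzero;
    the hypothesis then makes it equal to the prime of the smallest closed set. *)
Lemma spec_krull_dim1 (m : X) (a0 : K) : m a0 -> a0 != 0 ->
  (forall p q : X, p `<=` q -> (exists2 a, p a & a != 0) -> q `<=` p) ->
  krull_dim (spec_scheme R) 1.
Proof.
move=> ma0 a00 dim1; split.
  exists (fun i => if i is 0%N then spec_V m else spec_V (generic_prime R)).
  split=> [i _|].
    by case: i => [|i]; split;
      [exact: spec_V_closed|exact: spec_V_irreducible|exact: spec_V_closed
      |exact: spec_V_irreducible].
  move=> [|//] _; rewrite spec_V_generic; split=> // /(_ (generic_prime R) I).
  by move=> /(_ a0 ma0)/= e; rewrite e eqxx in a00.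
move=> [Z [Zci Zlt]].
have /choice[P PE] : forall i, exists p, (i <= 2)%N -> Z i = spec_V p.
  move=> i; have [i2|_] := boolP (i <= 2)%N; last by exists m.
  have [ci ii] := Zci i i2.
  by have [p e] := closed_irreducible_V ci ii; exists p.
have lt01 := Zlt 0%N isT; have lt12 := Zlt 1%N isT.
rewrite !PE // in lt01 lt12.
have sub p q : spec_V p `<=` spec_V q -> q `<=` p by apply; exact: subset_refl.
have [s01 n01] := lt01; have [s12 n12] := lt12.
apply: n01 => q Pq; apply: subset_trans Pq.
apply: dim1; first exact: sub.
apply: contrapT => P1z; apply: n12 => r _ x P1x.
have -> : x = 0 by apply/eqP; apply: contrapT => /negP x0; apply: P1z; exists x.
exact: prime0.
Qed.

End SpecTopology.

Section SpecOverField.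
Variables (k K : fieldType) (R : subring_of K) (phi : {rmorphism k -> K}).
Hypothesis Rphi : forall c, R (phi c).
Local Notation X := (spec_scheme R).
Local Notation OT := (sec X (opensT X)).

Definition spec_struct (c : k) : OT := spec_glob (Rphi c).

Fact spec_struct_zmod : zmod_morphism spec_struct.
Proof. by move=> a b; apply: glob_val_inj; rewrite glob_valB !glob_valK rmorphB. Qed.
Fact spec_struct_monoid : monoid_morphism spec_struct.
Proof.
by split=> [|a b]; apply: glob_val_inj; rewrite ?glob_valM !glob_valK ?rmorph1 ?rmorphM.
Qed.
HB.instance Definition _ := GRing.isZmodMorphism.Build k OT spec_struct spec_struct_zmod.
HB.instance Definition _ := GRing.isMonoidMorphism.Build k OT spec_struct spec_struct_monoid.

Definition spec_kscheme : kscheme k := @KScheme k X spec_struct.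

Lemma glob_val_kconst c : glob_val (kconst (X := spec_kscheme) (opensT X) c) = phi c.
Proof. by []. Qed.

Lemma spec_finite_type (m : nat) (g : 'I_m -> K) : (forall i, R (g i)) ->
  (forall S : set K, (forall c, S (phi c)) -> (forall i, S (g i)) ->
    (forall x y, S x -> S y -> S (x + y)) ->
    (forall x y, S x -> S y -> S (x * y)) -> R `<=` S) ->
  finite_type spec_kscheme.
Proof.
move=> Rg gen; exists 1%N, (fun _ => opensT X); split; first by exists ord0.
move=> _; split; first exact: spec_affine.
exists m, (fun i => spec_glob (Rg i)) => S Sk Sg SD SM s.
have : R (glob_val s) by exact: glob_valR.
pose T := [set x : K | R x /\ forall t : OT, glob_val t = x -> S t].
have eqS (t t' : OT) : S t -> glob_val t' = glob_val t -> S t'.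
  by move=> St /glob_val_inj ->.
move=> /(gen T) h; have [] := h _ _ _ _ => //.
- by move=> c; split=> // t; exact: (eqS _ t (Sk c)).
- by move=> i; split=> // t; exact: (eqS _ t (Sg i)).
- move=> x y [Rx Sx] [Ry Sy]; split; first exact: subringD.
  move=> t te; apply: (eqS (spec_glob Rx + spec_glob Ry)).
    by apply: SD; [exact: Sx|exact: Sy].
  by rewrite te glob_valD.
- move=> x y [Rx Sx] [Ry Sy]; split; first exact: subringM.
  move=> t te; apply: (eqS (spec_glob Rx * spec_glob Ry)).
    by apply: SM; [exact: Sx|exact: Sy].
  by rewrite te glob_valM.
- by move=> _; exact.
Qed.

Lemma spec_rational_pointP (x : prime_of R) :
  rational_points spec_kscheme x <-> forall a, R a -> exists c, x (a - phi c).
Proof.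
split=> [rx a Ra|rx U s Ux].
  have [c] := rx (opensT X) (spec_glob Ra) I.
  move=> h; exists c; apply: contrapT => xac; apply: h; apply/glob_unit.
  by rewrite glob_valB glob_val_kconst.
have [a [b [Ra Rb xb sE]]] := spec_val_loc (s : spec_sec (R := R) U) (exist _ x Ux).
have [ca xa] := rx a Ra; have [cb xcb] := rx b Rb.
have cb0 : phi cb != 0.
  apply/eqP => e; apply: xb; rewrite -[b]subr0 -e; exact: xcb.
exists (ca / cb) => /(@spec_germ_unit K R U _ x Ux)[a' [b' [Ra' Rb' xa' xb' E]]].
have {}E : a / b - phi (ca / cb) = a' / b'.
  rewrite -E; apply: etrans _ (esym (@spec_valB K R U s _ (exist _ x Ux))).
  by congr (_ - _); exact: esym sE.
have b0 := prime_neq0 xb; have b'0 := prime_neq0 xb'.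
have Rc c : R (phi c) := Rphi c.
have xx : x (a * phi cb - phi ca * b).
  have -> : a * phi cb - phi ca * b =
      phi cb * (a - phi ca) + (- phi ca) * (b - phi cb) by ring.
  by apply: primeD; apply: primeM => //; exact: subringN.
apply: (prime_mul (p := x) Ra' (subringM Rb (Rc cb)) xa' (prime_mul Rb (Rc cb) xb _)).
  move=> xc; have := primeM (Rc cb^-1) xc.
  rewrite -rmorphM mulVf ?rmorph1; first exact: (@prime1 _ _ x).
  by rewrite -(fmorph_eq0 phi).
have -> : a' * (b * phi cb) = b' * (a * phi cb - phi ca * b).
  have := E; rewrite fmorph_div => /(congr1 (fun y => y * (b * phi cb * b'))) e.
  transitivity (a' / b' * (b * phi cb * b')); first by field.
  by rewrite -e; field; rewrite b0 cb0.
exact: primeM.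
Qed.

End SpecOverField.

Lemma frac_sub (K : fieldType) (a b u v : K) : u != 0 -> v != 0 ->
  a / u - b / v = (a * v - b * u) / (u * v).
Proof. by move=> u0 v0; rewrite -mulNr addf_div // mulNr. Qed.

Lemma subM_decomp (S : comPzRingType) (a b u v : S) :
  a * b - u * v = b * (a - u) + u * (b - v).
Proof. by ring. Qed.

(** Isolates coefficient [m], to be used with the lowest coefficient that is nonzero, or that a
    given prime does not divide. *)
Lemma horner_split (A S : comNzRingType) (f : {rmorphism A -> S}) (H : {poly A})
    (b : S) (m : nat) : (m < size H)%N ->
  (map_poly f H).[b] = \sum_(i < m) f H`_i * b ^+ i + b ^+ m * (f H`_m +
    b * \sum_(i < size H - m.+1) f H`_(m.+1 + i) * b ^+ i).
Proof.
move=> mH; rewrite (@horner_coef_wide _ (m.+1 + (size H - m.+1))); last first.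
  by rewrite subnKC ?size_poly.
rewrite big_split_ord /= big_ord_recr /= -addrA; congr (_ + _).
  by apply: eq_bigr => i _; rewrite coef_map.
rewrite coef_map mulrDr [f _ * _]mulrC; congr (_ + _).
rewrite mulrA -exprSr mulr_sumr; apply: eq_bigr => i _.
by rewrite coef_map exprD mulrCA.
Qed.

(** * The smooth curve defined by a system *)

Section SystemCurve.
Variables (k : fieldType) (n : nat) (c : 'I_n.+1 -> k).
Variable p : 'I_n.+1 -> {mpoly k[n.+1]}.
Hypotheses (c0 : c ord0 = 0) (p0 : p ord0 = 1).
Variables (z : 'I_n.+1 -> pser k).
Hypothesis z_sys : ps_system c p z.
Variables (K : fieldType) (j : {rmorphism pser k -> K}).
Hypothesis j_inj : injective j.
Variable w : {mpoly k[n.+1]}.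
Hypothesis wc : meval c w = 1.
Hypothesis w_rel : forall q, sys_rel z q -> sys_ideal c p (w * q).
Hypothesis w_lift : forall (S : comNzRingType) (f : {rmorphism k -> S})
  (J : S -> Prop) (g : 'I_n.+1 -> S),
  is_ideal J -> (forall a b, J a -> J b -> a * b = 0) ->
  (forall i, J (mmap f g (sys_eq c p i))) ->
  (exists u, u * mmap f g w = 1) ->
  exists2 g', forall i, J (g' i - g i) &
    forall i, g' i = f (c i) + g' ord0 * mmap f g' (p i).

Let ez (q : {mpoly k[n.+1]}) : K := j (mmap (ps_C k) z q).

Let ezD q r : ez (q + r) = ez q + ez r.
Proof. by rewrite /ez !rmorphD. Qed.
Let ezB q r : ez (q - r) = ez q - ez r.
Proof. by rewrite /ez !rmorphB. Qed.
Let ezM q r : ez (q * r) = ez q * ez r.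
Proof. by rewrite /ez !rmorphM. Qed.
Let ez1 : ez 1 = 1.
Proof. by rewrite /ez !rmorph1. Qed.
Let ez0 : ez 0 = 0.
Proof. by rewrite /ez !rmorph0. Qed.
Let ezX q m : ez (q ^+ m) = ez q ^+ m.
Proof. by rewrite /ez !rmorphXn. Qed.
Let ez_rel q : ez q = 0 -> sys_rel z q.
Proof. by move=> e; apply: j_inj; rewrite rmorph0. Qed.
Let rel_c q : sys_rel z q -> meval c q = 0.
Proof. by move=> r; rewrite -(sys_coef0 c0 p0 z_sys) r rmorph0. Qed.
Let ezw0 : ez w != 0.
Proof. by apply/eqP => /ez_rel/rel_c/eqP; rewrite wc oner_eq0. Qed.
Let ezwm m : ez w ^+ m != 0. Proof. exact: expf_neq0 ezw0. Qed.

(** The ring k[z][1/w]. By the hypotheses on [w], its inversion makes the equations generate the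
    relations and allows lifts; w(c) = 1 keeps the point c on the curve. *)
Definition curve_set : set K := [set x | exists q m, x = ez q / ez w ^+ m].

Fact curve_set1 : curve_set 1.
Proof. by exists 1, 0%N; rewrite ez1 expr0 divr1. Qed.
Fact curve_setB x y : curve_set x -> curve_set y -> curve_set (x - y).
Proof.
move=> [q [m ->]] [r [l ->]]; exists (q * w ^+ l - r * w ^+ m), (m + l)%N.
by rewrite ezB !ezM !ezX exprD frac_sub.
Qed.
Fact curve_setM x y : curve_set x -> curve_set y -> curve_set (x * y).
Proof.
move=> [q [m ->]] [r [l ->]]; exists (q * r), (m + l)%N.
by rewrite ezM exprD mulf_div.
Qed.

Definition curve_ring : subring_of K := SubringOf curve_set1 curve_setB curve_setM.
Local Notation R := curve_ring.

Let R_ez q : R (ez q). Proof. by exists q, 0%N; rewrite expr0 divr1. Qed.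
Let R_winv m : R (ez w ^- m).
Proof. by exists 1, m; rewrite ez1 mul1r. Qed.

Let phi : {rmorphism k -> K} := j \o ps_C k.
Let phiE a : phi a = ez a%:MP. Proof. by rewrite /ez mmapC. Qed.
Let Rphi a : R (phi a). Proof. by rewrite phiE; exact: R_ez. Qed.

Definition curve_kscheme : kscheme k := spec_kscheme Rphi.

Let num_prime (x : prime_of R) q m : x (ez q / ez w ^+ m) <-> x (ez q).
Proof.
split=> h; last by rewrite mulrC; apply: primeM => //; exact: R_winv.
rewrite -[ez q](divfK (ezwm m)) mulrC; apply: primeM => //.
by rewrite -ezX; exact: R_ez.
Qed.

Lemma curve_finite_type : finite_type curve_kscheme.
Proof.
pose g (i : 'I_n.+2) := if unlift ord_max i is Some l then ez 'X_l else (ez w)^-1.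
apply: (@spec_finite_type k K R phi Rphi n.+2 g).
  move=> i; rewrite /g; case: unlift => [l|]; first exact: R_ez.
  by have := R_winv 1; rewrite expr1.
move=> S Sk Sg SD SM x [q [m ->]]; apply: (SM).
  elim/mpoly_alg_ind: q => [a|i|q r Hq Hr|q r Hq Hr].
  - by rewrite -phiE.
  - by have := Sg (lift ord_max i); rewrite /g liftK.
  - by rewrite ezD; exact: SD.
  - by rewrite ezM; exact: SM.
have Sw : S (ez w)^-1 by have := Sg ord_max; rewrite /g unlift_none.
elim: m => [|m IHm]; first by rewrite expr0 invr1 -(rmorph1 phi).
by rewrite exprSr invfM; exact: SM.
Qed.

Definition curve_point_set : set K :=
  [set x | exists q m, x = ez q / ez w ^+ m /\ meval c q = 0].

Let point_num q m : curve_point_set (ez q / ez w ^+ m) -> meval c q = 0.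
Proof.
move=> [r [l [e rc]]].
have /ez_rel/rel_c : ez (q * w ^+ l - r * w ^+ m) = 0.
  by rewrite ezB !ezM !ezX -[ez q](divfK (ezwm m)) e mulrAC divfK // subrr.
by rewrite mevalB !mevalM !rmorphXn /= wc rc !expr1n mul0r subr0 mulr1.
Qed.

Definition curve_point : prime_of R.
Proof.
exists curve_point_set.
- by move=> _ [q [m [-> _]]]; exists q, m.
- by exists 0, 0%N; rewrite ez0 mul0r meval0.
- move=> _ _ [q [m [-> qc]]] [r [l [-> rc]]].
  exists (q * w ^+ l + r * w ^+ m), (m + l)%N.
  rewrite mevalD !mevalM qc rc !mul0r addr0; split=> //.
  by rewrite ezD !ezM !ezX exprD addf_div.
- move=> _ _ [q [m ->]] [r [l [-> rc]]]; exists (q * r), (m + l)%N.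
  rewrite mevalM rc mulr0; split=> //.
  by rewrite ezM exprD mulf_div.
- move=> h; have := @point_num 1 0%N; rewrite ez1 expr0 divr1 => /(_ h)/eqP.
  by rewrite meval1 oner_eq0.
- move=> _ _ [q [m ->]] [r [l ->]].
  have -> : ez q / ez w ^+ m * (ez r / ez w ^+ l) = ez (q * r) / ez w ^+ (m + l).
    by rewrite ezM exprD mulf_div.
  move=> /point_num /eqP; rewrite mevalM mulf_eq0 => /orP[] /eqP h.
    by left; exists q, m.
  by right; exists r, l.
Defined.

Lemma curve_point_rational : rational_points curve_kscheme curve_point.
Proof.
apply/spec_rational_pointP => _ [q [m ->]]; exists (meval c q).
exists (q - (meval c q)%:MP * w ^+ m), m.
rewrite mevalB mevalM mevalC rmorphXn /= wc expr1n mulr1 subrr; split=> //.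
by rewrite ezB ezM ezX -phiE mulrBl mulfK.
Qed.

Lemma curve_rational_coords (x : curve_kscheme) : rational_points curve_kscheme x ->
  exists2 v : 'I_n.+1 -> k, (forall q, (x : prime_of R) (ez q - phi (meval v q))) &
    forall q, sys_rel z q -> meval v q = 0.
Proof.
move=> /spec_rational_pointP rx.
have /choice[v vP] := fun i => rx _ (R_ez 'X_i).
have xv q : (x : prime_of R) (ez q - phi (meval v q)).
  elim/mpoly_alg_ind: q => [a|i|q r Hq Hr|q r Hq Hr].
  - by rewrite mevalC -phiE subrr; exact: prime0.
  - by rewrite mevalXU.
  - by rewrite ezD mevalD rmorphD opprD addrACA; exact: primeD.
  - rewrite ezM mevalM rmorphM.
    have -> : ez q * ez r - phi (meval v q) * phi (meval v r) =
      ez r * (ez q - phi (meval v q)) + phi (meval v q) * (ez r - phi (meval v r)).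
      exact: subM_decomp.
    by apply: primeD; apply: primeM.
exists v => // q rq; apply/eqP; apply: contrapT => /negP vq.
have := xv q; rewrite /ez rq rmorph0 sub0r => h.
apply: (@prime1 _ _ (x : prime_of R)).
have -> : 1 = phi (- (meval v q)^-1) * - phi (meval v q).
  by rewrite rmorphN mulrNN -rmorphM mulVf ?rmorph1.
exact: primeM.
Qed.

Let jp : {rmorphism {poly k} -> K} := j \o @ps_poly k.

Let ez_root q H : (map_poly (@ps_poly k) H).[mmap (ps_C k) z q] = 0 ->
  (map_poly jp H).[ez q] = 0.
Proof. by move=> e; rewrite map_poly_comp horner_map e rmorph0. Qed.

Let ps_poly_ez (h : {poly k}) : exists q, ez q = j (ps_poly h).
Proof.
elim/poly_ind: h => [|h a [q Hq]]; first by exists 0; rewrite ez0 !rmorph0.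
exists (q * 'X_ord0 + a%:MP).
rewrite ezD ezM Hq -phiE rmorphD rmorphM /= [in RHS]rmorphD rmorphM.
by congr (_ * _ + _); rewrite /ez mmap_XU (sys_z0 c0 p0 z_sys).
Qed.

Let R_poly h : R (j (ps_poly h)).
Proof. by have [q <-] := ps_poly_ez h. Qed.
Let R_jp h : R (jp h). Proof. exact: R_poly. Qed.
Let R_ezX q m : R (ez q ^+ m). Proof. by rewrite -ezX. Qed.
#[local] Hint Resolve R_poly R_jp R_ezX R_ez Rphi : core.

(** Once powers of q are cancelled, the lowest nonzero coefficient of an equation of q over k[t] is
    a multiple of q. *)
Lemma prime_sub_poly (x : prime_of R) q : x (ez q) -> ez q != 0 ->
  exists2 h : {poly k}, h != 0 & x (j (ps_poly h)).
Proof.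
move=> xq q0.
have [H H0 HA] := sys_algebraic c0 p0 z_sys q.
have : exists i, H`_i != 0.
  by exists (size H).-1; rewrite -lead_coefE lead_coef_eq0.
move=> ex; case: (ex_minnP ex) => m Hm mmin.
exists H`_m => //.
set A := mmap (ps_C k) z q in HA.
have ms : (m < size H)%N.
  by rewrite ltnNge; apply: contraNN Hm => /(nth_default 0) ->.
have := ez_root HA; rewrite (horner_split _ _ ms) big1 ?add0r => [|i _]; last first.
  have [->|Hi] := eqVneq H`_i 0; first by rewrite rmorph0 mul0r.
  by have := mmin _ Hi; rewrite leqNgt ltn_ord.
move=> /eqP; rewrite mulf_eq0 expf_eq0 (negPf q0) andbF /= addr_eq0 => /eqP ->.
rewrite -mulrN mulrC; apply: primeM => //; apply: subringN.
elim/big_ind: _ => [||i _]; [exact: subring0|exact: subringD|].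
by apply: subringM => //; rewrite -ezX; exact: R_ez.
Qed.

(* Every element of the curve satisfies a polynomial relation over k[t], which
   can be made primitive with respect to the prime of k[t] below x. *)
Lemma curve_dim1 (x y : prime_of R) : x `<=` y -> (exists2 a, x a & a != 0) ->
  y `<=` x.
Proof.
move=> xy [a xa a0].
have [q [m aE]] : R a by exact: prime_sub xa.
have [h0 h00 xh0] : exists2 h : {poly k}, h != 0 & x (j (ps_poly h)).
  apply: (@prime_sub_poly x q); first by apply/(num_prime _ _ m); rewrite -aE.
  by apply: contraNneq a0 => e; rewrite aE e mul0r.
pose ix h := x (j (ps_poly h)).
(* [pi] generates the contraction of [x] to k[t]. *)
have [pi [pi0 xpi pimin]] : exists pi : {poly k}, [/\ pi != 0, ix pi &
    forall h, ix h -> pi %| h].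
  have : exists d, `[< exists h, [/\ h != 0, ix h & size h = d] >].
    by exists (size h0); apply/asboolP; exists h0.
  move=> ex; case: (ex_minnP ex) => d /asboolP[pi [pi0 xpi sd]] dmin.
  exists pi; split=> // h xh; apply: contrapT => /negP; rewrite /dvdp => r0.
  have xr : ix (h %% pi).
    have -> : h %% pi = h - h %/ pi * pi by rewrite {2}(divp_eq h pi) addrC addKr.
    rewrite /ix !rmorphB !rmorphM /=; apply: primeD => //.
    by rewrite -mulNr; apply: primeM => //; exact: subringN.
  have := dmin (size (h %% pi)); rewrite leqNgt -sd ltn_modp pi0.
  by move=> /(_ _)/negP; apply=> //; apply/asboolP; exists (h %% pi).
have dvd_ix h : pi %| h -> ix h.
  by move=> /dvdpP[u ->]; rewrite /ix !rmorphM; apply: primeM => //; exact: R_poly.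
have cst_y (h : {poly k}) : h != 0 -> (size h <= 1)%N -> ~ y (j (ps_poly h)).
  move=> hn0 /size1_polyC hE yh; apply: (@prime1 _ _ y).
  have h0n : h`_0 != 0 by apply: contraNneq hn0 => e; rewrite hE e.
  have -> : 1 = phi (h`_0)^-1 * j (ps_poly h).
    rewrite {2}hE -[ps_poly _]/(ps_C k h`_0) -[j _]/(phi _) -rmorphM mulVf //.
    by rewrite rmorph1.
  exact: primeM.
have spi : (1 < size pi)%N.
  by rewrite ltnNge; apply/negP => /(cst_y _ pi0); apply; exact: xy.
move=> b yb; have [r [l bE]] : R b by exact: prime_sub yb.
rewrite bE; apply/num_prime.
have {}yb : y (ez r) by apply/(num_prime _ _ l); rewrite -bE.
apply: contrapT => xr.
set B := mmap (ps_C k) z r.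
(* An equation not divisible by [pi]: factors [pi] are removed as long as they divide all
   coefficients. *)
have [H [i0 ndiv HB]] : exists H : {poly {poly k}}, exists2 i, ~~ (pi %| H`_i) &
    (map_poly (@ps_poly k) H).[B] = 0.
  have [H H0 HB] := sys_algebraic c0 p0 z_sys r.
  have [i Hi] : exists i, H`_i != 0.
    by exists (size H).-1; rewrite -lead_coefE lead_coef_eq0.
  have [N] := ubnP (size H`_i).
  elim: N => // N IHN in H H0 HB i Hi *; rewrite ltnS => sN.
  have [ndiv|/forallNP alldiv] := pselect (exists i, ~~ (pi %| H`_i)).
    by have [i' ni'] := ndiv; exists H, i'.
  pose H' := map_poly (fun u => u %/ pi) H.
  have HE u : H`_u = pi * H'`_u.
    by rewrite coef_map_id0 ?div0p // mulrC divpK //; apply/negPn/negP/alldiv.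
  have H'i : H'`_i != 0 by apply: contraNneq Hi => e; rewrite HE e mulr0.
  apply: (IHN H' _ _ i) => //.
  - by apply: contraNneq H'i => ->; rewrite coef0.
  - have HH : H = pi%:P * H' by apply/polyP => u; rewrite coefCM.
    move: HB; rewrite HH rmorphM /= map_polyC hornerM hornerC => /eqP.
    rewrite mulf_eq0 => /orP[|/eqP//]; rewrite -(rmorph0 (@ps_poly k)).
    by move=> /eqP/ps_poly_inj/eqP; rewrite (negPf pi0).
  - apply: leq_trans sN; rewrite HE size_mul // -ltnS prednK; last first.
      by rewrite addn_gt0 (ltnW spi).
    by rewrite -{1}[size H'`_i]add0n -addSn -addSn leq_add2r.
have ex : exists i, ~~ (pi %| H`_i) by exists i0.
case: (ex_minnP ex) => m0 Hm mmin.
have ms : (m0 < size H)%N.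
  by rewrite ltnNge; apply: contraNN Hm => /(nth_default 0) ->; rewrite dvdp0.
have xsum : x (ez r ^+ m0 * (jp H`_m0 + ez r *
    \sum_(i < size H - m0.+1) jp H`_(m0.+1 + i) * ez r ^+ i)).
  have := ez_root HB; rewrite (horner_split _ _ ms) => /eqP.
  rewrite addrC addr_eq0 => /eqP->; rewrite -mulN1r.
  apply: primeM; first by apply: subringN; exact: subring1.
  elim/big_ind: _ => [||i _]; [exact: prime0|exact: primeD|].
  rewrite mulrC; apply: primeM; first by rewrite -ezX; exact: R_ez.
  by apply: dvd_ix; apply/negPn/negP => /mmin; rewrite leqNgt ltn_ord.
have xr' m' : ~ x (ez r ^+ m').
  elim: m' => [|m' IH]; first by rewrite expr0; exact: prime1.
  by rewrite exprS; apply: prime_mul => //; rewrite -ezX; exact: R_ez.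
set tl := \sum_(i < _) _ in xsum.
have Rtl : R tl.
  rewrite /tl; elim/big_ind: _ => [||i _]; [exact: subring0|exact: subringD|].
  by apply: subringM => //; rewrite -ezX; exact: R_ez.
(* Modulo [x] all lower coefficients vanish; as r is not in [x], its power cancels and coefficient
   [m0] falls into [y]. Its gcd with [pi] is then in [y] too, so it is not constant; but as [x] is
   prime, this gcd is constant or divisible by [pi]. *)
have yH : y (j (ps_poly H`_m0)).
  have [|/xy yt] : x (ez r ^+ m0) \/ x (j (ps_poly H`_m0) + ez r * tl).
    apply: primeP xsum; first by rewrite -ezX; exact: R_ez.
    by apply: subringD => //; exact: subringM.
  - by move=> /xr'.
  rewrite -[j _](addrK (ez r * tl)); apply: primeD => //.
  by rewrite -mulrN mulrC; apply: primeM => //; exact: subringN.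
have d_pi : gcdp pi H`_m0 %| pi by exact: dvdp_gcdl.
have yd : y (j (ps_poly (gcdp pi H`_m0))).
  have [[u v] /= e] := Bezoutp pi H`_m0.
  have /eqpP[[al be] /= /andP[al0 be0] E] := e.
  have -> : gcdp pi H`_m0 = be^-1 *: (al *: (u * pi + v * H`_m0)).
    by rewrite E scalerA mulVf // scale1r.
  rewrite scalerA -mul_polyC rmorphM rmorphM; apply: primeM; first exact: R_poly.
  rewrite !rmorphD !rmorphM /=; apply: primeD; apply: primeM => //; exact: xy.
have /dvdpP[e pie] := d_pi.
have [] : ix e \/ ix (gcdp pi H`_m0).
  apply: primeP => //; rewrite -!rmorphM -pie; exact: xpi.
- move=> /pimin; rewrite {1}pie => div_e.
  have e0 : e != 0 by apply: contraNneq pi0 => e0; rewrite pie e0 mul0r.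
  have g0 : gcdp pi H`_m0 != 0.
    by apply: contraNneq pi0 => g0; rewrite pie g0 mulr0.
  apply: (cst_y _ g0) yd.
  have := dvdp_leq e0 div_e; rewrite size_mul // -subn1 leq_subLR addnC.
  by rewrite leq_add2r.
- move=> /pimin div_g; case/negP: Hm; apply: dvdp_trans div_g _.
  exact: dvdp_gcdr.
Qed.

Local Notation OT := (sec curve_kscheme (opensT curve_kscheme)).

Let ezs q : OT := spec_glob (R_ez q).
Let winv : OT := spec_glob (R_winv 1).
Let ezsD q r : ezs (q + r) = ezs q + ezs r.
Proof. apply: glob_val_inj; rewrite glob_valD; exact: ezD. Qed.
Let ezsM q r : ezs (q * r) = ezs q * ezs r.
Proof. apply: glob_val_inj; rewrite glob_valM; exact: ezM. Qed.
Let ezsB q r : ezs (q - r) = ezs q - ezs r.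
Proof. apply: glob_val_inj; rewrite glob_valB; exact: ezB. Qed.
Let ezs1 : ezs 1 = 1.
Proof. apply: glob_val_inj; exact: ez1. Qed.
Let ezsX q m : ezs (q ^+ m) = ezs q ^+ m.
Proof. by elim: m => [|m IHm]; rewrite ?expr0 ?ezs1 // !exprS ezsM IHm. Qed.
Let ezsC a : ezs a%:MP = kconst (opensT curve_kscheme) a.
Proof. by apply: glob_val_inj; rewrite glob_valK -phiE. Qed.
Let ezs_rel q : sys_rel z q -> ezs q = 0.
Proof. by move=> rq; apply: glob_val_inj; rewrite glob_valK /ez rq rmorph0. Qed.
Let winvM : winv * ezs w = 1.
Proof. by apply: glob_val_inj; rewrite glob_valM !glob_valK expr1 mulVf. Qed.
Let winvX m : glob_val (winv ^+ m) = ez w ^- m.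
Proof. by rewrite glob_valX glob_valK expr1 exprVn. Qed.

Let OT_frac (s : OT) : exists q m, s = ezs q * winv ^+ m.
Proof.
have [q [m e]] := glob_valR s; exists q, m; apply: glob_val_inj.
by rewrite glob_valM winvX glob_valK.
Qed.

Lemma mk_rmorphism (S T : pzRingType) (f : S -> T) :
  zmod_morphism f -> monoid_morphism f -> {h : {rmorphism S -> T} | h =1 f}.
Proof.
move=> fz fm.
pose h : {rmorphism S -> T} := HB.pack f (GRing.isZmodMorphism.Build S T f fz)
  (GRing.isMonoidMorphism.Build S T f fm).
by exists h.
Qed.

Lemma inv_powD (S : comPzRingType) (a b : S) m l : a * b = 1 ->
  a ^+ m = b ^+ l * a ^+ (m + l).
Proof. by move=> ab; rewrite exprD mulrCA -exprMn [b * a]mulrC ab expr1n mulr1. Qed.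

(** The coordinates are lifted arbitrarily and then corrected to a solution of the system. Relations
    vanish at it, because [w] times a relation is a combination of the equations and the image of
    [w] is a unit. *)
Lemma curve_lift (A : comNzRingType) (B : comPzRingType) (q : {rmorphism A -> B})
    (u : {rmorphism k -> A}) (g : {rmorphism OT -> B}) :
  (forall b : B, exists a : A, q a = b) ->
  (forall a b : A, q a = 0 -> q b = 0 -> a * b = 0) ->
  (forall a : k, g (kconst (opensT curve_kscheme) a) = q (u a)) ->
  exists h : {rmorphism OT -> A},
    (forall a : k, h (kconst (opensT curve_kscheme) a) = u a) /\
    (forall s, q (h s) = g s).
Proof.
move=> surj sq0 comp.
pose J a := q a = 0.
have HJ : is_ideal J.
  rewrite /J; split=> [|a b qa qb|a b qb]; first exact: rmorph0.
    by rewrite rmorphD qa qb addr0.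
  by rewrite rmorphM qb mulr0.
have /choice[G0 G0P] := fun i => surj (g (ezs 'X_i)).
have qG (G : 'I_n.+1 -> A) : (forall i, q (G i) = g (ezs 'X_i)) ->
    forall r, q (mmap u G r) = g (ezs r).
  move=> GP; elim/mpoly_alg_ind => [a|i|r s Hr Hs|r s Hr Hs].
  - by rewrite mmapC ezsC comp.
  - by rewrite mmap_XU GP.
  - by rewrite rmorphD /= rmorphD ezsD rmorphD Hr Hs.
  - by rewrite rmorphM /= rmorphM ezsM rmorphM Hr Hs.
have unitW (G : 'I_n.+1 -> A) : (forall i, q (G i) = g (ezs 'X_i)) ->
    exists v, v * mmap u G w = 1.
  move=> GP; have [v qv] := surj (g winv).
  have e : J (v * mmap u G w - 1).
    by rewrite /J rmorphB rmorphM qG // qv -rmorphM winvM !rmorph1 subrr.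
  (* A lift of the inverse of [w] is an inverse up to an error of square zero; this factor removes
     the error. *)
  exists (v * (2 - v * mmap u G w)).
  have := sq0 _ _ e e => /eqP; rewrite -subr_eq0 subr0 => /eqP E.
  have -> : v * (2 - v * mmap u G w) * mmap u G w =
    1 - (v * mmap u G w - 1) * (v * mmap u G w - 1) by ring.
  by rewrite E subr0.
have [G GJ Gsys] : exists2 G, forall i, J (G i - G0 i) &
    forall i, G i = u (c i) + G ord0 * mmap u G (p i).
  apply: w_lift HJ sq0 _ (unitW _ G0P) => i; rewrite /J qG // ezs_rel ?rmorph0 //.
  apply: (sys_root0 (sys_zP c0 p0 z_sys)); apply: ideal_gen_sub; by exists i.
have GP i : q (G i) = g (ezs 'X_i).
  by have := GJ i; rewrite /J rmorphB G0P => /eqP; rewrite subr_eq0 => /eqP.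
have [v vW] := unitW _ GP.
set W := mmap u G w in vW.
have Grel r : sys_rel z r -> mmap u G r = 0.
  move=> /w_rel/(sys_root0 Gsys); rewrite rmorphM /= -/W => e.
  by rewrite -[mmap u G r]mul1r -vW -mulrA e mulr0.
have wd r m s l : ezs r * winv ^+ m = ezs s * winv ^+ l ->
    mmap u G r * v ^+ m = mmap u G s * v ^+ l.
  move=> e; have : sys_rel z (r * w ^+ l - s * w ^+ m).
    apply: ez_rel; have := congr1 (@glob_val K R) e.
    rewrite !glob_valM !winvX !glob_valK ezB !ezM !ezX => E.
    by rewrite -[ez r](divfK (ezwm m)) E mulrAC divfK ?subrr.
  move=> /Grel; rewrite rmorphB !rmorphM !rmorphXn /= -/W => E.
  have vWm d : v ^+ d * W ^+ d = 1 by rewrite -exprMn vW expr1n.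
  have -> : mmap u G r * v ^+ m = mmap u G r * W ^+ l * v ^+ (m + l).
    by rewrite exprD mulrCA mulrC -!mulrA [W ^+ l * _]mulrC vWm mulr1 mulrC.
  have -> : mmap u G s * v ^+ l = mmap u G s * W ^+ m * v ^+ (m + l).
    by rewrite exprD -!mulrA [W ^+ m * _]mulrA [W ^+ m * _]mulrC vWm mul1r.
  by congr (_ * _); apply/eqP; rewrite -subr_eq0 E.
have /choice[h hP] : forall s : OT, exists a, forall r m, s = ezs r * winv ^+ m ->
    a = mmap u G r * v ^+ m.
  move=> s; have [r [m sE]] := OT_frac s; exists (mmap u G r * v ^+ m) => r' m' sE'.
  by apply: wd; rewrite -sE -sE'.
have winvD m l : winv ^+ m = ezs w ^+ l * winv ^+ (m + l).
  exact: inv_powD.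
have vD m l : v ^+ m = W ^+ l * v ^+ (m + l).
  exact: inv_powD.
have hz : zmod_morphism h.
  move=> s t; have [r [m sE]] := OT_frac s; have [r' [l tE]] := OT_frac t.
  rewrite (hP s r m sE) (hP t r' l tE) (hP _ (r * w ^+ l - r' * w ^+ m) (m + l)%N).
    rewrite rmorphB !rmorphM !rmorphXn /= -/W mulrBl -!mulrA -vD; congr (_ - _ * _).
    by rewrite addnC -vD.
  rewrite sE tE (winvD m l) (winvD l m) addnC [(l + m)%N]addnC.
  have -> : ezs (r * w ^+ l - r' * w ^+ m) =
      ezs r * ezs w ^+ l - ezs r' * ezs w ^+ m.
    by rewrite ezsB !ezsM !ezsX.
  by rewrite mulrBl !mulrA addnC.
have hm : monoid_morphism h.
  split=> [|s t].
    rewrite (hP 1 1 0%N) ?rmorph1 ?mul1r ?expr0 //.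
    by rewrite mulr1 ezs1.
  have [r [m sE]] := OT_frac s; have [r' [l tE]] := OT_frac t.
  rewrite (hP s r m sE) (hP t r' l tE) (hP _ (r * r') (m + l)%N).
    by rewrite rmorphM exprD mulrACA.
  by rewrite sE tE ezsM exprD mulrACA.
have [hh hE] := mk_rmorphism hz hm.
exists hh; split=> [a|s]; rewrite hE.
  by rewrite (hP _ a%:MP 0%N) ?mmapC ?expr0 ?mulr1.
have [r [m sE]] := OT_frac s; rewrite (hP s r m sE) sE !rmorphM !rmorphXn qG //.
congr (_ * _ ^+ m).
have qW : q W = g (ezs w) by exact: qG.
rewrite -[q v]mul1r -[1](rmorph1 g) -winvM rmorphM -mulrA -qW -rmorphM.
by rewrite [W * v]mulrC vW rmorph1 mulr1.
Qed.

Lemma curve_smooth : smooth_at (X := curve_kscheme) curve_point.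
Proof.
exists (opensT _); split=> //; first exact: spec_affine.
move=> A B q u g surj sq0 comp.
(* Over the zero ring every map is a morphism. *)
have [A10|A10] := eqVneq (1 : A) 0; last first.
  pose A' : comNzRingType := HB.pack (GRing.ComPzRing.sort A)
    (GRing.PzSemiRing_isNonZero.Build A A10).
  exact: (@curve_lift A' B q u g).
have A0 (a b : A) : a = b by rewrite -[a]mul1r -[b]mul1r A10 !mul0r.
have [h _] := @mk_rmorphism OT A (fun=> 0) (fun _ _ => A0 _ _)
  (conj (A0 _ _) (fun _ _ => A0 _ _)).
exists h; split=> [a|s]; first exact: A0.
have [a <-] := surj (g s); congr (q _); exact: A0.
Qed.

Lemma curve_irreducible : irreducible_curve curve_kscheme.
Proof.
split; [exact: curve_finite_type|exact: spec_irreducible|].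
apply: (@spec_krull_dim1 K R curve_point (ez 'X_ord0)).
- by exists 'X_ord0, 0%N; rewrite expr0 divr1 mevalXU.
- rewrite /ez mmap_XU (sys_z0 c0 p0 z_sys) -(rmorph0 j) (inj_eq j_inj).
  apply/eqP => /(congr1 (fun f : pser k => f 1%N))/eqP.
  by rewrite /ps_X /ps_poly coefX oner_eq0.
- exact: curve_dim1.
Qed.

(** A rational point is determined by its coordinates: ez q / ez w ^+ m lies in its prime exactly
    when q vanishes at them. *)
Lemma curve_points_infinite : large_field k ->
  infinite_set [set v : 'I_n.+1 -> k | forall q, sys_rel z q -> meval v q = 0].
Proof.
move=> lk fin; have := lk _ curve_irreducible.
case; first by exists curve_point; split; [exact: curve_point_rational|exact: curve_smooth].
have /choice[v vP] : forall x : curve_kscheme, exists v : 'I_n.+1 -> k,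
    rational_points curve_kscheme x ->
    (forall q, (x : prime_of R) (ez q - phi (meval v q))) /\
    forall q, sys_rel z q -> meval v q = 0.
  move=> x; have [rx|nrx] := pselect (rational_points curve_kscheme x).
    by have [v h1 h2] := curve_rational_coords rx; exists v.
  by exists (fun=> 0).
apply: card_le_finite fin; apply: embeds_card_le; exists v.
have mem (x : prime_of R) (rx : rational_points curve_kscheme x) q m :
    x (ez q / ez w ^+ m) <-> meval (v x) q = 0.
  rewrite num_prime; have [xv _] := vP _ rx; split=> [xq|e]; last first.
    by have := xv q; rewrite e rmorph0 subr0.
  apply/eqP; apply: contrapT => /negP vq.
  apply: (@prime1 _ _ x).
  have -> : 1 = phi (meval (v x) q)^-1 * (ez q - (ez q - phi (meval (v x) q))).
    by rewrite opprB addrC subrK -rmorphM mulVf ?rmorph1.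
  apply: primeM => //; rewrite -[- _]mulN1r; apply: primeD => //.
  by apply: primeM => //; apply: subringN; exact: subring1.
split=> [x /vP[]//|x y rx ry exy].
apply: prime_ext => a; split=> xa.
  have [q [m aE]] : R a by exact: prime_sub xa.
  by rewrite aE; apply/(mem y ry); rewrite -exy; apply/(mem x rx q m); rewrite -aE.
have [q [m aE]] : R a by exact: prime_sub xa.
by rewrite aE; apply/(mem x rx); rewrite exy; apply/(mem y ry q m); rewrite -aE.
Qed.

End SystemCurve.

(** * Points of systems over a large field *)

Section LargeSystem.
Variables (k : fieldType) (n : nat) (c : 'I_n.+1 -> k).
Variable p : 'I_n.+1 -> {mpoly k[n.+1]}.
Hypotheses (c0 : c ord0 = 0) (p0 : p ord0 = 1).
Variables (z : 'I_n.+1 -> pser k).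
Hypothesis z_sys : ps_system c p z.
Hypothesis lk : large_field k.

Definition sys_point (v : 'I_n.+1 -> k) : Prop :=
  forall q, sys_rel z q -> meval v q = 0.

Lemma large_system_infinite : infinite_set [set v | sys_point v].
Proof.
have [wa wac wrel] := sys_rel_annihilator c0 p0 z_sys.
have [wl wlc wlift] := sys_lift c0 p0.
apply: (@curve_points_infinite k n c p c0 p0 z z_sys {fraction (pser k)}
  (@tofrac (pser k)) _ (wa * wl)) => //.
- by move=> x y /eqP; rewrite tofrac_eq => /eqP.
- by rewrite mevalM wac wlc mulr1.
- move=> q /wrel h; rewrite mulrAC mulrC.
  by have [_ _] := is_ideal_gen (fun q => exists i, q = sys_eq c p i); apply.
- move=> S f J g HJ J2 Jg [u Hu]; apply: wlift HJ J2 Jg _.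
  by exists (u * mmap f g wa); rewrite -mulrA -rmorphM.
Qed.

Lemma sys_pointP v : sys_point v ->
  forall i, v i = c i + v ord0 * meval v (p i).
Proof.
move=> vP i; have : sys_rel z (sys_eq c p i).
  apply: (sys_root0 (sys_zP c0 p0 z_sys)); apply: ideal_gen_sub; by exists i.
move=> /vP; rewrite /sys_eq !mevalB mevalM !mevalXU mevalC => /eqP.
by rewrite -addrA -opprD subr_eq0 => /eqP.
Qed.

(** By the equations v_0 = 0 forces v = c, and c alone is a finite set. *)
Lemma large_system_point : exists2 v, sys_point v & v ord0 != 0.
Proof.
apply: contrapT => nv; apply: large_system_infinite.
apply: (sub_finite_set (B := [set c])); last exact: finite_set1.
move=> v vP; apply/funext => i; rewrite (sys_pointP vP).
have [->|v0] := eqVneq (v ord0) 0; first by rewrite mul0r addr0.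
by case: nv; exists v.
Qed.

End LargeSystem.

(** Uses the system whose only unknown is t. *)
Lemma large_field_infinite (k : fieldType) : large_field k -> infinite_set [set: k].
Proof.
move=> lk fin.
pose c := (fun=> 0) : 'I_1 -> k; pose p := (fun=> 1) : 'I_1 -> {mpoly k[1]}.
have [z zs] := ps_system_exists c p.
apply: (@large_system_infinite k 0 c p erefl erefl z zs lk).
apply: card_le_finite fin; apply: embeds_card_le; exists (fun v => v ord0).
by split=> // v v' _ _ e; apply/funext => i; rewrite !ord1.
Qed.

Section SystemDilation.
Variables (k : fieldType) (n : nat) (c : 'I_n.+1 -> k).
Variable p : 'I_n.+1 -> {mpoly k[n.+1]}.
Hypotheses (c0 : c ord0 = 0) (p0 : p ord0 = 1).
Variables (z : 'I_n.+1 -> pser k).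
Hypothesis z_sys : ps_system c p z.

(* The dilation t |-> d t turns the solution z(t) into the solution z(d t) of a
   system of the same kind; both are put in a single system. *)
Lemma large_system_ratio (d : k) : large_field k ->
  exists v v', [/\ sys_point z v, sys_point z v', v ord0 != 0 &
    v' ord0 = d * v ord0].
Proof.
move=> lk.
pose N := (n.+1 + n.+1)%N.
pose eL : {rmorphism {mpoly k[n.+1]} -> {mpoly k[N]}} :=
  mmap (mpolyC N (R := k)) (fun i => 'X_(lshift n.+1 i)).
pose eR : {rmorphism {mpoly k[n.+1]} -> {mpoly k[N]}} :=
  mmap (mpolyC N (R := k)) (fun i => 'X_(rshift n.+1 i)).
pose cc (i : 'I_N) := match fintype.split i with inl l => c l | inr r => c r end.
pose pp (i : 'I_N) : {mpoly k[N]} :=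
  match fintype.split i with inl l => eL (p l) | inr r => d%:MP * eR (p r) end.
pose zz (i : 'I_N) :=
  match fintype.split i with inl l => z l | inr r => ps_scale d (z r) end.
have sL (l : 'I_n.+1) : fintype.split (lshift n.+1 l : 'I_N) = inl l.
  by rewrite -[lshift _ _]/(unsplit (inl l)) unsplitK.
have sR (r : 'I_n.+1) : fintype.split (rshift n.+1 r : 'I_N) = inr r.
  by rewrite -[rshift _ _]/(unsplit (inr r)) unsplitK.
have e0 : (ord0 : 'I_N) = lshift n.+1 ord0 by exact: val_inj.
have ppL l : pp (lshift n.+1 l) = eL (p l) by rewrite /pp sL.
have zL q : mmap (ps_C k) zz (eL q) = mmap (ps_C k) z q.
  apply: (rmorph_mmap (g := mmap (ps_C k) zz)) => [a|i]; first exact: mmapC.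
  by apply: etrans (mmap_XU _ _ _) _; rewrite /zz sL.
have zR q : mmap (ps_C k) zz (eR q) = ps_scale d (mmap (ps_C k) z q).
  have -> : ps_scale d (mmap (ps_C k) z q) =
      mmap (ps_C k) (fun i => ps_scale d (z i)) q.
    by apply: (rmorph_mmap (g := ps_scale d)) => // a; exact: ps_scaleC.
  apply: (rmorph_mmap (g := mmap (ps_C k) zz)) => [a|i]; first exact: mmapC.
  by apply: etrans (mmap_XU _ _ _) _; rewrite /zz sR.
have sys : ps_system (n := N) cc pp zz.
  move=> i; rewrite /zz /cc /pp; case: (fintype.split i) => l; first by rewrite zL z_sys.
  rewrite rmorphM /= mmapC zR z_sys rmorphD rmorphM /= ps_scaleC ps_scaleX.
  by rewrite mulrCA mulrA.
have cc0 : cc ord0 = 0 by rewrite e0 /cc sL.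
have pp0 : pp ord0 = 1 by rewrite e0 ppL p0 rmorph1.
have [v vP v0] := @large_system_point k (n + n.+1) cc pp cc0 pp0 zz sys lk.
have {v vP v0} [v [vP v0]] : exists v : 'I_N -> k,
    (forall q, sys_rel (n := n + n.+1) zz q -> meval v q = 0) /\ v ord0 != 0.
  by exists v.
have vL q : meval v (eL q) = meval (fun i => v (lshift n.+1 i)) q.
  elim/mpoly_alg_ind: q => [a|i|q r Hq Hr|q r Hq Hr].
  - by rewrite /eL /= mmapC !mevalC.
  - by rewrite /eL /= mmap_XU !mevalXU.
  - by rewrite rmorphD !mevalD Hq Hr.
  - by rewrite rmorphM !mevalM Hq Hr.
have vR q : meval v (eR q) = meval (fun i => v (rshift n.+1 i)) q.
  elim/mpoly_alg_ind: q => [a|i|q r Hq Hr|q r Hq Hr].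
  - by rewrite /eR /= mmapC !mevalC.
  - by rewrite /eR /= mmap_XU !mevalXU.
  - by rewrite rmorphD !mevalD Hq Hr.
  - by rewrite rmorphM !mevalM Hq Hr.
exists (fun i => v (lshift n.+1 i)), (fun i => v (rshift n.+1 i)); split.
- by move=> q rq; rewrite -vL; apply: vP; rewrite /sys_rel zL.
- by move=> q rq; rewrite -vR; apply: vP; rewrite /sys_rel zR rq rmorph0.
- by rewrite -e0.
(* The right copy of t is z_0(d t) = d t, which is a relation between the two copies. *)
have /vP : sys_rel zz ('X_(rshift n.+1 ord0) - d%:MP * 'X_(lshift n.+1 ord0)).
  rewrite /sys_rel rmorphB rmorphM /= mmapC !mmap_XU /zz sL sR.
  by rewrite (sys_z0 c0 p0 z_sys) ps_scaleX subrr.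
by rewrite mevalB mevalM mevalC !mevalXU => /eqP; rewrite subr_eq0 => /eqP.
Qed.

End SystemDilation.

(** * Fibres without rational points *)

Section FiniteAlgebra.
Variables (k : fieldType) (B : comNzRingType) (kappa : {rmorphism k -> B}).
Variables (n : nat) (b : 'I_n -> B) (I : B -> Prop).
Hypothesis HI : is_ideal I.
Hypothesis spanI : forall x, exists a : 'I_n -> k, I (x - \sum_i kappa (a i) * b i).
Hypothesis kinf : infinite_set [set: k].
Hypothesis hperf : perfect_field k.

Let I0 : I 0. Proof. by have [] := HI. Qed.
Let ID x y : I x -> I y -> I (x + y). Proof. by have [_ + _] := HI; apply. Qed.
Let IM a x : I x -> I (a * x). Proof. by have [_ _] := HI; apply. Qed.
Let Isum (F : finType) (f : F -> B) : (forall i, I (f i)) -> I (\sum_i f i).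
Proof. exact: ideal_sum. Qed.

(** Linear dependence in B / I, which n elements span over k. Computing modulo [I] avoids the
    quotient ring. *)
Let relation (e : 'I_n.+1 -> B) :
  exists2 a : 'I_n.+1 -> k, (exists i, a i != 0) & I (\sum_i kappa (a i) * e i).
Proof.
have /choice[a aP] := fun i => spanI (e i).
pose M : 'M[k]_(n.+1, n) := \matrix_(i, j) a i j.
have kM : kermx M != 0.
  rewrite kermx_eq0 -row_leq_rank -ltnNge ltnS; exact: rank_leq_col.
have [i ri] : exists i, row i (kermx M) != 0.
  apply/existsP; rewrite -negb_forall; apply: contra kM => /forallP h.
  by apply/eqP/row_matrixP => i; rewrite (eqP (h i)) row0.
set u := row i (kermx M) in ri.
have uM : u *m M = 0 by apply/sub_kermxP; exact: row_sub.
exists (fun l => u 0 l).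
  by case/rV0Pn: ri => l ul; exists l.
have -> : \sum_l kappa (u 0 l) * e l =
    \sum_l kappa (u 0 l) * (e l - \sum_j kappa (a l j) * b j).
  apply/eqP; rewrite -subr_eq0 -sumrB.
  under eq_bigr do rewrite -mulrBr opprB addrC subrK mulr_sumr.
  rewrite exchange_big /= big1 // => j _.
  under eq_bigr do rewrite mulrA -rmorphM.
  rewrite -mulr_suml -rmorph_sum.
  have -> : \sum_l u 0 l * a l j = (u *m M) 0 j.
    by rewrite [RHS]mxE; apply: eq_bigr => l _; rewrite [M _ _]mxE.
  by rewrite uM mxE rmorph0 mul0r.
by apply: Isum => l; exact: IM.
Qed.

Let evB (f : {poly k}) (x : B) : B := (map_poly kappa f).[x].

Let evBD f g x : evB (f + g) x = evB f x + evB g x.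
Proof. by rewrite /evB rmorphD hornerD. Qed.
Let evBM f g x : evB (f * g) x = evB f x * evB g x.
Proof. by rewrite /evB rmorphM hornerM. Qed.
Let evBC a x : evB a%:P x = kappa a.
Proof. by rewrite /evB map_polyC hornerC. Qed.
Let evBX x : evB 'X x = x.
Proof. by rewrite /evB map_polyX hornerX. Qed.

Let annihilated (x : B) : exists2 f : {poly k}, f != 0 & I (evB f x).
Proof.
have [a [i ai] Ia] := relation (fun i => x ^+ i).
exists (\poly_(l < n.+1) a (inord l)).
  apply: contraNneq ai => /(congr1 (fun f : {poly k} => f`_i)).
  by rewrite coef_poly ltn_ord coef0 inord_val => ->.
rewrite /evB (@horner_coef_wide _ n.+1) ?(leq_trans (size_poly _ _)) ?size_poly //.
congr (I _): Ia; apply: eq_bigr => l _.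
by rewrite coef_map coef_poly ltn_ord /= inord_val.
Qed.

Let isPrime (P : set B) := [/\ (forall x, I x -> P x), is_ideal P, ~ P 1 &
  forall x y, P (x * y) -> P x \/ P y].

Let prime_kappa (P : set B) a : isPrime P -> P (kappa a) -> a = 0.
Proof.
move=> [_ [_ _ PM] P1 _] Pa; apply/eqP; apply: contrapT => /negP a0; apply: P1.
by rewrite -(rmorph1 kappa) -(mulVf a0) rmorphM; exact: PM.
Qed.

(* Primes containing I are maximal, since B / I is algebraic over k. *)
Let prime_incomparable (P Q : set B) : isPrime P -> isPrime Q -> P `<=` Q -> Q `<=` P.
Proof.
move=> PP QP PQ x Qx.
have [PI [_ PD PM] P1 Pp] := PP; have [_ [Q0 QD QM] Q1 _] := QP.
have [f f0 /PI Pf] := annihilated x.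
have [N] := ubnP (size f); elim: N => // N IHN in f f0 Pf *; rewrite ltnS => sN.
pose g := \poly_(i < (size f).-1) f`_i.+1.
have fE : f = g * 'X + (f`_0)%:P.
  apply/polyP => i; rewrite coefD coefMX coefC coef_poly.
  case: i => [|i] /=; rewrite ?add0r ?addr0 //; case: ltnP => // si.
  by rewrite nth_default // (leq_trans (leqSpred _)).
move: Pf; rewrite fE evBD evBM evBX evBC.
have [c0|c0] := eqVneq f`_0 0.
  rewrite c0 rmorph0 addr0 => /Pp[|//].
  have g0 : g != 0.
    by apply: contraNneq f0 => e; rewrite fE e mul0r add0r c0.
  move=> Pg; apply: (IHN g) => //; rewrite (leq_ltn_trans (size_poly _ _)) //.
  by rewrite (leq_trans _ sN) // prednK ?size_poly_gt0.
move=> /PQ h; case: (negP c0); apply/eqP; apply: (prime_kappa QP).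
rewrite -[kappa _](addKr (evB g x * x)); apply: (QD) => //.
by rewrite -mulNr; exact: QM.
Qed.

Let prime_above (x : B) : ~ (exists y, I (1 - y * x)) -> exists2 P, isPrime P & P x.
Proof.
move=> nx.
have [//|//|//|//| | | |//| | |P [JP _ PM [P0 PD PMul] PP]] := @prime_avoiding B setT
    [set u | exists y, I (u - y * x)] [set 1].
- by exists 0; rewrite mul0r subr0.
- move=> u v [y Iy] [y' Iy']; exists (y + y').
  by rewrite mulrDl opprD addrACA; exact: ID.
- move=> a u _ [y Iy]; exists (a * y).
  by rewrite -mulrA -mulrBr; exact: IM.
- by move=> u v -> ->; rewrite mulr1.
- by move=> u [y Iy] u1; apply: nx; exists y; rewrite -u1.
exists P; last by apply: JP; exists 1; rewrite mul1r subrr.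
split.
- by move=> u Iu; apply: JP; exists 0; rewrite mul0r subr0.
- by split=> // a u; exact: PMul.
- by move=> /PM; apply.
- by move=> u v; exact: PP.
Qed.

(* Elements of all the primes but one are independent modulo I. *)
Let few_primes (P : 'I_n.+1 -> set B) : (forall i, isPrime (P i)) ->
  exists i j, i != j /\ P i = P j.
Proof.
move=> Pp; apply: contrapT => nPP.
have /choice[e eP] : forall i, exists x : B,
    ~ P i x /\ forall j, j != i -> P j x.
  move=> i.
  have [_ [P0 PD PM] P1 Pr] := Pp i.
  have /choice[y yP] : forall j, exists y, ~ P i y /\ (j != i -> P j y).
    move=> j; have [->|ji] := eqVneq j i; first by exists 1.
    have : ~ P j `<=` P i.
      move=> ji_sub; apply: nPP; exists j, i; split=> //.
      by apply/seteqP; split=> //; exact: prime_incomparable.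
    by move=> /existsNP[y /not_implyP[Pjy Piy]]; exists y.
  exists (\prod_j y j); split.
    elim/big_ind: _ => // [u v nu nv /Pr[]//|j _]; by have [] := yP j.
  move=> j ji; have [_ [_ _ PjM] _ _] := Pp j.
  by rewrite (bigD1 j) //= mulrC; apply: PjM; have [_] := yP j; apply.
have [a [i ai] Ia] := relation e.
have [PI [P0 PD PM] P1 Pr] := Pp i.
have [nei ei] := eP i.
have : P i (kappa (a i) * e i).
  have := PI _ Ia; rewrite (bigD1 i) //= => h.
  rewrite -[_ * _](addrK (\sum_(j < n.+1 | j != i) kappa (a j) * e j)).
  apply: (PD) => //; apply: ideal_opp => //.
  elim/big_ind: _ => // j ji; apply: (PM); have [_] := eP j; apply.
  by rewrite eq_sym.
by move=> /Pr[/(prime_kappa (Pp i))/eqP|//]; rewrite (negPf ai).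
Qed.

(** Otherwise each combination of the b_i with coefficients a^i is a constant modulo some prime. Few
    primes and many a single out one prime with residue field k, that is, a forbidden [psi]. *)
Lemma finite_algebra_element :
  (forall psi : {rmorphism B -> k}, (forall c, psi (kappa c) = c) ->
    ~ (forall x, I x -> psi x = 0)) ->
  exists x : B, forall c : k, exists y, I (1 - y * (x - kappa c)).
Proof.
move=> nopsi; apply: contrapT => bad.
pose bb (a : k) := \sum_(i < n) kappa (a ^+ i) * b i.
have /choice[P PP] : forall a, exists Q, isPrime Q /\ exists c, Q (bb a - kappa c).
  move=> a; have /existsNP[c nc] : ~ forall c, exists y, I (1 - y * (bb a - kappa c)).
    by move=> h; apply: bad; exists (bb a).
  by have [Q Qp Qx] := prime_above nc; exists Q; split=> //; exists c.
have finP : finite_set (range P).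
  apply: contrapT => /infinite_embeds_nat[f [fr fI]].
  have /choice[g gP] : forall i, exists a, P a = f i.
    by move=> i; have [a _ <-] := fr i Logic.I; exists a.
  have [i [j [ij e]]] := few_primes (fun i : 'I_n.+1 => (PP (g i)).1).
  by move: ij; rewrite -val_eqE /= (fI i j Logic.I Logic.I) ?eqxx // -!gP.
(* Pigeonhole: infinitely many a, finitely many primes. *)
have [Q Qinf] : exists Q, infinite_set [set a | P a = Q].
  apply: contrapT => /forallNP h; apply: kinf.
  have -> : [set: k] = \bigcup_(Q in range P) [set a | P a = Q].
    by apply/seteqP; split=> // a _; exists (P a) => //; exists a.
  by apply: bigcup_finite => // Q _; apply: contrapT; exact: h.
have [f [fQ fI]] := infinite_embeds_nat Qinf.
have Qp : isPrime Q by rewrite -(fQ 0%N Logic.I); have [] := PP (f 0%N).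
have [QI [Q0 QD QM] Q1 Qr] := Qp.
have /choice[c cP] : forall i, exists c, Q (bb (f i) - kappa c).
  by move=> i; have [_ [c]] := PP (f i); rewrite (fQ i Logic.I); exists c.
have QN x : Q x -> Q (- x) by apply: ideal_opp.
(* Inverting the Vandermonde matrix of n of these a shows that every b_l is a constant modulo
   [Q]. *)
pose V : 'M[k]_n := Vandermonde n (\row_i f i).
have uV : V \in unitmx.
  rewrite unitmxE unitfE det_Vandermonde; apply/prodf_neq0 => i _.
  apply/prodf_neq0 => j ij; rewrite !mxE subr_eq0.
  by apply/eqP => /(fI j i Logic.I Logic.I) e; rewrite e ltnn in ij.
have Qb l : exists a, Q (b l - kappa a).
  exists (\sum_(i < n) c i * invmx V i l).
  have -> : b l - kappa (\sum_(i < n) c i * invmx V i l) =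
      \sum_(i < n) kappa (invmx V i l) * (bb (f i) - kappa (c i)).
    under [RHS]eq_bigr do rewrite mulrBr.
    rewrite sumrB rmorph_sum; congr (_ - _); last first.
      by apply: eq_bigr => i _; rewrite rmorphM mulrC.
    rewrite /bb; under eq_bigr do rewrite mulr_sumr.
    rewrite exchange_big /= (bigD1 l) //= [X in _ + X]big1 ?addr0.
      under eq_bigr do rewrite mulrA -rmorphM.
      rewrite -mulr_suml -rmorph_sum.
      have /matrixP/(_ l l) := mulmxV uV; rewrite !mxE eqxx => E.
      rewrite (eq_bigr (fun i => V l i * invmx V i l)) ?E ?rmorph1 ?mul1r // => i _.
      by rewrite !mxE mulrC.
    move=> l' ll'; under eq_bigr do rewrite mulrA -rmorphM.
    rewrite -mulr_suml -rmorph_sum.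
    have /matrixP/(_ l' l) := mulmxV uV; rewrite !mxE (negPf ll') => E.
    rewrite (eq_bigr (fun i => V l' i * invmx V i l)) ?E ?rmorph0 ?mul0r // => i _.
    by rewrite !mxE mulrC.
  by elim/big_ind: _ => // i _; apply: (QM).
have /choice[psi psiP] : forall x, exists a, Q (x - kappa a).
  move=> x; have [a /QI Ix] := spanI x; have /choice[d dP] := Qb.
  exists (\sum_i a i * d i).
  rewrite -[x](subrK (\sum_i kappa (a i) * b i)) -addrA; apply: (QD) => //.
  rewrite rmorph_sum -sumrB; elim/big_ind: _ => // i _.
  by rewrite rmorphM -mulrBr; exact: QM.
have uniq_psi x a : Q (x - kappa a) -> psi x = a.
  move=> h; apply/eqP; rewrite -subr_eq0; apply/eqP; apply: (prime_kappa Qp).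
  rewrite rmorphB; have := QD _ _ h (QN _ (psiP x)).
  by rewrite opprB addrC addrA subrK.
have pz : zmod_morphism psi.
  move=> x y; apply: uniq_psi; rewrite rmorphB opprB addrACA.
  have -> : x + kappa (psi y) + (- y - kappa (psi x)) =
    (x - kappa (psi x)) + - (y - kappa (psi y)) by ring.
  by apply: (QD) => //; exact: QN.
have pm : monoid_morphism psi.
  split=> [|x y]; apply: uniq_psi; first by rewrite rmorph1 subrr.
  rewrite rmorphM subM_decomp; apply: (QD); exact: QM.
have [h hE] := mk_rmorphism pz pm.
apply: (nopsi h) => [c'|x Ix]; rewrite hE; apply: uniq_psi.
  by rewrite subrr.
by rewrite rmorph0 subr0; exact: QI.
Qed.

(** [h] has least degree among the nonzero polynomials with h(x) nilpotent modulo [I]. A square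
    factor could be replaced by its root, and a linear factor X - c dropped because x - c is a unit;
    perfectness turns square-free into separable. *)
Lemma finite_algebra_separable :
  (forall psi : {rmorphism B -> k}, (forall c, psi (kappa c) = c) ->
    ~ (forall x, I x -> psi x = 0)) ->
  exists (x : B) (h : {poly k}) (N : nat), [/\ separable_poly h,
    (forall c, ~~ root h c) & I ((map_poly kappa h).[x] ^+ N)].
Proof.
move=> /finite_algebra_element[x xunit].
have [d0 hd0] : exists d, `[< exists (h : {poly k}) N,
    [/\ h != 0, size h = d & I (evB h x ^+ N)] >].
  have [f f0 If] := annihilated x.
  by exists (size f); apply/asboolP; exists f, 1%N; rewrite expr1.
have ex : exists d, `[< exists (h : {poly k}) N,
    [/\ h != 0, size h = d & I (evB h x ^+ N)] >] by exists d0.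
case: (ex_minnP ex) => d /asboolP[h [N [h0 sh Ih]]] dmin {d0 hd0 ex}.
have hmin (g : {poly k}) M : g != 0 -> I (evB g x ^+ M) -> (size h <= size g)%N.
  by move=> g0 Ig; rewrite sh; apply: dmin; apply/asboolP; exists g, M.
have sqfree (g u : {poly k}) : h = g * g * u -> (size g <= 1)%N.
  move=> hE; rewrite leqNgt; apply/negP => sg.
  have g0 : g != 0 by apply: contraNneq h0 => e; rewrite hE e !mul0r.
  have u0 : u != 0 by apply: contraNneq h0 => e; rewrite hE e mulr0.
  have gu0 : g * u != 0 by rewrite mulf_neq0.
  have : I (evB (g * u) x ^+ (N + N)).
    have -> : evB (g * u) x ^+ (N + N) = evB u x ^+ N * evB h x ^+ N.
      by rewrite -exprMn -evBM hE exprD -exprMn -evBM; congr (evB _ x ^+ _); ring.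
    exact: IM.
  move=> /(hmin _ _ gu0); rewrite hE -mulrA [in X in (X <= _)%N]size_mul //.
  rewrite leqNgt => /negP; apply.
  by case: (size g) sg => [|[|m]] // _; rewrite addSn /= addSn ltnS leq_addl.
exists x, h, N; split=> //; last first.
  move=> c; apply/negP => /factor_theorem[g hE].
  have g0 : g != 0 by apply: contraNneq h0 => e; rewrite hE e mul0r.
  have [y Iy] := xunit c.
  have Ig : I (evB g x ^+ N).
    set v := x - kappa c in Iy.
    have vE : evB ('X - c%:P) x = v.
      by rewrite /evB rmorphB /= map_polyX map_polyC hornerD hornerN hornerX hornerC.
    have : I (evB g x ^+ N * v ^+ N) by rewrite -exprMn -vE -evBM -hE.
    have Iy1 m : I (1 - (y * v) ^+ m).
      elim: m => [|m IHm]; first by rewrite expr0 subrr.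
      have -> : 1 - (y * v) ^+ m.+1 = 1 - (y * v) ^+ m + (y * v) ^+ m * (1 - y * v).
        by rewrite exprSr; ring.
      by apply: ID => //; exact: IM.
    move=> Igv; have -> : evB g x ^+ N = evB g x ^+ N * (1 - (y * v) ^+ N) +
        y ^+ N * (evB g x ^+ N * v ^+ N) by rewrite exprMn; ring.
    by apply: ID; exact: IM.
  have := hmin _ _ g0 Ig; rewrite {1}hE size_mul ?polyXsubC_eq0 // size_XsubC addn2.
  by rewrite ltnn.
apply/separable_polyP; split=> [u v uvh|u uh su].
  have [w hE] := dvdpP _ _ uvh.
  rewrite coprimep_def eqn_leq; apply/andP; split.
    have /dvdpP[u' uE] := dvdp_gcdl u v; have /dvdpP[v' vE] := dvdp_gcdr u v.
    move: (gcdp u v) uE vE => g uE vE.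
    by apply: (sqfree _ (u' * v' * w)); rewrite hE uE vE; ring.
  rewrite size_poly_gt0 gcdp_eq0; apply: contraNN h0 => /andP[/eqP u0 _].
  by rewrite hE u0 mul0r mulr0.
(* An irreducible factor [pi] of [u] is coprime to its derivative, so u' = 0 forces [pi] to divide
   [u] twice. *)
apply/negP => /eqP u'0.
have [pi [pi_u spi pimin]] : exists pi : {poly k}, [/\ pi %| u, (1 < size pi)%N &
    forall q : {poly k}, q %| u -> (1 < size q)%N -> (size pi <= size q)%N].
  have ex : exists d, `[< exists q : {poly k}, [/\ q %| u, (1 < size q)%N & size q = d] >].
    by exists (size u); apply/asboolP; exists u.
  case: (ex_minnP ex) => e /asboolP[pi [pi_u spi se]] emin; exists pi; split=> // q qu sq.
  by rewrite se; apply: emin; apply/asboolP; exists q.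
have irr : irreducible_poly pi.
  split=> // q sq qpi.
  have u0 : u != 0 by apply: contraTneq su => ->; rewrite size_poly0.
  have pi0 : pi != 0 by apply: contraTneq spi => ->; rewrite size_poly0.
  have q0 : q != 0 by apply: contraNneq pi0 => q0; move: qpi; rewrite q0 dvd0p.
  rewrite -dvdp_size_eqp //; apply/eqP/anti_leq; rewrite dvdp_leq //=.
  apply: pimin; first exact: dvdp_trans pi_u.
  by rewrite ltn_neqAle eq_sym sq size_poly_gt0.
have := hperf irr; rewrite unlock => cop.
have /dvdpP[e uE] := pi_u.
have : pi %| e.
  rewrite -(Gauss_dvdpl e cop).
  have := u'0; rewrite uE derivM => /eqP; rewrite addrC addr_eq0 => /eqP ->.
  by rewrite -mulNr dvdp_mulIr.
move=> /dvdpP[e' eE].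
have /dvdpP[w hE] := uh.
have := sqfree pi (w * e'); rewrite hE uE eE leqNgt spi.
by move=> /(_ _)/negP; apply=> //; ring.
Qed.

End FiniteAlgebra.

Lemma det_fixed_vector (S : comPzRingType) n (M : 'M[S]_n) (v : 'cV[S]_n) (a : S) :
  M *m v = a *: v -> \det (a%:M - M) *: v = 0.
Proof.
move=> Mv; rewrite -mul_scalar_mx -mul_adj_mx -mulmxA mulmxBl mul_scalar_mx Mv.
by rewrite subrr mulmx0.
Qed.

(** With [I] the extension to B of the kernel of [ev], the fibre is B / I. If I = B, the fibre is
    empty and Nakayama gives [s]. If not, h(b)^N lies in [I] and acts on the generators by a matrix
    [M] vanishing at the point; the square of [M], for h(b)^(2N), will supply the factor t^2. *)
Lemma fibre_certificate_nz (k : fieldType) (A : comPzRingType) (B : comNzRingType)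
    (r : {rmorphism A -> B}) (ev : {rmorphism A -> k}) (iota : {rmorphism k -> A}) :
  infinite_set [set: k] -> perfect_field k -> (forall c, ev (iota c) = c) ->
  module_finite r ->
  (forall psi : {rmorphism B -> k}, ~ forall a, psi (r a) = ev a) ->
  (exists s, ev s = 1 /\ r s = 0) \/
  exists (n : nat) (M : 'M[A]_n) (b : B) (h : {poly k}) (N : nat),
    [/\ separable_poly h, h \is monic, (1 < size h)%N /\ (0 < N)%N,
      forall c, ~~ root h c & (forall i j, ev (M i j) = 0) /\
      forall psi : {rmorphism B -> k}, (forall c, psi (r (iota c)) = c) ->
        \det ((h.[psi b] ^+ (N + N))%:M - map_mx (psi \o r) (M *m M)) = 0].
Proof.
move=> kinf hperf evi [n [b bspan]] nopsi.
pose I x := exists m : 'I_n -> A, (forall i, ev (m i) = 0) /\ x = \sum_i r (m i) * b i.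
have HI : is_ideal I.
  split=> [|x y [m [m0 ->]] [m' [m'0 ->]]|a x [m [m0 ->]]].
  - exists (fun=> 0); split=> [i|]; first exact: rmorph0.
    by rewrite big1 // => i _; rewrite rmorph0 mul0r.
  - exists (fun i => m i + m' i); split=> [i|]; first by rewrite rmorphD m0 m'0 addr0.
    by rewrite -big_split; apply: eq_bigr => i _; rewrite rmorphD mulrDl.
  - have /choice[l lP] := fun i => bspan (a * b i).
    exists (fun j => \sum_i m i * l i j); split=> [j|].
      by rewrite rmorph_sum big1 // => i _; rewrite rmorphM m0 mul0r.
    rewrite mulr_sumr; under eq_bigr do rewrite mulrCA lP mulr_sumr.
    rewrite exchange_big; apply: eq_bigr => j _ /=.
    by rewrite rmorph_sum mulr_suml; apply: eq_bigr => i _; rewrite rmorphM mulrA.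
pose kappa : {rmorphism k -> B} := r \o iota.
have spanI x : exists a : 'I_n -> k, I (x - \sum_i kappa (a i) * b i).
  have [a ->] := bspan x; exists (fun i => ev (a i)), (fun i => a i - iota (ev (a i))).
  split=> [i|]; first by rewrite rmorphB evi subrr.
  by rewrite -sumrB; apply: eq_bigr => i _; rewrite rmorphB mulrBl.
have Imx u : I u -> exists M : 'M[A]_n, (forall i j, ev (M i j) = 0) /\
    map_mx r M *m (\col_i b i) = u *: (\col_i b i).
  move=> Iu; have /choice[m mP] : forall i, exists m : 'I_n -> A,
      (forall j, ev (m j) = 0) /\ u * b i = \sum_j r (m j) * b j.
    by move=> i; have [_ _ /(_ (b i) u Iu)] := HI; rewrite mulrC.
  exists (\matrix_(i, j) m i j); split=> [i j|]; first by rewrite mxE; have [] := mP i.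
  apply/matrixP => i j; rewrite !mxE; have [_ ->] := mP i.
  by apply: eq_bigr => l _; rewrite !mxE.
(* The generators span 1. *)
have kill d : d *: (\col_i b i) = 0 -> d = 0.
  move=> db; have [a a1] := bspan 1; rewrite -[d]mulr1 a1 mulr_sumr big1 // => i _.
  have /matrixP/(_ i 0) := db; rewrite !mxE => e; by rewrite mulrCA e mulr0.
have [I1|I1] := pselect (I 1).
  left; have [M [M0 Mb]] := Imx 1 I1.
  exists (\det (1%:M - M)); split.
    rewrite -det_map_mx map_mxB map_mx1.
    suff -> : map_mx ev M = 0 by rewrite subr0 det1.
    by apply/matrixP => i j; rewrite !mxE.
  apply: kill; rewrite -det_map_mx map_mxB map_mx1; exact: det_fixed_vector.
right.
have [|x [h [N [hsep hroot Ih]]]] := finite_algebra_separable HI spanI kinf hperf.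
  move=> psi psik psi0; apply: (nopsi psi) => a.
  have [c1 c1E] := bspan 1.
  have : I (r (a - iota (ev a))).
    exists (fun i => (a - iota (ev a)) * c1 i); split=> [i|].
      by rewrite rmorphM rmorphB evi subrr mul0r.
    rewrite -[LHS]mulr1 c1E mulr_sumr; apply: eq_bigr => i _.
    by rewrite rmorphM mulrA.
  move=> /psi0 /eqP; rewrite !rmorphB subr_eq0 => /eqP ->.
  exact: psik.
have h0 := separable_poly_neq0 hsep.
pose u := (map_poly kappa h).[x] ^+ N.
have lh0 : lead_coef h != 0 by rewrite lead_coef_eq0.
have sh : (1 < size h)%N.
  rewrite ltnNge; apply/negP => /size1_polyC hE; apply: I1.
  have [c c0 {}hE] : exists2 c, c != 0 & h = c%:P.
    by exists h`_0 => //; apply: contraNneq h0 => e; rewrite hE e.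
  have [_ _ IM] := HI; have := IM (kappa (c ^- N)) _ Ih.
  by rewrite hE map_polyC hornerC -rmorphXn -rmorphM mulVf ?expf_neq0 // rmorph1.
have N0 : (0 < N)%N.
  by rewrite lt0n; apply/eqP => N0; apply: I1; move: Ih; rewrite N0 expr0.
pose h1 := (lead_coef h)^-1 *: h.
have h1E : h1 %= h by rewrite eqp_scale ?invr_eq0.
have Ih1 : I ((map_poly kappa h1).[x] ^+ N).
  have [_ _ IM] := HI.
  rewrite /h1 -mul_polyC rmorphM /= map_polyC hornerM hornerC exprMn; exact: IM.
have [M [M0 Mb]] := Imx _ Ih1.
exists n, M, x, h1, N; split.
- by rewrite (eqp_separable h1E).
- by rewrite monicE lead_coefZ mulVf.
- by rewrite size_scale ?invr_eq0.
- by move=> c; rewrite (eqp_root h1E).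
split=> // psi psik.
have e2 : map_mx r (M *m M) *m (\col_i b i) =
    ((map_poly kappa h1).[x] ^+ (N + N)) *: (\col_i b i).
  by rewrite map_mxM -mulmxA Mb -scalemxAr Mb scalerA exprD.
have := kill _ (det_fixed_vector e2) => /(congr1 psi).
rewrite rmorph0 -det_map_mx map_mxB map_scalar_mx /= -map_mx_comp rmorphXn.
rewrite -horner_map -map_poly_comp.
rewrite (_ : map_poly (psi \o (r \o iota)) h1 = h1) //.
by apply/polyP => i; rewrite coef_map; exact: psik.
Qed.

Lemma fibre_certificate (k : fieldType) (A B : comPzRingType)
    (r : {rmorphism A -> B}) (ev : {rmorphism A -> k}) (iota : {rmorphism k -> A}) :
  infinite_set [set: k] -> perfect_field k -> (forall c, ev (iota c) = c) ->
  module_finite r ->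
  (forall psi : {rmorphism B -> k}, ~ forall a, psi (r a) = ev a) ->
  (exists s, ev s = 1 /\ r s = 0) \/
  exists (n : nat) (M : 'M[A]_n) (b : B) (h : {poly k}) (N : nat),
    [/\ separable_poly h, h \is monic, (1 < size h)%N /\ (0 < N)%N,
      forall c, ~~ root h c & (forall i j, ev (M i j) = 0) /\
      forall psi : {rmorphism B -> k}, (forall c, psi (r (iota c)) = c) ->
        \det ((h.[psi b] ^+ (N + N))%:M - map_mx (psi \o r) (M *m M)) = 0].
Proof.
have [B10|B10] := eqVneq (1 : B) 0.
  move=> _ _ _ _ _; left; exists 1; split; first exact: rmorph1.
  by rewrite rmorph1.
pose B' : comNzRingType := HB.pack (GRing.ComPzRing.sort B)
  (GRing.PzSemiRing_isNonZero.Build B B10).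
exact: (@fibre_certificate_nz k A B' r).
Qed.

(** * Newton approximation of a root of h modulo chi *)

Lemma horner_char_poly (R : comNzRingType) n (M : 'M[R]_n) (a : R) :
  (char_poly M).[a] = \det (a%:M - M).
Proof.
rewrite /char_poly -/(horner_eval a _) -det_map_mx; congr (\det _).
apply/matrixP => i j; rewrite !mxE rmorphB rmorphMn /=.
by rewrite /horner_eval hornerX hornerC.
Qed.

(** The determinant of M + X L is a polynomial in X, compared at 0 and at t. *)
Lemma det_congr (R : comNzRingType) n (M L : 'M[R]_n) (t : R) :
  exists e, \det (M + t *: L) = \det M + t * e.
Proof.
pose D : {poly R} := \det (map_mx polyC M + 'X *: map_mx polyC L).
have DE s : D.[s] = \det (M + s *: L).
  rewrite /D -/(horner_eval s _) -det_map_mx; congr (\det _).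
  apply/matrixP => i j; rewrite !mxE rmorphD rmorphM /=.
  by rewrite /horner_eval hornerX !hornerC.
have := DE t; have := DE 0; rewrite scale0r addr0.
elim/poly_ind: (D) => [|q a _]; rewrite ?hornerMXaddC ?horner0.
  by move=> <- <-; exists 0; rewrite mulr0 addr0.
by rewrite mulr0 add0r => <- <-; exists q.[t]; rewrite addrC mulrC.
Qed.

Lemma comp_poly_taylor (R : comNzRingType) (f a e : {poly R}) :
  exists G, f \Po (a + e) = f \Po a + (f^`() \Po a) * e + e ^+ 2 * G.
Proof.
elim/poly_ind: f => [|f c [G fE]].
  by exists 0; rewrite deriv0 !comp_poly0 mul0r mulr0 !addr0.
exists (f^`() \Po a + G * (a + e)).
rewrite derivMXaddC !comp_polyD !comp_polyM !comp_polyX !comp_polyC fE; ring.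
Qed.

Lemma separable_bezout (k : fieldType) (h : {poly k}) : separable_poly h ->
  exists u v, u * h + v * h^`() = 1.
Proof.
rewrite unlock => /Bezout_coprimepP[[u v] /= /eqpP[[a b] /= /andP[a0 b0] E]].
exists ((b^-1 * a) *: u), ((b^-1 * a) *: v).
by rewrite -!scalerAl -scalerDr -scalerA E scalerA mulVf // scale1r.
Qed.

(** Newton iteration from Y = X, with v as inverse of h' modulo h; each step turns h^M into h^(2M),
    of which M + 1 factors are kept. *)
Lemma newton_root (k : fieldType) (h : {poly k}) (M : nat) : separable_poly h ->
  exists Y q, h \Po Y = h ^+ M * q.
Proof.
move=> /separable_bezout[u [v uv]].
elim: M => [|M [Y [q Yq]]]; first by exists 'X, h; rewrite comp_polyXr mul1r.
(* The cofactor below contains [h ^+ M.-1], which needs M > 0. *)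
have [M0|M0] := posnP M.
  by exists 'X, 1; rewrite comp_polyXr M0 expr1 mulr1.
have [G E] := comp_poly_taylor h Y (- ((v \Po Y) * (h \Po Y))).
exists (Y - (v \Po Y) * (h \Po Y)).
have vh : (v \Po Y) * (h^`() \Po Y) = 1 - (u \Po Y) * (h \Po Y).
  have := congr1 (fun f => f \Po Y) uv; rewrite comp_polyD !comp_polyM.
  by rewrite -[1]/(1%:P) comp_polyC => <-; ring.
exists (h ^+ M.-1 * q ^+ 2 * (u \Po Y + (v \Po Y) ^+ 2 * G)).
rewrite E.
have -> : h \Po Y + (h^`() \Po Y) * - ((v \Po Y) * (h \Po Y)) +
    (- ((v \Po Y) * (h \Po Y))) ^+ 2 * G =
    h \Po Y - (v \Po Y) * (h^`() \Po Y) * (h \Po Y) +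
    (h \Po Y) ^+ 2 * ((v \Po Y) ^+ 2 * G) by ring.
rewrite vh; set U := u \Po Y; set W := (v \Po Y) ^+ 2 * G.
have -> : h \Po Y - (1 - U * (h \Po Y)) * (h \Po Y) + (h \Po Y) ^+ 2 * W =
  (h \Po Y) ^+ 2 * (U + W) by ring.
by rewrite Yq exprMn -exprM muln2 -addnn !mulrA -exprD addSnnS prednK.
Qed.

Section WeilPolynomials.
Variables (k : fieldType) (n : nat) (h : {poly k}) (N : nat).
Hypotheses (hmon : h \is monic) (sh : (1 < size h)%N) (N0 : (0 < N)%N).

Definition weil_deg : nat := (n * (size (h ^+ (N + N))).-1)%N.

(** Composition with h^(2N) makes its value at b the determinant of the fibre certificate. It is
    monic of degree [weil_deg], which is the number of coefficients of a remainder, hence of new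
    unknowns. *)
Definition weil_chi (R : idomainType) (f : {rmorphism k -> R}) (t : R)
    (L : 'M[R]_n) : {poly R} :=
  char_poly (t ^+ 2 *: L) \Po map_poly f (h ^+ (N + N)).

Let szH : (1 < size (h ^+ (N + N)))%N.
Proof.
rewrite -[size _]prednK ?size_poly_gt0 ?expf_neq0 ?monic_neq0 // size_exp ltnS.
rewrite muln_gt0 addn_gt0 N0 andbT -ltnS prednK // (ltn_trans _ sh) //.
Qed.

Lemma weil_chi_monic R f t L : @weil_chi R f t L \is monic.
Proof.
rewrite monicE /weil_chi lead_coef_comp ?size_map_poly //.
rewrite (monicP (char_poly_monic _)) mul1r (monicP _) ?expr1n //.
by apply/monic_map/monic_exp.
Qed.

Lemma size_weil_chi R f t L : size (@weil_chi R f t L) = weil_deg.+1.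
Proof.
have m0 := monic_neq0 (weil_chi_monic f t L).
rewrite -[LHS]prednK ?size_poly_gt0 // /weil_chi size_comp_poly size_char_poly.
by rewrite size_map_poly.
Qed.

Lemma map_weil_chi (R R' : idomainType) (f : {rmorphism k -> R})
    (f' : {rmorphism k -> R'}) (g : {rmorphism R -> R'}) t L :
  (forall c, g (f c) = f' c) ->
  map_poly g (weil_chi f t L) = weil_chi f' (g t) (map_mx g L).
Proof.
move=> gf; rewrite /weil_chi map_comp_poly map_char_poly map_mxZ.
rewrite [g (t ^+ 2)]rmorphXn -map_poly_comp.
by rewrite (eq_map_poly (g := f')).
Qed.

Lemma weil_chiE R f t L : exists e,
  @weil_chi R f t L = map_poly f (h ^+ ((N + N) * n)) + (t ^+ 2)%:P * e.
Proof.
have [e E] := det_congr ('X%:M : 'M[{poly R}]_n) (- map_mx polyC L) (t ^+ 2)%:P.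
exists (e \Po map_poly f (h ^+ (N + N))).
have -> : weil_chi f t L = ('X ^+ n + (t ^+ 2)%:P * e) \Po map_poly f (h ^+ (N + N)).
  congr (_ \Po _); apply: etrans _ (etrans E _); last by rewrite det_scalar.
  by rewrite /char_poly /char_poly_mx map_mxZ scalerN.
rewrite comp_polyD comp_polyM comp_polyC rmorphXn /= comp_polyX -rmorphXn.
by rewrite -exprM.
Qed.

Lemma horner_weil_chi (t : k) (L : 'M[k]_n) (b : k) :
  (weil_chi idfun t L).[b] = \det ((h.[b] ^+ (N + N))%:M - t ^+ 2 *: L).
Proof.
by rewrite /weil_chi horner_comp horner_char_poly map_poly_id // horner_exp.
Qed.

End WeilPolynomials.

Lemma weil_step (P : comNzRingType) (chi hY hY0 dhY0 q eps u v T d G rem Q : P) :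
  hY = hY0 + dhY0 * (T * d) + (T * d) ^+ 2 * G ->
  u * hY0 + v * dhY0 = 1 -> hY0 = (chi - T ^+ 2 * eps) * q -> d = T * rem ->
  v * eps * q - T * (u * eps * q * d) - v * d ^+ 2 * G = Q * chi + rem ->
  exists Q', (1 + T ^+ 2 * (u * eps * q)) * hY = Q' * chi.
Proof.
move=> EY uv E0 Ed Es.
have vY : v * hY = ((v - u * (T * d)) * q - T ^+ 2 * Q) * chi.
  have -> : v * hY = v * hY0 + (v * dhY0) * (T * d) + T ^+ 2 * (v * d ^+ 2 * G).
    by rewrite EY; ring.
  have -> : v * dhY0 = 1 - u * hY0 by rewrite -uv; ring.
  have -> : v * d ^+ 2 * G = v * eps * q - T * (u * eps * q * d) - (Q * chi + rem).
    by rewrite -Es; ring.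
  have -> : v * hY0 + (1 - u * hY0) * (T * d) +
      T ^+ 2 * (v * eps * q - T * (u * eps * q * d) - (Q * chi + rem)) =
    (v - u * (T * d)) * (hY0 + T ^+ 2 * eps * q) + T * (d - T * rem) -
      T ^+ 2 * Q * chi by ring.
  rewrite -Ed subrr E0; ring.
exists (dhY0 * ((v - u * (T * d)) * q - T ^+ 2 * Q) + u * q * hY).
have -> : (dhY0 * ((v - u * (T * d)) * q - T ^+ 2 * Q) + u * q * hY) * chi =
  dhY0 * (((v - u * (T * d)) * q - T ^+ 2 * Q) * chi) + u * q * hY * chi by ring.
rewrite -vY.
have -> : 1 + T ^+ 2 * (u * eps * q) = v * dhY0 + u * (hY0 + T ^+ 2 * eps * q).
  by rewrite -uv; ring.
rewrite E0; ring.
Qed.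

(** All identities hold in [A] except d = T rem, which holds only after [f], the evaluation at the
    solution. *)
Lemma weil_step_map (A P : comNzRingType) (f : {rmorphism A -> P})
    (chi hY hY0 dhY0 q eps u v T d G rem Q : A) :
  hY = hY0 + dhY0 * (T * d) + (T * d) ^+ 2 * G ->
  u * hY0 + v * dhY0 = 1 -> hY0 = (chi - T ^+ 2 * eps) * q -> f d = f T * f rem ->
  v * eps * q - T * (u * eps * q * d) - v * d ^+ 2 * G = Q * chi + rem ->
  exists Q', (1 + f T ^+ 2 * f (u * eps * q)) * f hY = Q' * f chi.
Proof.
move=> EY uv E0 Ed Es.
have [] := @weil_step P (f chi) (f hY) (f hY0) (f dhY0) (f q) (f eps) (f u) (f v)
  (f T) (f d) (f G) (f rem) (f Q).
- by rewrite EY !(rmorphD, rmorphM, rmorphXn).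
- by rewrite -!(rmorphD, rmorphM) uv rmorph1.
- by rewrite E0 !(rmorphB, rmorphM, rmorphXn).
- exact: Ed.
- by rewrite -!(rmorphD, rmorphB, rmorphM, rmorphXn) Es.
by move=> Q' E; exists Q'; rewrite -E !rmorphM.
Qed.

Lemma weil_rem (P : comNzRingType) (a y c q r e : P) :
  a * y = e * c -> y = q * c + r -> a * r = (e - a * q) * c.
Proof. by move=> E Ey; rewrite mulrBl -E Ey; ring. Qed.

Lemma ps_Xn_low (k : comNzRingType) m (f : pser k) i :
  (i < m)%N -> (ps_X k ^+ m * f) i = 0.
Proof.
elim: m i => // m IHm [|i] im; rewrite exprS -mulrA ps_XM //.
exact: IHm.
Qed.

(** H is - t^2 times the remainder of w H modulo chi; iterated, this makes H divisible by every
    power of t. *)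
Lemma weil_zero (k : fieldType) (chi H w Q : {poly pser k}) :
  chi \is monic -> (size H < size chi)%N ->
  (1 + ((ps_X k) ^+ 2)%:P * w) * H = Q * chi -> H = 0.
Proof.
move=> cm sH E.
have HE : H = - (ps_X k ^+ 2) *: Pdiv.Ring.rmodp (w * H) chi.
  have := congr1 (fun f => Pdiv.Ring.rmodp f chi) E.
  rewrite Pdiv.RingMonic.rmodp_mull // mulrDl mul1r Pdiv.RingMonic.rmodpD //.
  rewrite Pdiv.Ring.rmodp_small // -mulrA mul_polyC Pdiv.RingMonic.rmodpZ //.
  by move=> /eqP; rewrite addr_eq0 -scaleNr => /eqP.
have div m : exists H', H = ps_X k ^+ m *: H'.
  elim: m => [|m [H' H'E]]; first by exists H; rewrite expr0 scale1r.
  exists (- ps_X k *: Pdiv.Ring.rmodp (w * H') chi).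
  rewrite HE {1}H'E -scalerAr Pdiv.RingMonic.rmodpZ // !scalerA; congr (_ *: _).
  by rewrite mulNr mulrN -exprSr -exprD.
apply/polyP => i; apply/funext => l; have [H' ->] := div l.+1.
by rewrite coefZ ps_Xn_low // coef0.
Qed.

Lemma meval_mmapX (k : fieldType) m M (v : 'I_M -> k) (g : 'I_m -> 'I_M)
    (q : {mpoly k[m]}) :
  meval v (mmap (mpolyC M (R := k)) (fun j => 'X_(g j)) q) =
  meval (fun j => v (g j)) q.
Proof.
elim/mpoly_alg_ind: q => [a|i|q r Hq Hr|q r Hq Hr].
- by rewrite mmapC !mevalC.
- by rewrite mmap_XU !mevalXU.
- by rewrite rmorphD /= !mevalD Hq Hr.
- by rewrite rmorphM /= !mevalM Hq Hr.
Qed.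

Section WeilSystem.
Variables (k : fieldType) (m : nat) (c : 'I_m.+1 -> k).
Variable p : 'I_m.+1 -> {mpoly k[m.+1]}.
Hypotheses (c0 : c ord0 = 0) (p0 : p ord0 = 1).
Variables (n : nat) (L : 'M[{mpoly k[m.+1]}]_n) (h : {poly k}) (N : nat).
Hypotheses (hsep : separable_poly h) (hmon : h \is monic) (sh : (1 < size h)%N).
Hypotheses (N0 : (0 < N)%N) (hroot : forall a, ~~ root h a).

Let d := weil_deg n h N.
Local Notation S := {mpoly k[m.+1 + d]}.

(* The new unknowns are the coefficients of t^-1 (Y - Y0), where Y0 is a root of
   h modulo chi at t = 0 and Y is a root of h modulo chi; a root of chi in k
   would give the root Y of h in k. *)
Lemma weil_system : exists (c' : 'I_(m.+1 + d) -> k)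
    (p' : 'I_(m.+1 + d) -> {mpoly k[m.+1 + d]}),
  [/\ forall i, c' (lshift d i) = c i,
      forall i, p' (lshift d i) =
        mmap (mpolyC (m.+1 + d) (R := k)) (fun j => 'X_(lshift d j)) (p i) &
      forall z' : 'I_(m.+1 + d) -> pser k, ps_system c' p' z' ->
      forall v : 'I_(m.+1 + d) -> k, sys_point (n := m + d) z' v ->
      forall b, \det ((h.[b] ^+ (N + N))%:M - v (lshift d ord0) ^+ 2 *:
        map_mx (meval (fun i => v (lshift d i))) L) != 0].
Proof.
have [u [v uv]] := separable_bezout hsep.
have [Y0 [q Yq]] := newton_root ((N + N) * n) hsep.
pose kS : {rmorphism k -> S} := mpolyC (m.+1 + d) (R := k).
pose emb : {rmorphism {mpoly k[m.+1]} -> S} :=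
  mmap kS (fun j => 'X_(lshift d j)).
pose T : S := 'X_(lshift d ord0).
pose LS : 'M[S]_n := map_mx emb L.
pose chi := weil_chi h N kS T LS.
have cm : chi \is monic by exact: weil_chi_monic.
have sc : size chi = d.+1 by exact: size_weil_chi.
have [eps chiE] := weil_chiE h N kS T LS.
pose P := map_poly kS.
(* Indexed by [nat] to serve as coefficients; the value 0 outside the range is not read. *)
pose X (i : nat) : S :=
  if insub i is Some j then 'X_(rshift m.+1 (j : 'I_d)) else 0.
pose del : {poly S} := \poly_(i < d) X i.
have [G EG] := comp_poly_taylor (P h) (P Y0) (T%:P * del).
set hY := P h \Po (P Y0 + T%:P * del) in EG.
(* The expression reduced modulo chi in [weil_step]; the coefficients of its remainder are the
   right-hand sides of the new equations. *)
pose stuff : {poly S} := P (v \Po Y0) * eps * P q -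
  T%:P * (P (u \Po Y0) * eps * P q * del) - P (v \Po Y0) * del ^+ 2 * G.
pose rem := Pdiv.Ring.rmodp stuff chi.
have stuffE : stuff = Pdiv.Ring.rdivp stuff chi * chi + rem.
  exact: Pdiv.RingMonic.rdivp_eq.
have srem : (size rem <= d)%N.
  rewrite -ltnS -sc /rem; exact/Pdiv.Ring.ltn_rmodpN0/monic_neq0.
pose remY := Pdiv.Ring.rmodp hY chi.
have hYE : hY = Pdiv.Ring.rdivp hY chi * chi + remY.
  exact: Pdiv.RingMonic.rdivp_eq.
have sremY : (size remY < d.+1)%N.
  rewrite -sc /remY; exact/Pdiv.Ring.ltn_rmodpN0/monic_neq0.
pose c' (i : 'I_(m.+1 + d)) := match fintype.split i with inl l => c l | inr _ => 0 end.
pose p' (i : 'I_(m.+1 + d)) : S :=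
  match fintype.split i with inl l => emb (p l) | inr j => rem`_j end.
have sL l : fintype.split (lshift d l : 'I_(m.+1 + d)) = inl l.
  by rewrite -[lshift _ _]/(unsplit (inl l)) unsplitK.
have sR j : fintype.split (rshift m.+1 j : 'I_(m.+1 + d)) = inr j.
  by rewrite -[rshift _ _]/(unsplit (inr j)) unsplitK.
exists c', p'; split=> [i|i|z' sys v' v'P b]; rewrite ?/c' ?/p' ?sL //.
have [phi phiE] : exists phi : {rmorphism S -> pser k},
    forall q, phi q = mmap (ps_C k) z' q by exists (mmap (ps_C k) z').
have phiT : phi T = ps_X k.
  rewrite phiE mmap_XU sys /c' /p' !sL c0 p0 !rmorph1 rmorph0 add0r.
  exact: mulr1.
have phik a : phi (kS a) = ps_C k a by rewrite phiE; exact: mmapC.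
have phidel : map_poly phi del = (ps_X k)%:P * map_poly phi rem.
  apply/polyP => i; rewrite coefCM !coef_map coef_poly.
  case: ltnP => [id|di]; last first.
    have e0 (x : S) : x = 0 -> phi x = 0 by move=> ->; exact: rmorph0.
    apply: etrans (e0 _ erefl) (esym (etrans _ (mulr0 (ps_X k)))).
    by congr (_ * _); apply: e0; exact: nth_default (leq_trans srem di).
  have -> : i = Ordinal id by [].
  rewrite /X valK; apply: etrans (phiE _) _; rewrite mmap_XU sys /c' /p' !sR.
  apply: etrans (congr1 (fun x => x + _) (rmorph0 (ps_C k))) (etrans (add0r _) _).
  by congr (_ * _); rewrite -phiE.
have Yq' : P h \Po P Y0 = (chi - T%:P ^+ 2 * eps) * P q.
  rewrite -map_comp_poly Yq rmorphM /chi chiE rmorphXn /= -!rmorphXn /=.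
  by rewrite addrK.
have uvY : P (u \Po Y0) * (P h \Po P Y0) + P (v \Po Y0) * ((P h)^`() \Po P Y0) = 1.
  have := congr1 (fun f => P (f \Po Y0)) uv; rewrite comp_polyD !comp_polyM.
  rewrite /P rmorphD !rmorphM /= !map_comp_poly -deriv_map => ->.
  by rewrite rmorph1; exact: comp_polyC.
pose w := map_poly phi (P (u \Po Y0) * eps * P q).
have [Q' step] : exists Q', (1 + ((ps_X k) ^+ 2)%:P * w) * map_poly phi hY =
    Q' * map_poly phi chi.
  have [|Q' E] := @weil_step_map _ _ (map_poly phi) _ _ _ _ _ _ _ _ _ _ _ _ _
    EG uvY Yq' _ stuffE; first by apply: etrans phidel _; rewrite -phiT -map_polyC.
  exists Q'; apply: etrans E; congr ((1 + _ * _) * _).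
  by rewrite polyC_exp -phiT -map_polyC.
have remY0 : map_poly phi remY = 0.
  have cm' : map_poly phi chi \is monic by exact: monic_map.
  have sc' : size (map_poly phi chi) = d.+1.
    by rewrite size_map_poly_id0 ?sc // (monicP cm) rmorph1 oner_eq0.
  apply: (@weil_zero k (map_poly phi chi) _ w
    (Q' - (1 + ((ps_X k) ^+ 2)%:P * w) *
      map_poly phi (Pdiv.Ring.rdivp hY chi))) => //.
    by rewrite sc' (leq_ltn_trans (size_poly _ _)).
  have E : map_poly phi hY = map_poly phi (Pdiv.Ring.rdivp hY chi) *
      map_poly phi chi + map_poly phi remY.
    by rewrite -rmorphM -rmorphD -hYE.
  exact: (weil_rem step E).
pose psi : {rmorphism S -> k} := meval v'.
have psik a : psi (kS a) = a by exact: mevalC.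
(* The remainder of h(Y) vanishes at the series solution, so its coefficients are relations and
   vanish at the point v' as well. *)
have remYv : map_poly psi remY = 0.
  apply/polyP => i; rewrite coef_map coef0; apply: v'P.
  apply: etrans (esym (phiE _)) _; have := congr1 (fun f : {poly pser k} => f`_i) remY0.
  by rewrite coef_map coef0.
have PsiP f : map_poly psi (P f) = f.
  by apply/polyP => i; rewrite !coef_map; exact: psik.
apply/negP => /eqP det0.
have chi0 : (map_poly psi chi).[b] = 0.
  rewrite (map_weil_chi _ _ (f' := idfun)) // horner_weil_chi -det0.
  rewrite /psi /T /= mevalXU; congr (\det (_ - _ *: _)).
  by apply/matrixP => i j; rewrite !mxE; exact: meval_mmapX.
(* Over k, chi now divides h(Y), so a root b of chi would give the root Y(b) of h. *)
have := congr1 (map_poly psi) hYE; rewrite rmorphD rmorphM /= remYv addr0.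
rewrite /hY map_comp_poly PsiP => /(congr1 (fun f => f.[b])).
rewrite horner_comp hornerM chi0 mulr0 => /eqP.
by rewrite -/(root _ _) (negPf (hroot _)).
Qed.

End WeilSystem.

(** * Schemes *)

Lemma mpoly_hom_ext (n : nat) (R : comNzRingType) (A : comPzRingType)
    (e e' : {rmorphism {mpoly R[n]} -> A}) :
  (forall c, e c%:MP = e' c%:MP) -> (forall i, e 'X_i = e' 'X_i) -> e =1 e'.
Proof.
move=> eC eX; apply: mpoly_alg_ind => [//|//|p q ep eq|p q ep eq].
  by rewrite !rmorphD ep eq.
by rewrite !rmorphM ep eq.
Qed.

(** The target may be the zero ring, as for sections over the empty set; this case is treated
    apart. *)
Lemma mpoly_hom (n : nat) (R : comNzRingType) (A : comPzRingType)
    (f : {rmorphism R -> A}) (h : 'I_n -> A) :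
  exists e : {rmorphism {mpoly R[n]} -> A},
    (forall c, e c%:MP = f c) /\ (forall i, e 'X_i = h i).
Proof.
have [A1|A1] := eqVneq (1 : A) 0.
  have A0 (x y : A) : x = y by rewrite -[x]mul1r -[y]mul1r A1 !mul0r.
  have [||e _] := @mk_rmorphism {mpoly R[n]} A (fun _ => 0).
  - by move=> x y; exact: A0.
  - by split=> [|x y]; exact: A0.
  by exists e; split=> x; exact: A0.
pose A' : comNzRingType := HB.pack (GRing.ComPzRing.sort A)
  (GRing.PzSemiRing_isNonZero.Build A A1).
pose f' : {rmorphism R -> A'} := f.
pose e : {rmorphism {mpoly R[n]} -> A'} := mmap f' (h : 'I_n -> A').
have eC c : e c%:MP = f' c by exact: mmapC.
have eX i : e 'X_i = h i by exact: (mmap_XU f').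
by exists e.
Qed.

Lemma sys_rel_of_hom (k : fieldType) (n : nat) (c : 'I_n.+1 -> k)
    (p : 'I_n.+1 -> {mpoly k[n.+1]}) (z : 'I_n.+1 -> pser k) (A : comPzRingType)
    (G : {rmorphism {mpoly k[n.+1]} -> A}) (e : {rmorphism A -> k}) q :
  c ord0 = 0 -> p ord0 = 1 -> ps_system c p z ->
  (forall a, e (G a%:MP) = a) -> e (G 'X_ord0) = 0 ->
  (forall a, G 'X_ord0 * a = 0 -> a = 0) ->
  (forall i, G 'X_i = G (c i)%:MP + G 'X_ord0 * G (p i)) ->
  G q = 0 -> sys_rel z q.
Proof.
move=> c0 p0 zs eG e0 reg Gsys Gq.
have A1 : 1 != 0 :> A.
  by apply/eqP => /(congr1 e)/eqP; rewrite rmorph1 rmorph0 oner_eq0.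
pose A' : comNzRingType := HB.pack (GRing.ComPzRing.sort A)
  (GRing.PzSemiRing_isNonZero.Build A A1).
pose f : {rmorphism k -> A'} := G \o (mpolyC n.+1 (R := k)).
pose g (i : 'I_n.+1) : A' := G 'X_i.
have mE (r : {mpoly k[n.+1]}) : mmap f g r = G r.
  apply: (@mpoly_hom_ext _ k A' (mmap f g) G) => [a|i]; first exact: mmapC.
  exact: (mmap_XU f).
apply: (@sys_rel_of_point k n c p c0 p0 z zs A' f (e : {rmorphism A' -> k}) g) => //.
- by move=> i; rewrite mE; exact: Gsys.
- by rewrite mE.
Qed.

(** * Germs and values of sections *)

Section RingedSpaceTheory.
Variable X : ringed_space.
Implicit Types (U V W N : opens X) (x y : X).

Lemma res_irr U V (h h' : V `<=` U) (s : sec X U) : res h s = res h' s.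
Proof. by rewrite (Prop_irrelevance h h'). Qed.

Lemma germ_unit_res U V (h : V `<=` U) (s : sec X U) x :
  V x -> germ_unit (res h s) x <-> germ_unit s x.
Proof.
move=> Vx; split=> [[W [hW [Wx [t Ht]]]]|[W [hW [Wx [t Ht]]]]].
  have hU : W `<=` U := subset_trans hW h.
  by exists W, hU; split=> //; exists t; rewrite -(res_comp h hW).
have h1 : opensI V W `<=` V by move=> y [].
have h2 : opensI V W `<=` W by move=> y [].
have hU : opensI V W `<=` U := subset_trans h1 h.
exists (opensI V W), h1; split=> //; exists (res h2 t).
by rewrite (res_comp h h1 hU) -(res_comp hW h2 hU) -rmorphM Ht rmorph1.
Qed.

Lemma germ_unit_dom U (s : sec X U) x : germ_unit s x -> U x.
Proof. by move=> [W [h [Wx _]]]; exact: (h). Qed.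

Lemma germ_unitM U (s t : sec X U) x :
  germ_unit (s * t) x <-> germ_unit s x /\ germ_unit t x.
Proof.
split=> [[W [h [Wx [u Hu]]]]|[[W [h [Wx [u Hu]]]] [W' [h' [Wx' [u' Hu']]]]]].
  split; exists W, h; split=> //.
    by exists (u * res h t); rewrite -Hu rmorphM; ring.
  by exists (u * res h s); rewrite -Hu rmorphM; ring.
have h1 : opensI W W' `<=` W by move=> y [].
have h2 : opensI W W' `<=` W' by move=> y [].
have hU : opensI W W' `<=` U := subset_trans h1 h.
exists (opensI W W'), hU; split=> //; exists (res h1 u * res h2 u').
rewrite rmorphM -{1}(res_comp h h1 hU) -(res_comp h' h2 hU) mulrACA -!rmorphM.
by rewrite Hu Hu' !rmorph1 mulr1.
Qed.

Lemma germ_unit1 U x : U x -> germ_unit (1 : sec X U) x.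
Proof.
move=> Ux; exists U, (@subset_refl _ U); split=> //; exists 1.
by rewrite mul1r rmorph1.
Qed.

Lemma germ_unitX U (s : sec X U) n x : U x -> germ_unit s x -> germ_unit (s ^+ n) x.
Proof.
move=> Ux su; elim: n => [|n IHn]; first by rewrite expr0; exact: germ_unit1.
by rewrite exprS; apply/germ_unitM.
Qed.

Lemma sec_empty U (s t : sec X U) : (forall x, ~ U x) -> s = t.
Proof.
move=> U0; have hV (i : False) : (fun _ : False => U) i `<=` U by [].
by apply: (sheaf_separated (hV := hV)) => [x /U0//|[]].
Qed.

(** Local inverses are unique, hence glue. *)
Lemma unit_basic_open U (s : sec X U) : exists t, t * res (@basic_open_sub X U s) s = 1.
Proof.
have loc (x : {x | basic_open s x}) : exists W : opens X,
    W (sval x) /\ exists (h : W `<=` U) (t : sec X W), t * res h s = 1.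
  case: x => x [Ux [W [h [Wx [t Ht]]]]]; exists W; split=> //.
  by exists h, t.
have /choice[W WP] := loc.
have WD i : W i `<=` basic_open s.
  move=> y Wy; have [_ [h [t Ht]]] := WP i; split; first exact: (h).
  by exists (W i), h; split=> //; exists t.
have /all_sig[t tP] i : {t : sec X (W i) | t * res (WD i) (res (@basic_open_sub X U s) s) = 1}.
  apply: cid; have [_ [h [t Ht]]] := WP i; exists t.
  by rewrite (res_comp _ _ h).
have [||u uP] := @sheaf_glue X (basic_open s) _ W WD _ t.
- by move=> x sx; exists (exist _ x sx); have [] := WP (exist _ x sx).
- move=> i j V hi hj.
  have hV : V `<=` basic_open s := subset_trans hi (WD i).
  set r := res (@basic_open_sub X U s) s in tP.
  have Ei : res hi (t i) * res hV r = 1.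
    by rewrite -(res_comp (WD i) hi hV) -rmorphM tP rmorph1.
  have Ej : res hj (t j) * res hV r = 1.
    by rewrite -(res_comp (WD j) hj hV) -rmorphM tP rmorph1.
  by rewrite -[LHS]mulr1 -Ej mulrCA Ei mulr1.
exists u; apply: (sheaf_separated (hV := WD)) => [x sx|i].
  by exists (exist _ x sx); have [] := WP (exist _ x sx).
by rewrite rmorphM uP tP rmorph1.
Qed.

Lemma affine_fraction U W x (s : sec X W) : affine U -> U x -> W x ->
  exists (g a : sec X U) (n : nat) (h : basic_open g `<=` W),
    basic_open g x /\
    res (@basic_open_sub X U g) g ^+ n * res h s = res (@basic_open_sub X U g) a.
Proof.
move=> aU Ux Wx.
have [g [gx gUW]] := affine_basis aU (fun y (h : opensI U W y) => h.1) (conj Ux Wx).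
have h : basic_open g `<=` W by move=> y /gUW[].
have [n [a E]] := loc_frac (affine_loc aU g) (res h s).
by exists g, a, n, h; split=> //; rewrite -rmorphXn.
Qed.

End RingedSpaceTheory.

Section SchemeTheory.
Variable X : scheme.
Implicit Types (U V W N : opens X) (x y : X).

Lemma germ_nonunit0 U x : U x -> ~ germ_unit (0 : sec X U) x.
Proof.
move=> Ux [W [h [Wx [t]]]]; rewrite rmorph0 mulr0 => W01.
have [V [aV Vx]] := scheme_affine x.
have := prime_ideal0 (affine_prime aV Vx); apply.
have h1 : opensI W V `<=` W by move=> y [].
have h2 : opensI W V `<=` V by move=> y [].
exists (opensI W V), h2; split=> //; exists 0.
by rewrite mul0r -(rmorph0 (res h1)) W01 rmorph1.
Qed.

(** On an affine neighbourhood both sections become fractions with denominator a power of g, a unit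
    at x, and the numerators that are not units at x form a prime ideal. *)
Lemma germ_nonunitD U (s t : sec X U) x : U x ->
  ~ germ_unit s x -> ~ germ_unit t x -> ~ germ_unit (s + t) x.
Proof.
move=> Ux ns nt; have [V [aV Vx]] := scheme_affine x.
have [g [gx gUV]] := affine_basis aV (fun y (h : opensI V U y) => h.1) (conj Vx Ux).
have h : basic_open g `<=` U by move=> y /gUV[].
set hg := @basic_open_sub X V g.
have ug : germ_unit (res hg g) x by apply/(germ_unit_res hg g gx); case: gx.
have [n [a Ea]] := loc_frac (affine_loc aV g) (res h s).
have [m [b Eb]] := loc_frac (affine_loc aV g) (res h t).
have nu (r : sec X V) i (u : sec X U) : res hg (g ^+ i) * res h u = res hg r ->
    ~ germ_unit u x -> ~ germ_unit r x.
  move=> E nu /(germ_unit_res hg r gx); rewrite -E => /germ_unitM[_].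
  by move=> /(germ_unit_res h u gx).
have na := nu _ _ _ Ea ns; have nb := nu _ _ _ Eb nt.
have pV := affine_prime aV Vx.
have : ~ germ_unit (g ^+ m * a + g ^+ n * b) x.
  apply: (prime_idealD pV); exact: (prime_idealM pV).
apply: contra_not => /(germ_unit_res h _ gx) us; apply/(germ_unit_res hg _ gx).
have -> : res hg (g ^+ m * a + g ^+ n * b) =
    res hg (g ^+ (n + m)) * res h (s + t).
  by rewrite rmorphD !rmorphM -Ea -Eb !rmorphXn rmorphD exprD; ring.
by apply/germ_unitM; split=> //; rewrite rmorphXn; apply: germ_unitX.
Qed.

(** Near each point s is a fraction a / g^n on D(g), and g a is a unit nowhere. Then g a is
    nilpotent, hence 0 by reducedness. *)
Lemma nowhere_unit_eq0 : reduced X -> forall U (s : sec X U),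
  (forall x, ~ germ_unit s x) -> s = 0.
Proof.
move=> rX U s ns.
pose I := {W : opens X | exists h : W `<=` U, res h s = 0}.
have hV (i : I) : sval i `<=` U by case: i => W [].
apply: (sheaf_separated (hV := hV)) => [x Ux|[W [h E]]]; last first.
  by rewrite rmorph0 /= (res_irr _ h).
have [V [aV Vx]] := scheme_affine x.
have [g [a [n [h [gx E]]]]] := affine_fraction s aV Vx Ux.
set hg := @basic_open_sub X V g in E.
have [u Hu] := unit_basic_open g; rewrite -/hg in Hu.
have ga : g * a = 0.
  have nga y : ~ germ_unit (g * a) y.
    move=> gay; have /germ_unitM[gy ay] := gay.
    have Dy : basic_open g y by split=> //; exact: germ_unit_dom gy.
    apply: (ns y); apply/(germ_unit_res h s Dy).
    move: ay => /(germ_unit_res hg a Dy); rewrite -E => /germ_unitM[_ //].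
  (* D(g a) is empty and its ring zero, so a power of g a kills 1. *)
  have [|m] := @loc_zero _ _ _ _ (affine_loc aV (g * a)) 1.
    by apply: sec_empty => y [_ /nga].
  by rewrite mulr1 => /rX.
have sz : res h s = 0.
  have un : u ^+ n * res hg g ^+ n = 1 by rewrite -exprMn Hu expr1n.
  rewrite -[LHS]mul1r -un -mulrA E -[res hg a]mul1r -Hu -mulrA -rmorphM ga.
  by rewrite rmorph0 !mulr0.
by exists (exist _ (basic_open g) (ex_intro _ h sz)).
Qed.

End SchemeTheory.

Section IntegralScheme.
Variable X : scheme.
Hypothesis hX : integral_scheme X.
Implicit Types (U V W : opens X) (x y : X).

Lemma integral_openI (U V : set X) : open U -> open V -> U !=set0 -> V !=set0 ->
  U `&` V !=set0.
Proof.
move=> oU oV [x Ux] [y Vy]; have [[_ irr] _] := hX.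
apply: contrapT => nUV.
have [||z _|h|h] := irr (~` U) (~` V); [exact: open_closedC|exact: open_closedC| | |].
- by apply: contrapT => /not_orP[/contrapT Uz /contrapT Vz]; apply: nUV; exists z.
- by have := h x Logic.I.
- by have := h y Logic.I.
Qed.

Lemma integral_mul0 U (s t : sec X U) : s * t = 0 -> s = 0 \/ t = 0.
Proof.
move=> st; have [_ rX] := hX; apply: contrapT => /not_orP[s0 t0].
have ex (r : sec X U) : r <> 0 -> basic_open r !=set0.
  move=> r0; apply: contrapT => h; apply: r0; apply: (nowhere_unit_eq0 rX) => x rx.
  by apply: h; exists x; split=> //; exact: germ_unit_dom rx.
have [x [[Ux sx] [_ tx]]] := integral_openI (open_oset (basic_open s))
  (open_oset (basic_open t)) (ex s s0) (ex t t0).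
apply: (germ_nonunit0 Ux); rewrite -st; exact/germ_unitM.
Qed.

Lemma integral_res0 U V (h : V `<=` U) (s : sec X U) x :
  V x -> res h s = 0 -> s = 0.
Proof.
move=> Vx rs; have [_ rX] := hX; apply: (nowhere_unit_eq0 rX) => y sy.
have [z [[Uz sz] Vz]] := integral_openI (open_oset (basic_open s)) (open_oset V)
  (ex_intro _ y (conj (germ_unit_dom sy) sy)) (ex_intro _ x Vx).
by move/(germ_unit_res h s Vz): sz; rewrite rs; exact: germ_nonunit0.
Qed.

End IntegralScheme.

Section Rational.
Variables (k : fieldType) (X : kscheme k).
Implicit Types (U V W : opens X) (x y : X).

Definition kconstr U : {rmorphism k -> sec X U} :=
  @res X (opensT X) U (fun x _ => Logic.I) \o kscheme_struct X.

Lemma kconstrE U c : kconstr U c = kconst U c. Proof. by []. Qed.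

Lemma res_kconst U V (h : V `<=` U) c : res h (kconst U c) = kconst V c.
Proof. exact: res_comp. Qed.

Lemma kconst_unit U c x : U x -> germ_unit (kconst U c) x <-> c != 0.
Proof.
move=> Ux; rewrite -kconstrE; split=> [|c0].
  by apply: contraPneq => ->; rewrite rmorph0; exact: germ_nonunit0.
exists U, (@subset_refl _ U); split=> //; exists (kconstr U c^-1).
by rewrite res_id -rmorphM mulVf // rmorph1.
Qed.

Lemma germ_unit_near U (s t : sec X U) x : U x -> ~ germ_unit (s - t) x ->
  germ_unit s x <-> germ_unit t x.
Proof.
move=> Ux nst.
have imp (a b : sec X U) : ~ germ_unit (a - b) x -> germ_unit a x -> germ_unit b x.
  move=> nab ua; apply: contrapT => nb.
  by have := germ_nonunitD Ux nab nb; rewrite subrK.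
split; apply: imp => //; apply: contra_not nst => ts.
have -> : s - t = (-1) * (t - s) by ring.
apply/germ_unitM; split=> //; have := kconst_unit (-1) Ux.
by rewrite -kconstrE rmorphN1 oppr_eq0 oner_eq0 => ->.
Qed.

(** Evaluation at a rational point, determined by its being the identity on constants and by which
    germs are units. *)
Definition value_at U (e : sec X U -> k) x : Prop :=
  (forall c, e (kconst U c) = c) /\ (forall s, e s != 0 <-> germ_unit s x).

Lemma rational_value x U : rational_points X x -> U x ->
  exists e : {rmorphism sec X U -> k}, value_at e x.
Proof.
move=> rx Ux; have /choice[e eP] := fun s => rx U s Ux.
have uniq s c : ~ germ_unit (s - kconst U c) x -> e s = c.
  move=> sc; apply/eqP; rewrite -subr_eq0; apply: contrapT => /negP.
  move=> /(kconst_unit _ Ux); rewrite -kconstrE rmorphB !kconstrE.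
  have -> : kconst U (e s) - kconst U c =
      (s - kconst U c) + (-1) * (s - kconst U (e s)) by ring.
  apply: germ_nonunitD => // /germ_unitM[_]; exact: eP.
have [||h he] := @mk_rmorphism _ _ e.
- move=> s t; apply: uniq; rewrite -kconstrE rmorphB !kconstrE.
  have -> : s - t - (kconst U (e s) - kconst U (e t)) =
      (s - kconst U (e s)) + (-1) * (t - kconst U (e t)) by ring.
  by apply: germ_nonunitD => // /germ_unitM[_]; exact: eP.
- split=> [|s t]; apply: uniq.
    by rewrite -kconstrE rmorph1 subrr; exact: germ_nonunit0.
  rewrite -kconstrE rmorphM !kconstrE.
  have -> : s * t - kconst U (e s) * kconst U (e t) =
      (s - kconst U (e s)) * t + kconst U (e s) * (t - kconst U (e t)) by ring.
  apply: germ_nonunitD => // /germ_unitM[]; last by move=> _; exact: eP.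
  by move=> + _; exact: eP.
exists h; split=> [c|s]; rewrite he.
  by apply: uniq; rewrite subrr; exact: germ_nonunit0.
by rewrite -(kconst_unit _ Ux); exact: iff_sym (germ_unit_near Ux (eP s)).
Qed.

Lemma value_nonunit U (e : {rmorphism sec X U -> k}) x : value_at e x ->
  forall s, ~ germ_unit (s - kconst U (e s)) x.
Proof.
by move=> [ek eu] s /eu; rewrite rmorphB ek subrr eqxx.
Qed.

Lemma value_inj U (e e' : {rmorphism sec X U -> k}) x :
  value_at e x -> value_at e' x -> e =1 e'.
Proof.
move=> ex [e'k e'u] s; have := value_nonunit (s := s) ex.
move=> /e'u/negP; rewrite negbK rmorphB e'k subr_eq0 => /eqP h; exact: esym.
Qed.

Lemma affine_point_inj U x y : affine U -> U x -> U y ->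
  (forall s : sec X U, germ_unit s x <-> germ_unit s y) -> x = y.
Proof.
move=> aU Ux Uy h.
have [z [_ zP]] := affine_bij aU (affine_prime aU Ux).
rewrite -(zP x) // (zP y) //; split=> //.
by apply/funext => s; apply/propext; split=> ns /h.
Qed.

(** If every germ at [x] is a fraction a / g of elements of [A], its value is e a / e g. This serves
    both affine open sets and charts of a closed subscheme. *)
Lemma fraction_rational (x : X) U (A : comPzRingType)
    (phi : {rmorphism A -> sec X U}) (e : {rmorphism A -> k})
    (iota : {rmorphism k -> A}) :
  U x -> (forall c, phi (iota c) = kconst U c) -> (forall c, e (iota c) = c) ->
  (forall a, e a != 0 <-> germ_unit (phi a) x) ->
  (forall W (s : sec X W), W x ->
    exists (g a : A) (N : opens X) (h : N `<=` W) (h' : N `<=` U),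
    [/\ N x, germ_unit (phi g) x & res h' (phi g) * res h s = res h' (phi a)]) ->
  rational_points X x.
Proof.
move=> Ux phik ek eu H W s Wx; have [g [a [N [h [h' [Nx gx E]]]]]] := H W s Wx.
have g0 : e g != 0 by exact/eu.
exists (e a / e g) => /(germ_unit_res h _ Nx) su.
have : germ_unit (phi (a - iota (e a / e g) * g)) x.
  apply/(germ_unit_res h' _ Nx).
  have -> : phi (a - iota (e a / e g) * g) = phi a - kconst U (e a / e g) * phi g.
    by rewrite rmorphB (rmorphM phi) phik.
  rewrite rmorphB rmorphM -E res_kconst.
  have -> : res h' (phi g) * res h s - kconst N (e a / e g) * res h' (phi g) =
     res h' (phi g) * (res h s - kconst N (e a / e g)) by ring.
  apply/germ_unitM; split; first exact/germ_unit_res.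
  by move: su; rewrite rmorphB res_kconst.
by move=> /eu; rewrite rmorphB (rmorphM e) ek divfK // subrr eqxx.
Qed.

Lemma affine_rational_point U (e : {rmorphism sec X U -> k}) : affine U ->
  (forall c, e (kconst U c) = c) ->
  exists x, [/\ U x, rational_points X x & value_at e x].
Proof.
move=> aU ek.
have pe : prime_ideal [set s : sec X U | e s = 0].
  split=> /=.
  - exact: rmorph0.
  - by move=> a b ea eb; rewrite rmorphD ea eb addr0.
  - by move=> a b eb; rewrite rmorphM eb mulr0.
  - by rewrite rmorph1; exact/eqP/oner_neq0.
  - by move=> a b; rewrite rmorphM => /eqP; rewrite mulf_eq0 => /orP[]/eqP; [left|right].
have [x [[Ux Px] _]] := affine_bij aU pe.
have ex : value_at e x.
  split=> // s; have := congr1 (fun P : set _ => P s) Px; rewrite /= => E.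
  split=> [/eqP h|sx]; first by apply: contrapT; rewrite -E.
  by apply/eqP => h; move: sx; apply: contraPP; rewrite -E.
exists x; split=> //.
apply: (@fraction_rational x U _ idfun e (kconstr U)) => // [|W s Wx].
  by case: ex.
have [g [a [n [h [gx E]]]]] := affine_fraction s aU Ux Wx.
exists (g ^+ n), a, (basic_open g), h, (@basic_open_sub X U g).
by split=> //; rewrite ?rmorphXn //; apply: germ_unitX => //; case: gx.
Qed.

End Rational.

Section MorphismValue.
Variables (X Y : scheme) (f : morphism X Y).

Lemma comor_unit (V : opens Y) (s : sec Y V) (x : X) : V (f x) ->
  germ_unit (comor f V s) x <-> germ_unit s (f x).
Proof.
move=> Vx; split=> [|[W [h [Wx [t Ht]]]]]; first exact: comor_local.
have h' : mpreim f W `<=` mpreim f V by move=> y; exact: (h).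
exists (mpreim f W), h'; split=> //; exists (comor f W t).
by rewrite -comor_res -rmorphM Ht rmorph1.
Qed.

End MorphismValue.

Lemma morphism_value (k : fieldType) (X Y : kscheme k) (f : morphism X Y)
    (V : opens Y) (x : X) (e : {rmorphism sec X (mpreim f V) -> k}) :
  over_k f -> V (f x) -> value_at e x -> value_at (e \o comor f V) (f x).
Proof.
move=> fk Vx [ek eu]; split=> [c|s] /=; first by rewrite fk.
by rewrite -(comor_unit s Vx) eu.
Qed.

(** * Uniformizers *)

(** The homogenized polynomial b^n f(a / b), without division. *)
Definition hom_eval (A : comNzRingType) n (f : {poly A}) (a b : A) : A :=
  \sum_(i < n.+1) f`_i * a ^+ i * b ^+ (n - i).

Lemma hom_eval_linear (A : comNzRingType) n (f : {poly A}) (al be a b : A) :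
  (size f <= n.+1)%N ->
  hom_eval n.+1 ((al *: 'X + be%:P) * f) a b = (al * a + be * b) * hom_eval n f a b.
Proof.
move=> sf; rewrite /hom_eval [RHS]mulrDl !mulr_sumr.
have -> : \sum_(i < n.+2) ((al *: 'X + be%:P) * f)`_i * a ^+ i * b ^+ (n.+1 - i) =
    \sum_(i < n.+2) al * ('X * f)`_i * a ^+ i * b ^+ (n.+1 - i) +
    \sum_(i < n.+2) be * f`_i * a ^+ i * b ^+ (n.+1 - i).
  rewrite -big_split; apply: eq_bigr => i _ /=.
  by rewrite mulrDl -scalerAl coefD coefZ coefCM -!mulrDl.
congr (_ + _).
  rewrite big_ord_recl coefXM eqxx !(mulr0, mul0r) add0r; apply: eq_bigr => i _.
  by rewrite coefXM /= /bump leq0n add1n /= subSS exprS; ring.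
rewrite big_ord_recr /= nth_default // !(mulr0, mul0r) addr0; apply: eq_bigr => i _.
by rewrite subSn ?leq_ord // exprS; ring.
Qed.

Lemma hom_eval_prod (A : comNzRingType) n (al be : 'I_n -> A) (a b : A) :
  hom_eval n (\prod_i (al i *: 'X + (be i)%:P)) a b = \prod_i (al i * a + be i * b).
Proof.
have size_lin (x y : A) : (size (x *: 'X + y%:P : {poly A})%R <= 2)%N.
  rewrite (leq_trans (size_polyD _ _)) // geq_max (leq_trans (size_scale_leq _ _)).
    by rewrite (leq_trans (size_polyC_leq1 _)).
  by rewrite size_polyX.
have size_pr m (al' be' : 'I_m -> A) :
    (size (\prod_i (al' i *: 'X + (be' i)%:P) : {poly A})%R <= m.+1)%N.
  elim: m al' be' => [|m IHm] al' be'; first by rewrite big_ord0 size_polyC oner_neq0.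
  rewrite big_ord_recl (leq_trans (size_polyMleq _ _)) //.
  have := leq_add (size_lin (al' ord0) (be' ord0))
    (IHm (fun i => al' (lift ord0 i)) (fun i => be' (lift ord0 i))).
  by case: (_ + _)%N.
elim: n al be => [|n IHn] al be.
  by rewrite /hom_eval !big_ord0 big_ord1 coef1 eqxx !expr0 !mulr1.
by rewrite !big_ord_recl hom_eval_linear ?IHn.
Qed.

(** Normality is tested on equations with cleared denominators, so the determinant is needed in
    homogeneous form. The identity is checked on each permutation, where both sides come from a
    product of linear forms. *)
Lemma det_hom (A : comNzRingType) n (B : 'M[A]_n) (a b : A) :
  \det (a%:M - b *: B) =
  a ^+ n + \sum_(i < n) (char_poly B)`_i * a ^+ i * b ^+ (n - i).
Proof.
transitivity (hom_eval n (char_poly B) a b); last first.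
  rewrite /hom_eval big_ord_recr /= subnn mulr1 addrC; congr (_ + _).
  have := monicP (char_poly_monic B); rewrite lead_coefE size_char_poly => ->.
  by rewrite mul1r.
rewrite /char_poly /determinant /hom_eval.
under [RHS]eq_bigr do rewrite coef_sum !mulr_suml.
rewrite exchange_big; apply: eq_bigr => s _ /=.
set sg := _ ^+ _; rewrite -/(perm.fun_of_perm s); move: (perm.fun_of_perm s) => f.
have := hom_eval_prod (fun i => (i == f i)%:R) (fun i => - B i (f i)) a b.
rewrite /hom_eval => E.
have -> : \prod_i (a%:M - b *: B) i (f i) =
    \prod_i ((i == f i)%:R * a + - B i (f i) * b).
  apply: eq_bigr => i _; rewrite !mxE mulNr [b * _]mulrC; congr (_ - _).
  exact: (esym (mulr_natl _ _)).
rewrite -E mulr_sumr; apply: eq_bigr => i _.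
have -> : \prod_j char_poly_mx B j (f j) =
    \prod_j ((j == f j)%:R *: 'X + (- B j (f j))%:P).
  by apply: eq_bigr => j _; rewrite !mxE polyCN scaler_nat.
have -> : (-1) ^+ perm.odd_perm s = sg%:P by rewrite /sg rmorphXn rmorphN1.
by rewrite coefCM !mulrA.
Qed.

Section Uniformizer.
Variables (k : fieldType) (A : comNzRingType) (eps : {rmorphism A -> k}).
Variables (p : set A) (r : nat) (y : 'I_r -> A).
Hypothesis pp : prime_ideal p.
Hypothesis peps : forall a, p a -> eps a = 0.
Hypothesis yeps : forall j, eps (y j) = 0.
Hypothesis ygen : forall a, eps a = 0 -> exists b, a = \sum_j b j * y j.
Hypothesis pnz : exists2 a, eps a = 0 & ~ p a.
Hypothesis dim1 : forall q : set A, prime_ideal q -> p `<=` q ->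
  (forall a, q a -> eps a = 0) -> q `<=` p \/ forall a, eps a = 0 -> q a.
Hypothesis normal : forall a b, ~ p b -> forall n (c : 'I_n -> A),
  p (a ^+ n + \sum_(i < n) c i * a ^+ i * b ^+ (n - i)) ->
  exists S Q, eps S != 0 /\ p (S * a - Q * b).

Let p0 : p 0. Proof. exact: prime_ideal0. Qed.
Let pD a b : p a -> p b -> p (a + b). Proof. exact: prime_idealD. Qed.
Let pM a b : p b -> p (a * b). Proof. exact: prime_idealM. Qed.
Let pI : is_ideal p. Proof. by split. Qed.

(* Divisibility in the localization of A / p at the kernel of eps. *)
Definition loc_divides a b : Prop := exists S Q, eps S != 0 /\ p (S * b - Q * a).

Lemma loc_dividesM a b c : loc_divides a b -> loc_divides a (c * b).
Proof.
move=> [S [Q [S0 pSQ]]]; exists S, (c * Q); split=> //.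
have -> : S * (c * b) - c * Q * a = c * (S * b - Q * a) by ring.
exact: pM.
Qed.

Lemma loc_divides_p a b : p b -> loc_divides a b.
Proof. by move=> pb; exists 1, 0; rewrite rmorph1 oner_neq0 mul1r mul0r subr0. Qed.

(* Otherwise a prime containing a0 and avoiding y j would lie strictly between
   p and the kernel of eps. *)
Lemma loc_divides_power a0 j : ~ p a0 -> eps a0 = 0 ->
  exists N, loc_divides a0 (y j ^+ N).
Proof.
move=> na0 ea0; apply: contrapT => nN.
have [//|//|//|//| | | |//| | |P [JP _ PM [P0 PD PMul] PP]] := @prime_avoiding A setT
    [set b | exists Q, p (b - Q * a0)]
    [set b | exists S N, eps S != 0 /\ b = S * y j ^+ N].
- by exists 0; rewrite mul0r subr0.
- move=> b b' [Q pb] [Q' pb']; exists (Q + Q').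
  by rewrite mulrDl opprD addrACA; exact: pD.
- by move=> a b _ [Q pb]; exists (a * Q); rewrite -mulrA -mulrBr; exact: pM.
- by exists 1, 0%N; rewrite rmorph1 oner_neq0 mulr1.
- move=> _ _ [S [N [S0 ->]]] [S' [N' [S0' ->]]]; exists (S * S'), (N + N')%N.
  by rewrite rmorphM mulf_neq0 // exprD mulrACA.
- by move=> b [Q pb] [S [N [S0 bE]]]; apply: nN; exists N, S, Q; rewrite -bE.
have PE : prime_ideal P.
  split=> //; first by move=> a b; exact: PMul.
    by move=> /PM; apply; exists 1, 0%N; rewrite rmorph1 oner_neq0 mulr1.
  by move=> a b; exact: PP.
have pP : p `<=` P by move=> b pb; apply: JP; exists 0; rewrite mul0r subr0.
have Pe a : P a -> eps a = 0.
  move=> Pa; apply/eqP; apply: contrapT => /negP ea; apply: (PM a) => //.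
  by exists a, 0%N; rewrite mulr1.
have [h|h] := dim1 PE pP Pe.
  by apply: na0; apply: h; apply: JP; exists 1; rewrite mul1r subrr.
apply: (PM (y j)); first exact: h.
by exists 1, 1%N; rewrite rmorph1 oner_neq0 mul1r.
Qed.

(** A nonzero element of the socle of the local ring modulo [a0]: starting from 1, multiply by each
    y_j in turn as often as the product stays outside the ideal of [a0]. *)
Lemma exists_socle a0 : ~ p a0 -> eps a0 = 0 ->
  exists b, ~ loc_divides a0 b /\ forall j, loc_divides a0 (y j * b).
Proof.
move=> na0 ea0.
suff: forall m, exists b, ~ loc_divides a0 b /\
    forall j : 'I_r, (j < m)%N -> loc_divides a0 (y j * b).
  by move=> /(_ r)[b [nb bP]]; exists b; split=> // j; exact: bP.
elim=> [|m [b [nb bP]]].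
  exists 1; split=> // -[S [Q [S0]]]; rewrite mulr1 => /peps.
  rewrite rmorphB rmorphM ea0 mulr0 subr0 => e; by rewrite e eqxx in S0.
have [rm|mr] := leqP r m.
  exists b; split=> // j _; apply: bP; exact: leq_trans (ltn_ord j) rm.
pose j0 := Ordinal mr.
have [N hN] := loc_divides_power j0 na0 ea0.
have : exists N, `[< loc_divides a0 (y j0 ^+ N * b) >].
  by exists N; apply/asboolP; rewrite mulrC; exact: loc_dividesM.
move=> /ex_minnP[[|M] /asboolP hM minM]; first by rewrite mul1r in hM.
exists (y j0 ^+ M * b); split=> [h|j].
  by have := minM M (asboolT h); rewrite ltnn.
rewrite ltnS leq_eqVlt => /orP[/eqP jm|jm].
  have -> : j = j0 by exact: val_inj.
  by rewrite mulrA -exprS.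
by rewrite mulrCA; apply: loc_dividesM; exact: bP.
Qed.

Lemma common_denominator (I : finType) (F : I -> A -> A -> Prop) :
  (forall i, exists S Q, eps S != 0 /\ F i S Q) ->
  (forall i S Q c, F i S Q -> F i (c * S) (c * Q)) ->
  exists S, eps S != 0 /\ forall i, exists Q, F i S Q.
Proof.
move=> h FM; have /choice[S SP] := h.
exists (\prod_i S i); split.
  by rewrite rmorph_prod; apply/prodf_neq0 => i _; have [Q []] := SP i.
move=> i; have [Q [_ FQ]] := SP i; rewrite (bigD1 i) //= mulrC.
by eexists; apply: FM; exact: FQ.
Qed.

(* The maximal ideal is principal: if a0 divides b m but not b, and b m / a0 were
   contained in m, then b / a0 would be integral by the determinant trick. *)
Lemma exists_uniformizer : exists j0, ~ p (y j0) /\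
  exists S, eps S != 0 /\ forall j, exists Q, p (S * y j - Q * y j0).
Proof.
have [a0 [ja na0]] : exists a0, (exists j, a0 = y j) /\ ~ p a0.
  apply: contrapT => h; have [a /ygen[b ->]] := pnz; apply.
  apply: ideal_sum => // j; apply: pM; apply: contrapT => nj; apply: h.
  by exists (y j); split=> //; exists j.
have ea0 : eps a0 = 0 by case: ja => j ->.
have [b [nb bP]] := exists_socle na0 ea0.
have [] := @common_denominator _ (fun j S Q => p (S * (y j * b) - Q * a0)) bP.
  by move=> j S Q c h; rewrite -!mulrA -mulrBr; exact: pM.
move=> S [S0 /choice[Q QP]].
have np S' : eps S' != 0 -> ~ p S' by move=> /eqP h /peps.
have [j0 Qj0] : exists j0, eps (Q j0) != 0.
  apply: contrapT => nQ.
  have /choice[B BP] : forall l, exists b', Q l = \sum_j b' j * y j.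
    by move=> l; apply: ygen; apply/eqP; apply: contrapT => /negP h; apply: nQ; exists l.
  pose M : 'M[A]_r := (S * b)%:M - a0 *: (\matrix_(l, j) B l j).
  pose Y : 'cV[A]_r := \col_j y j.
  have MY l : p ((M *m Y) l 0).
    have -> : (M *m Y) l 0 = S * (y l * b) - Q l * a0.
      rewrite mulmxBl mul_scalar_mx -scalemxAl !mxE BP; congr (_ - _); first by ring.
      rewrite mulrC; congr (_ * _); apply: eq_bigr => j _; by rewrite !mxE.
    exact: QP.
  have dY j : p (\det M * y j).
    have -> : \det M * y j = (\adj M *m (M *m Y)) j 0.
      by rewrite mulmxA mul_adj_mx mul_scalar_mx !mxE.
    rewrite mxE; apply: ideal_sum => // l; exact/pM/MY.
  have [j aE] := ja.
  have /(prime_idealP pp)[|] : p (\det M * y j) by [].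
    rewrite det_hom => /(normal na0)[S' [Q' [S0' h]]]; apply: nb.
    by exists (S' * S), Q'; rewrite rmorphM mulf_neq0 // -mulrA.
  by rewrite -aE.
(* Cancelling S b, which is not in [p]. As Q_j0 is a unit, every y_j is then a multiple of y_j0 in
   the local ring. *)
have key j : p (Q j0 * y j - Q j * y j0).
  have : p ((S * b) * (Q j0 * y j - Q j * y j0)).
    have -> : (S * b) * (Q j0 * y j - Q j * y j0) =
      Q j0 * (S * (y j * b) - Q j * a0) + (- Q j) * (S * (y j0 * b) - Q j0 * a0).
      by ring.
    by apply: pD; exact: pM.
  move=> /(prime_idealP pp)[/(prime_idealP pp)[/(np _ S0)//|pb]|//].
  by case: nb; exact: loc_divides_p.
exists j0; split.
  move=> pj0; have [j aE] := ja; apply: na0; rewrite aE.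
  have : p (Q j0 * y j).
    rewrite -(subrK (Q j * y j0) (Q j0 * y j)); apply: pD; [exact: key|exact: pM].
  by move=> /(prime_idealP pp)[/(np _ Qj0)|].
by exists (Q j0); split=> // j; exists (Q j); exact: key.
Qed.

End Uniformizer.

(** * Affine charts of a projective scheme *)

Lemma closure_irreducible (X : topologicalType) (x : X) :
  irreducible_set (closure [set x]).
Proof.
split=> [|F G cF cG sub]; first by exists x; exact: subset_closure.
have cl (H : set X) : closed H -> H x -> closure [set x] `<=` H.
  by move=> cH Hx; rewrite closureE; apply: smallest_sub => // y ->.
have [Fx|Gx] := sub x (subset_closure erefl); [left|right]; exact: cl.
Qed.

Lemma closure1_open (X : topologicalType) (x y : X) (U : set X) :
  open U -> closure [set x] y -> U y -> U x.
Proof.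
move=> oU xy Uy; have [z [-> //]] := xy U (open_nbhs_nbhs (conj oU Uy)).
Qed.

(* A closed immersion into a scheme, near an affine open U whose ring of sections
   is generated over k by finitely many elements. *)
Section Chart.
Variables (k : fieldType) (D Y : kscheme k) (i : morphism D Y) (U : opens Y).
Hypotheses (ik : over_k i) (ci : closed_immersion i) (aU : affine U).
Variables (r : nat) (pT : {rmorphism {mpoly k[r]} -> sec Y U}).
Hypothesis pTC : forall c, pT c%:MP = kconst U c.
Hypothesis pT_surj : forall s, exists q, s = pT q.

Definition chart_poly : {rmorphism {mpoly k[r]} -> sec D (mpreim i U)} :=
  comor i U \o pT.
Local Notation pe := chart_poly.
Local Notation U0 := (mpreim i U).

Lemma chart_polyC c : pe c%:MP = kconst U0 c.
Proof. by rewrite /= pTC ik. Qed.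

Lemma chart_poly_unit q y : U0 y -> germ_unit (pe q) y <-> germ_unit (pT q) (i y).
Proof. exact: comor_unit. Qed.

Lemma chart_inj y y' : U0 y -> U0 y' ->
  (forall q, germ_unit (pe q) y <-> germ_unit (pe q) y') -> y = y'.
Proof.
move=> Uy Uy' h; apply: (cimm_inj ci); apply: (affine_point_inj aU Uy Uy') => s.
have [q ->] := pT_surj s; rewrite -(chart_poly_unit q Uy) -(chart_poly_unit q Uy').
exact: h.
Qed.

Lemma chart_basis (N : opens D) y : N y -> U0 y ->
  exists G, basic_open (pe G) y /\ basic_open (pe G) `<=` N.
Proof.
move=> Ny Uy; have [V VN] := cimm_embed ci N.
have Vy : V (i y) by have : (i @^-1` V) y by rewrite VN.
have [s [sy sV]] := affine_basis aU (fun z (h : opensI U V z) => h.1) (conj Uy Vy).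
have [G sE] := pT_surj s; exists G; split.
  by split=> //; apply/(chart_poly_unit G Uy); rewrite -sE; case: sy.
move=> z [Uz /(chart_poly_unit G Uz) Gz]; rewrite -VN.
by have [|//] := sV (i z); split=> //; rewrite sE.
Qed.

(** Surjectivity on stalks lifts the germ to Y, where sections near a point of the affine [U] are
    fractions of polynomials in the generators. *)
Lemma chart_fraction (N : opens D) (s : sec D N) y : N y -> U0 y ->
  exists (G Q : {mpoly k[r]}) (h : basic_open (pe G) `<=` N),
    basic_open (pe G) y /\
    res (@basic_open_sub D U0 (pe G)) (pe G) * res h s =
    res (@basic_open_sub D U0 (pe G)) (pe Q).
Proof.
move=> Ny Uy; have [V [s' [W [hN [hV [Wy sE]]]]]] := cimm_surj ci s Ny.
have Viy : V (i y) := hV y Wy.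
have [g [a [n [h [gy E]]]]] := affine_fraction s' aU Uy Viy.
have [g' gE] := pT_surj g; have [a' aE] := pT_surj a.
pose N' := opensI W (mpreim i (basic_open g)).
have [G1 [G1y G1N]] := chart_basis (N := N') (conj Wy gy) Uy.
have Gy : basic_open (pe (G1 * g' ^+ n)) y.
  split=> //; rewrite rmorphM; apply/germ_unitM; split; first by case: G1y.
  rewrite rmorphXn; apply: germ_unitX => //; apply/(chart_poly_unit g' Uy).
  by rewrite -gE; case: gy.
have hG1 : basic_open (pe (G1 * g' ^+ n)) `<=` N'.
  move=> z [Uz]; rewrite rmorphM => /germ_unitM[G1z _]; exact: G1N.
have hGN : basic_open (pe (G1 * g' ^+ n)) `<=` N by move=> z /hG1[Wz _]; exact: (hN z Wz).
exists (G1 * g' ^+ n), (G1 * a'), hGN; split=> //.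
set B := basic_open _ in Gy hG1 hGN *; set hB := @basic_open_sub _ _ _.
have hBg : B `<=` mpreim i (basic_open g) by move=> z /hG1[].
have hgU : mpreim i (basic_open g) `<=` U0 by move=> z [].
have hgV : mpreim i (basic_open g) `<=` mpreim i V by move=> z gz; exact: (h _ gz).
have hBW : B `<=` W by move=> z /hG1[].
have hBV : B `<=` mpreim i V := subset_trans hBW hV.
have := congr1 (fun u => res hBg (comor i (basic_open g) u)) E.
rewrite rmorphM rmorphXn !(comor_res _ hgU) (comor_res _ hgV).
rewrite (rmorphM (res hBg)) (rmorphXn (res hBg)).
rewrite !(res_comp hgU hBg hB) (res_comp hgV hBg hBV) -(res_comp hV hBW hBV) sE.
rewrite (res_comp hN hBW hGN) gE aE => e.
by rewrite !rmorphM !rmorphXn -mulrA e.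
Qed.

Lemma chart_rational y (xi : 'I_r -> k) : U0 y ->
  (forall q, meval xi q != 0 <-> germ_unit (pe q) y) -> rational_points D y.
Proof.
move=> Uy xiP.
apply: (@fraction_rational k D y U0 _ pe (meval xi) (mpolyC r (R := k))) => //.
- exact: chart_polyC.
- by move=> c; exact: mevalC.
move=> W s Wy; have [G [Q [h [Gy E]]]] := chart_fraction s Wy Uy.
exists G, Q, (basic_open (pe G)), h, (@basic_open_sub D U0 (pe G)).
by split=> //; case: Gy.
Qed.

Hypothesis hD : integral_scheme D.

Definition chart_ideal : set {mpoly k[r]} := [set q | pe q = 0].
Local Notation p := chart_ideal.

Lemma chart_unitP q : ~ p q -> exists y, basic_open (pe q) y.
Proof.
move=> pq; apply: contrapT => h; apply: pq; have [_ rD] := hD.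
apply: (nowhere_unit_eq0 rD) => y qy; apply: h; exists y; split=> //.
exact: germ_unit_dom qy.
Qed.

(** The prime is a point of [U]. Were it outside the closed image of D, some G outside [q] would be
    a unit nowhere on D, hence lie in the ideal of the chart, which is contained in [q]. *)
Lemma chart_point (q : set {mpoly k[r]}) : prime_ideal q -> p `<=` q ->
  exists y, U0 y /\ forall f, germ_unit (pe f) y <-> ~ q f.
Proof.
move=> pq sub.
pose Q := [set s : sec Y U | exists2 f, s = pT f & q f].
have QE f : Q (pT f) <-> q f.
  split=> [[g /esym fg qg]|qf]; last by exists f.
  rewrite -(subrK g f); apply: (prime_idealD pq) => //; apply: sub.
  by rewrite /p /= rmorphB fg subrr rmorph0.
have pQ : prime_ideal Q.
  split.
  - by rewrite -(rmorph0 pT); apply/QE; exact: prime_ideal0.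
  - move=> a b; have [f ->] := pT_surj a; have [g ->] := pT_surj b.
    by move=> /QE qf /QE qg; rewrite -rmorphD; apply/QE; exact: prime_idealD.
  - move=> a b; have [f ->] := pT_surj a; have [g ->] := pT_surj b.
    by move=> /QE qg; rewrite -rmorphM; apply/QE; exact: prime_idealM.
  - by rewrite -(rmorph1 pT) => /QE; exact: prime_ideal1.
  - move=> a b; have [f ->] := pT_surj a; have [g ->] := pT_surj b.
    by rewrite -rmorphM => /QE/(prime_idealP pq)[h|h]; [left|right]; apply/QE.
have [z [[Uz Qz] _]] := affine_bij aU pQ.
have zP f : germ_unit (pT f) z <-> ~ q f.
  rewrite -QE Qz /=; split=> [h|/contrapT//]; exact.
have [y _ yz] : range i z.
  apply: contrapT => nz.
  have oV : open (~` range i) by exact/closed_openC/(cimm_closed ci).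
  have [s [sz sV]] := affine_basis aU (fun t (h : opensI U (Opens oV) t) => h.1)
    (conj Uz nz).
  have [G sE] := pT_surj s; have : ~ q G by apply/zP; rewrite -sE; case: sz.
  apply; apply: sub; apply: contrapT => /chart_unitP[y [Uy Gy]].
  have [|_] := sV (i y); last by apply; exists y.
  by split=> //; rewrite sE; apply/(chart_poly_unit G Uy).
have Uy : U0 y by rewrite /= /preimage /= yz.
by exists y; split=> // f; rewrite (chart_poly_unit f Uy) yz.
Qed.

Variables (P : D) (ev : {rmorphism sec D U0 -> k}).
Hypotheses (UP : U0 P) (evP : value_at ev P).

Lemma chart_ideal_prime : prime_ideal p.
Proof.
split; rewrite /p /mkset.
- exact: rmorph0.
- by move=> a b ea eb; rewrite rmorphD ea eb addr0.
- by move=> a b eb; rewrite rmorphM eb mulr0.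
- rewrite rmorph1 => /(congr1 ev)/eqP; by rewrite rmorph1 rmorph0 oner_eq0.
- by move=> a b; rewrite rmorphM => /(integral_mul0 hD).
Qed.

Definition chart_eps : {rmorphism {mpoly k[r]} -> k} := ev \o pe.
Local Notation eps := chart_eps.

Lemma chart_epsC c : eps c%:MP = c.
Proof. by rewrite /= pTC ik; case: evP. Qed.

Lemma chart_eps_unit f : eps f != 0 <-> germ_unit (pe f) P.
Proof. by have [_ evu] := evP; exact: (evu (pe f)). Qed.

Lemma chart_eps_ideal f : p f -> eps f = 0.
Proof. by rewrite /p /mkset => pf; rewrite /eps /= -[comor i U (pT f)]/(pe f) pf rmorph0. Qed.

Lemma chart_near0 (N : opens D) y (h : N `<=` U0) f : N y -> res h (pe f) = 0 -> p f.
Proof. exact: integral_res0. Qed.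

Lemma chart_normal : normal_at P -> forall a b, ~ p b ->
  forall n (c : 'I_n -> {mpoly k[r]}),
  p (a ^+ n + \sum_(j < n) c j * a ^+ j * b ^+ (n - j)) ->
  exists S Q, eps S != 0 /\ p (S * a - Q * b).
Proof.
move=> nP a b pb n c pc.
have gb : ~ germ_zero (pe b) P.
  by move=> [V [h [VP /(integral_res0 hD VP) pb0]]]; apply: pb.
have [|V [h [d [VP E]]]] := normal_closed nP (a := pe a) UP gb (n := n)
    (c := fun j => pe (c j)).
  exists U0, (@subset_refl _ U0); split=> //.
  rewrite res_id -[RHS]pc rmorphD rmorphXn rmorph_sum; congr (_ + _).
  by apply: eq_bigr => j _; rewrite !rmorphM !rmorphXn.
have [G [Q [h' [GP EQ]]]] := chart_fraction d VP UP.
exists G, Q; split; first by apply/chart_eps_unit; case: GP.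
apply: (chart_near0 (h := @basic_open_sub D U0 (pe G)) GP).
rewrite !(rmorphB, rmorphM) -EQ.
rewrite -!(res_comp h h' (@basic_open_sub D U0 (pe G))) E rmorphM; ring.
Qed.

(** A prime strictly between the ideal of the chart and the kernel of [eps] would be a point x with
    closures of P and of x and the whole of D forming a chain of length 2. *)
Lemma chart_dim1 : krull_dim D 1 -> forall q, prime_ideal q -> p `<=` q ->
  (forall a, q a -> eps a = 0) -> q `<=` p \/ forall a, eps a = 0 -> q a.
Proof.
move=> [_ nchain] q pq sub qe.
have [x [Ux xP]] := chart_point pq sub.
apply: contrapT => /not_orP[nqp nme]; apply: nchain.
have Px : closure [set x] P.
  move=> B /=; rewrite nbhsE => -[N [oN NP] NB].
  have [G [GP GN]] := chart_basis (N := Opens oN) NP UP.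
  exists x; split=> //; apply: NB; apply: GN; split=> //; apply/xP => /qe/eqP.
  by move=> h; have /chart_eps_unit := GP.2; rewrite h.
have clsub : closure [set P] `<=` closure [set x].
  by rewrite closureE; apply: smallest_sub; [exact: closed_closure|move=> _ ->].
exists (fun j => match j with 0 => closure [set P] | 1 => closure [set x]
  | _ => setT end); split=> [[|[|j]] _|[|[|j]] // _].
- by split; [exact: closed_closure|exact: closure_irreducible].
- by split; [exact: closed_closure|exact: closure_irreducible].
- by split; [exact: closedT|case: hD].
- split=> // back; move/existsNP: nme => [f /not_implyP[ef qf]].
  have xf : germ_unit (pe f) x by apply/xP.
  have : basic_open (pe f) P.
    apply: (closure1_open (open_oset _) (back x (subset_closure erefl))).
    by split.
  by move=> [_ /chart_eps_unit]; rewrite ef eqxx.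
- split=> // back; move/existsNP: nqp => [f /not_implyP[qf pf]].
  have [y fy] := chart_unitP pf.
  have [_ /xP] : basic_open (pe f) x by apply: (closure1_open (open_oset _) (back y Logic.I)).
  exact.
Qed.

(** Otherwise the chart is the single point P. Let Z0 be the smaller set of a chain of length 1. If
    it contains P, irreducibility makes it all of D; if not, a point y of it has P in all its
    neighbourhoods, and evaluation at P shows that the same sections are units at both points, so y
    = P. *)
Lemma chart_maximal_neq : rational_points D P -> krull_dim D 1 ->
  exists2 a, eps a = 0 & ~ p a.
Proof.
move=> rP [[Z [Zci Zlt]] _]; apply: contrapT => h.
have ep f : eps f = 0 -> p f.
  by move=> ef; apply: contrapT => pf; apply: h; exists f.
have single y : U0 y -> y = P.
  move=> Uy; apply: chart_inj => // q.
  have /ep : eps (q - (eps q)%:MP) = 0 by rewrite rmorphB chart_epsC subrr.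
  rewrite /p /mkset rmorphB chart_polyC => /eqP; rewrite subr_eq0 => /eqP ->.
  by rewrite !kconst_unit.
have [Z0c [[y Z0y] _]] := Zci 0%N isT; have [Z01 nZ01] := Zlt 0%N isT.
have [[_ irr] _] := hD.
have [Z0P|nZ0P] := pselect (Z 0%N P).
  have cU : closed (~` (U0 : set D)) by exact/open_closedC/open_oset.
  have [||z _|ZT|UT] := irr (Z 0%N) (~` (U0 : set D)) => //.
  - by have [Uz|] := pselect (U0 z); [left; rewrite (single z Uz)|right].
  - by apply: nZ01 => z _; exact: ZT.
  - exact: (UT P Logic.I).
have [V [aV Vy]] := scheme_affine y.
have meet (W : opens D) z : W z -> W P.
  move=> Wz; have [t [Ut Wt]] := integral_openI hD (open_oset U0) (open_oset W)
    (ex_intro _ P UP) (ex_intro _ z Wz).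
  by rewrite -(single t Ut).
have VP : V P by exact: meet Vy.
have [e eP] := rational_value rP VP.
apply: nZ0P; have <- : y = P; last by [].
have unit_P (s : sec D V) : germ_unit s y -> germ_unit s P.
  by move=> sy; have [] := meet (basic_open s) y (conj Vy sy).
apply: (affine_point_inj aV) => // s; split; first exact: unit_P.
move=> sP; have nP := value_nonunit (s := s) eP.
have ny : ~ germ_unit (s - kconst V (e s)) y by move/unit_P.
by apply/(germ_unit_near Vy ny); apply/(kconst_unit _ Vy); apply/eP.2.
Qed.

End Chart.

(** The universal property gives a map g from the sections back to polynomials, and its uniqueness
    part shows that g followed by [pT] is the identity. *)
Lemma proj_space_generated (k : fieldType) (Y : kscheme k) n : is_proj_space Y n ->
  exists (U : 'I_n.+1 -> opens Y)
         (pT : forall j, {rmorphism {mpoly k[n.+1]} -> sec Y (U j)}),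
  [/\ forall x, exists j, U j x, forall j, affine (U j),
      forall j c, pT j c%:MP = kconst (U j) c &
      forall j s, exists q, s = pT j q].
Proof.
move=> [U [t [cov aff univ _ _]]].
have /all_sig[pT pTP] j : {e : {rmorphism {mpoly k[n.+1]} -> sec Y (U j)} |
    (forall c, e c%:MP = kconst (U j) c) /\ forall l, e 'X_l = t j l}.
  by apply: cid; exact: (mpoly_hom (kconstr (U j)) (t j)).
exists U, pT; split=> // [j|j s]; first by have [] := pTP j.
have [tjj tj] := univ j; have [pTC pTX] := pTP j.
(* The index j must go to 1, since t_jj = 1. *)
pose a (l : 'I_n.+1) : {mpoly k[n.+1]} := if l == j then 1 else 'X_l.
have [|[g [gk gt]] _] := tj _ (mpolyC n.+1 (R := k)) a; first by rewrite /a eqxx.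
have [_ uniq] := tj _ (kconstr (U j)) (t j) tjj.
exists (g s).
apply: (uniq idfun (pT j \o g)) => [c|l] /=; first by rewrite gk pTC.
by rewrite gt /a; case: eqVneq => [->|_]; rewrite ?rmorph1.
Qed.

Lemma value_hom (k : fieldType) n (e e' : {rmorphism {mpoly k[n]} -> k}) :
  (forall c, e c%:MP = c) -> (forall c, e' c%:MP = c) ->
  (forall q, e q = 0 -> e' q = 0) -> e =1 e'.
Proof.
move=> ek e'k h q; have /h/eqP : e (q - (e q)%:MP) = 0.
  by rewrite rmorphB ek subrr.
by rewrite rmorphB e'k subr_eq0 => /eqP.
Qed.

Lemma hom_meval (k : fieldType) n (e : {rmorphism {mpoly k[n]} -> k}) :
  (forall c, e c%:MP = c) -> e =1 meval (fun j => e 'X_j).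
Proof.
move=> ek; apply: mpoly_hom_ext => [c|j]; first by rewrite ek; exact/esym/mevalC.
exact/esym/mevalXU.
Qed.

Lemma rational_points_embeds (k : fieldType) (D : kscheme k) :
  infinite_set [set: k] -> projective D -> embeds (rational_points D) [set: k].
Proof.
move=> kinf [n [Y [i [/proj_space_generated[U [pT [cov aff pTC pTs]]] ik ci]]]].
pose H (x : D) (jv : ('I_n.+1 * ('I_n.+1 -> k))) := U jv.1 (i x) /\
  forall q, meval jv.2 q != 0 <-> germ_unit (chart_poly i (pT jv.1) q) x.
have : embeds (rational_points D) [set: 'I_n.+1 * ('I_n.+1 -> k)].
  apply: (@graph_embeds _ _ _ _ (fun w => H w.1 w.2)).
  - move=> x rx; have [j Uj] := cov (i x).
    have [e [ek eu]] := rational_value (U := mpreim i (U j)) rx Uj.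
    exists (j, fun l => e (chart_poly i (pT j) 'X_l)); first by [].
    split=> // q; rewrite -(eu (chart_poly i (pT j) q)).
    rewrite -(@hom_meval k n.+1 (e \o chart_poly i (pT j))) // => c.
    by rewrite /= pTC ik.
  - move=> x x' [j v] [/= Ux xP] [/= Ux' xP'].
    by apply: (chart_inj ci (aff j) (pTs j) Ux Ux') => q; rewrite -xP -xP'.
  - exact: (ord0, fun=> 0).
move=> /embeds_trans; apply.
apply: embeds_trans (embeds_ffun (n.+1 + n.+1) kinf).
(* A chart and its coordinates become one vector over k: the indicator of the chart index, followed
   by the coordinates. *)
exists (fun jv l => match fintype.split l with
  | inl l => (l == jv.1)%:R | inr l => jv.2 l end); split=> // -[j v] [j' v'] _ _ /= E.
congr pair.
  have := congr1 (fun g => g (lshift n.+1 j)) E.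
  rewrite -[lshift _ _]/(unsplit (inl j)) unsplitK eqxx.
  by case: eqVneq => // _ /eqP; rewrite oner_eq0.
apply/funext => l; have := congr1 (fun g => g (rshift n.+1 l)) E.
by rewrite -[rshift _ _]/(unsplit (inr l)) unsplitK.
Qed.

(** * The system attached to a rational point of a curve *)

Section Unknowns.
Variable r : nat.

(** The unknowns stand for the uniformizer t, the r coordinates x_l of the chart and the inverse s
    of a common denominator. *)
Definition unk_t : 'I_r.+2 := ord0.
Definition unk_x (l : 'I_r) : 'I_r.+2 := lift ord0 (lift ord_max l).
Definition unk_s : 'I_r.+2 := lift ord0 ord_max.

Definition unknowns (T : Type) (t : T) (x : 'I_r -> T) (s : T) (i : 'I_r.+2) : T :=
  if unlift ord0 i is Some j then
    if unlift ord_max j is Some l then x l else s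
  else t.

Variables (T : Type) (t : T) (x : 'I_r -> T) (s : T).

Lemma unknowns_t : unknowns t x s unk_t = t.
Proof. by rewrite /unknowns unlift_none. Qed.
Lemma unknowns_x l : unknowns t x s (unk_x l) = x l.
Proof. by rewrite /unknowns !liftK. Qed.
Lemma unknowns_s : unknowns t x s unk_s = s.
Proof. by rewrite /unknowns liftK unlift_none. Qed.

Lemma unk_ind (P : 'I_r.+2 -> Prop) :
  P unk_t -> (forall l, P (unk_x l)) -> P unk_s -> forall i, P i.
Proof.
move=> Pt Px Ps i; have [j ->|->] := unliftP ord0 i; last exact: Pt.
by have [l ->|->] := unliftP ord_max j; [exact: Px|exact: Ps].
Qed.

End Unknowns.

Lemma value_res (k : fieldType) (X : kscheme k) (U V : opens X) (h : V `<=` U) x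
    (e : {rmorphism sec X V -> k}) : V x -> value_at e x -> value_at (e \o res h) x.
Proof.
move=> Vx [ek eu]; split=> [c|s] /=; first by rewrite res_kconst.
by rewrite eu germ_unit_res.
Qed.

Lemma mpoly_shift_gen (k : fieldType) r (c : 'I_r -> k) (f : {mpoly k[r]}) :
  exists b, f = (meval c f)%:MP + \sum_j b j * ('X_j - (c j)%:MP).
Proof.
elim/mpoly_alg_ind: f => [a|j|f g [b fE] [b' gE]|f g [b fE] [b' gE]].
- by exists (fun=> 0); rewrite mevalC big1 ?addr0 // => j _; rewrite mul0r.
- exists (fun l => (l == j)%:R); rewrite mevalXU (bigD1 j) //= eqxx mul1r big1.
    by rewrite addr0 addrC subrK.
  by move=> l /negPf->; rewrite mul0r.
- exists (fun l => b l + b' l); rewrite {1}fE {1}gE mevalD mpolyCD addrACA.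
  by rewrite -big_split; congr (_ + _); apply: eq_bigr => l _; rewrite mulrDl.
- exists (fun l => b l * g + (meval c f)%:MP * b' l).
  have -> : \sum_l (b l * g + (meval c f)%:MP * b' l) * ('X_l - (c l)%:MP) =
      (\sum_l b l * ('X_l - (c l)%:MP)) * g +
      (meval c f)%:MP * \sum_l b' l * ('X_l - (c l)%:MP).
    rewrite mulr_suml mulr_sumr -big_split; apply: eq_bigr => l _ /=; ring.
  rewrite {1}fE mulrDl mevalM mpolyCM {1}gE; ring.
Qed.

(** Brings the inverse of S into the shape required by a system: 1/S = 1/s0 - (S - s0) / (s0 S),
    where S - s0 = E T / S is a multiple of T. *)
Lemma sigma_equation (A : comPzRingType) (S s0 i0 sg B E T : A) :
  sg * S = 1 -> i0 * s0 = 1 -> S = s0 + B -> S * B = E * T ->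
  sg = i0 + T * - (i0 * (sg * sg * E)).
Proof.
move=> sS i0s SE SB; have -> : T * - (i0 * (sg * sg * E)) = - (i0 * sg * (sg * (E * T))).
  by ring.
rewrite -SB [sg * (S * B)]mulrA sS mul1r.
have -> : B = S - s0 by rewrite SE; ring.
rewrite mulrBr -[i0 * sg * S]mulrA sS mulr1.
have -> : i0 * sg * s0 = i0 * s0 * sg by ring.
by rewrite i0s; ring.
Qed.

Section ChartSystem.
Variables (k : fieldType) (D Y : kscheme k) (i : morphism D Y) (U : opens Y).
Hypotheses (ik : over_k i) (ci : closed_immersion i) (aU : affine U).
Variables (r : nat) (pT : {rmorphism {mpoly k[r]} -> sec Y U}).
Hypothesis pTC : forall c, pT c%:MP = kconst U c.
Hypothesis pT_surj : forall s, exists q, s = pT q.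
Hypotheses (hD : integral_scheme D) (dimD : krull_dim D 1).
Variable P : D.
Hypotheses (UP : mpreim i U P) (rP : rational_points D P) (nP : normal_at P).
Variables (N : opens D) (NP : N P) (n : nat) (M : 'M[sec D N]_n).
Hypothesis M_P : forall a b, ~ germ_unit (M a b) P.

Local Notation pe := (chart_poly i pT).
Local Notation U0 := (mpreim i U).
Local Notation p := (chart_ideal i pT).

Let fraction (s : sec D N) (G Q : {mpoly k[r]}) :=
  exists h : basic_open (pe G) `<=` N,
    res (@basic_open_sub D U0 (pe G)) (pe G) * res h s =
    res (@basic_open_sub D U0 (pe G)) (pe Q).

Lemma chart_openM G c : basic_open (pe (c * G)) `<=` basic_open (pe G).
Proof. by move=> z [Uz]; rewrite rmorphM => /germ_unitM[]. Qed.

Lemma chart_fractionM s G Q c : fraction s G Q -> fraction s (c * G) (c * Q).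
Proof.
move=> [h E].
have sub := @chart_openM G c.
have eM q : res (@basic_open_sub D U0 (pe (c * G))) (pe (c * q)) =
    res (@basic_open_sub D U0 (pe (c * G))) (pe c) *
    res (@basic_open_sub D U0 (pe (c * G))) (pe q).
  by rewrite -!rmorphM.
exists (subset_trans sub h); have := congr1 (res sub) E.
rewrite (rmorphM (res sub)) !(res_comp _ _ (@basic_open_sub D U0 (pe (c * G)))).
rewrite (res_comp _ _ (subset_trans sub h)) => E'.
by rewrite !eM -mulrA E'.
Qed.

Lemma chart_fraction_mod s G Q Q' : fraction s G Q -> p (Q - Q') -> fraction s G Q'.
Proof.
move=> [h E] pQ; exists h; rewrite E; apply/eqP; rewrite -subr_eq0 -!rmorphB.
by rewrite (_ : pe (Q - Q') = 0) ?rmorph0.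
Qed.

(** With [y0] a uniformizer, each x_l - c_l and each entry of M vanishes at P, so it is a multiple
    of [y0] in the local ring; [S] is a denominator common to all. *)
Lemma chart_denominator : exists (c : 'I_r -> k) (y0 S : {mpoly k[r]})
    (Q : 'I_r -> {mpoly k[r]}) (R : 'M[{mpoly k[r]}]_n) (e : {rmorphism sec D U0 -> k}),
  [/\ value_at e P, forall q, e (pe q) = meval c q,
      ~ p y0 /\ meval c y0 = 0, meval c S != 0 /\ basic_open (pe S) `<=` N &
      (forall l, p (S * ('X_l - (c l)%:MP) - Q l * y0)) /\
      forall a b, fraction (M a b) S (R a b * y0)].
Proof.
have [e eP] := rational_value (U := U0) rP UP; have [ek eu] := eP.
pose eps : {rmorphism {mpoly k[r]} -> k} := e \o pe.
pose c l := eps 'X_l.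
have epsC a : eps a%:MP = a by rewrite /eps /= pTC ik ek.
have epsE q : eps q = meval c q by exact: hom_meval.
pose y l : {mpoly k[r]} := 'X_l - (c l)%:MP.
have yeps l : eps (y l) = 0 by rewrite /y rmorphB epsC subrr.
have ygen a : eps a = 0 -> exists b, a = \sum_j b j * y j.
  have [b aE] := mpoly_shift_gen c a; rewrite epsE => a0.
  by exists b; rewrite {1}aE a0 mpolyC0 add0r.
have pp : prime_ideal p := chart_ideal_prime pT hD e.
have pI : is_ideal p.
  by split; [exact: prime_ideal0|exact: prime_idealD|exact: prime_idealM].
have [j0 [pj0 [S0 [S00 S0P]]]] := @exists_uniformizer k _ eps p r y pp
  (chart_eps_ideal (pT := pT) e) yeps ygen
  (chart_maximal_neq ik ci aU pTC pT_surj hD UP eP rP dimD)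
  (chart_dim1 ci aU pT_surj hD UP eP dimD)
  (chart_normal ci aU pT_surj hD UP eP nP).
(* The requirements on S: coordinates, entries of M, and D(S) inside N. *)
pose F (x : ('I_r + 'I_n * 'I_n) + unit) (S Q : {mpoly k[r]}) := match x with
  | inl (inl l) => p (S * y l - Q * y j0)
  | inl (inr ab) => fraction (M ab.1 ab.2) S (Q * y j0)
  | inr _ => basic_open (pe S) `<=` N end.
have [||S [Se SF]] := @common_denominator k _ eps _ F.
- case=> [[l|[a b]]|u] /=.
  + by have [Q pQ] := S0P l; exists S0, Q.
  + have [G [Q [h [GP E]]]] := chart_fraction ci aU pT_surj (M a b) NP UP.
    have Q0 : eps Q = 0.
      apply/eqP; apply: contrapT => /negP/eu => QP; apply: (M_P (a := a) (b := b)).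
      have /(germ_unit_res _ _ GP) := QP; move=> /(_ (@basic_open_sub D U0 (pe G))).
      by rewrite -E => /germ_unitM[_] /(germ_unit_res h _ GP).
    have [b' QE] := ygen Q Q0; have /choice[Q' Q'P] := S0P.
    have SG0 : eps (S0 * G) != 0.
      by rewrite rmorphM mulf_neq0 //; apply/eu; case: GP.
    exists (S0 * G), (\sum_l b' l * Q' l); split; first exact: SG0.
    apply: (@chart_fraction_mod _ _ (S0 * Q)); first by apply: chart_fractionM; exists h.
    rewrite QE mulr_sumr mulr_suml -sumrB; apply: ideal_sum => // l.
    have -> : S0 * (b' l * y l) - b' l * Q' l * y j0 =
      b' l * (S0 * y l - Q' l * y j0) by ring.
    exact: prime_idealM.
  + have [G [GP GN]] := chart_basis ci aU pT_surj NP UP.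
    by exists G, 0; split=> //; apply/eu; case: GP.
- move=> [[l|[a b]]|u] S Q d /=.
  + by move=> pS; rewrite -!mulrA -mulrBr; exact: prime_idealM.
  + by move=> h; rewrite -mulrA; exact: chart_fractionM.
  + exact: subset_trans (@chart_openM S d).
have /choice[Q QP] := fun l => SF (inl (inl l)).
have /choice[R RP] := fun ab => SF (inl (inr ab)).
have SN : basic_open (pe S) `<=` N by have [q h] := SF (inr tt); exact: (h).
exists c, (y j0), S, Q, (\matrix_(a, b) R (a, b)), e; split=> //.
- by rewrite -epsE yeps.
- by rewrite -epsE.
- by split=> // a b; rewrite mxE; exact: (RP (a, b)).
Qed.

(** The system is x_l = c_l + t s Q_l(x) together with [sigma_equation] for s = 1/S, and M = t s R
    explains [L]. The relation [T] keeps the value of the uniformizer, which identifies v_0 from the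
    point alone. *)
Lemma chart_system : exists (c : 'I_r.+2 -> k) (q : 'I_r.+2 -> {mpoly k[r.+2]})
    (L : 'M[{mpoly k[r.+2]}]_n) (T : D -> k -> Prop),
  [/\ c ord0 = 0, q ord0 = 1, forall x a b, T x a -> T x b -> a = b &
      forall z, ps_system c q z -> forall v, sys_point (n := r.+1) z v ->
      exists x, [/\ N x, rational_points D x, T x (v ord0) &
        forall e : {rmorphism sec D N -> k}, value_at e x ->
          forall a b, e (M a b) = v ord0 * meval v (L a b)]].
Proof.
have [c [y0 [S [Q [R [e [eP eE [py0 y0c] [Sc SN] [QP RP]]]]]]]] := chart_denominator.
pose W := basic_open (pe S); pose hW : W `<=` U0 := @basic_open_sub D U0 (pe S).
have [_ eu] := eP.
have PW : W P by split=> //; apply/eu; rewrite eE.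
have [eW eWP] := rational_value rP PW; have [eWk _] := eWP.
have eWE f : eW (res hW (pe f)) = meval c f.
  rewrite -eE; exact: (value_inj (value_res hW PW eWP) eP).
have [sg sgS] := unit_basic_open (pe S); rewrite -/hW in sgS.
pose t : sec D W := res hW (pe y0).
have [G [GC GX]] := mpoly_hom (kconstr W)
  (unknowns t (fun l => res hW (pe 'X_l)) sg).
pose emb : {rmorphism {mpoly k[r]} -> {mpoly k[r.+2]}} :=
  mmap (mpolyC r.+2 (R := k)) (fun l => 'X_(unk_x l)).
have embC a : emb a%:MP = a%:MP by exact: mmapC.
have Gt : G 'X_(unk_t r) = t by rewrite GX unknowns_t.
have Gs : G 'X_(unk_s r) = sg by rewrite GX unknowns_s.
have Gx l : G 'X_(unk_x l) = res hW (pe 'X_l) by rewrite GX unknowns_x.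
have GE f : G (emb f) = res hW (pe f).
  apply: (@mpoly_hom_ext _ _ _ (G \o emb) (res hW \o pe)) => [a|l] /=.
    by rewrite mmapC GC pTC ik res_kconst.
  by rewrite mmap_XU Gx.
have [b bE] := mpoly_shift_gen c S.
pose E := \sum_l b l * Q l.
have pE : p (S * (S - (meval c S)%:MP) - E * y0).
  have -> : S * (S - (meval c S)%:MP) - E * y0 =
      \sum_l b l * (S * ('X_l - (c l)%:MP) - Q l * y0).
    have -> : S - (meval c S)%:MP = \sum_l b l * ('X_l - (c l)%:MP).
      by rewrite {1}bE addrC addKr.
    rewrite /E mulr_sumr mulr_suml -sumrB.
    by apply: eq_bigr => l _; ring.
  apply: ideal_sum => [|l].
    have pp := chart_ideal_prime pT hD e.
    by split; [exact: prime_ideal0|exact: prime_idealD|exact: prime_idealM].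
  by apply: (prime_idealM (chart_ideal_prime pT hD e)); exact: QP.
have GpE f g h : p (f * g - h * y0) ->
    res hW (pe f) * res hW (pe g) = res hW (pe h) * t.
  move=> /(congr1 (res hW)); rewrite rmorph0 !(rmorphB, rmorphM) => /eqP.
  by rewrite subr_eq0 => /eqP.
pose c' := unknowns 0 c (meval c S)^-1.
pose q := unknowns 1 (fun l => 'X_(unk_s r) * emb (Q l))
  (- ((meval c S)^-1%:MP * ('X_(unk_s r) * 'X_(unk_s r) * emb E))).
exists c', q, (\matrix_(a, b) ('X_(unk_s r) * emb (R a b))),
  (fun x a => exists e' : {rmorphism sec D U0 -> k}, value_at e' x /\ e' (pe y0) = a).
have sys : forall j, G 'X_j = G (c' j)%:MP + G 'X_ord0 * G (q j).
  apply: unk_ind => [|l|].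
  - rewrite /c' /q !unknowns_t GC rmorph0 add0r rmorph1 mulr1; by [].
  - rewrite /c' /q !unknowns_x GC rmorphM GE Gs Gx Gt.
    have /GpE E1 := QP l.
    have -> : t * (sg * res hW (pe (Q l))) = sg * (res hW (pe (Q l)) * t) by ring.
    rewrite -E1 mulrA sgS mul1r rmorphB /= pTC ik rmorphB res_kconst.
    by rewrite addrC subrK.
  - rewrite /c' /q !unknowns_s GC Gs rmorphN !rmorphM GC GE Gs Gt.
    apply: (@sigma_equation _ (res hW (pe S)) (kconstr W (meval c S)) _ _
      (res hW (pe (S - (meval c S)%:MP)))) => //.
    + by rewrite -rmorphM mulVf // rmorph1.
    + by rewrite rmorphB /= pTC ik rmorphB res_kconst addrC subrK.
    + exact: GpE.
split=> [||x a1 a2 [e1 [e1x <-]] [e2 [e2x <-]]|z zs v vP].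
- by rewrite /c' unknowns_t.
- by rewrite /q unknowns_t.
- exact: (value_inj e1x e2x).
(* The unknowns are realized by sections near P satisfying the system, with t regular; so whatever
   these sections satisfy is a relation of z and holds at v. This puts the point on D. *)
have rel f : G f = 0 -> meval v f = 0.
  move=> Gf; apply: vP; apply: (@sys_rel_of_hom _ _ c' q z _ G eW) => //.
  - by rewrite /c' unknowns_t.
  - by rewrite /q unknowns_t.
  - by move=> a; rewrite GC eWk.
  - by rewrite Gt eWE.
  - move=> a; rewrite Gt => /(integral_mul0 hD)[t0|//].
    by case: py0; exact: (chart_near0 hD PW t0).
pose xi l := v (unk_x l).
have embv f : meval v (emb f) = meval xi f by exact: meval_mmapX.
have xip f : p f -> meval xi f = 0.
  by move=> pf; rewrite -embv; apply: rel; rewrite GE pf rmorph0.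
have pker : prime_ideal [set f | meval xi f = 0].
  split; rewrite /mkset.
  - exact: meval0.
  - by move=> f g f0 g0; rewrite mevalD f0 g0 addr0.
  - by move=> f g g0; rewrite mevalM g0 mulr0.
  - by rewrite meval1; exact/eqP/oner_neq0.
  - by move=> f g; rewrite mevalM => /eqP; rewrite mulf_eq0 => /orP[]/eqP; [left|right].
have [x [Ux xP]] := chart_point ci aU pT_surj hD pker xip.
have xP' f : meval xi f != 0 <-> germ_unit (pe f) x.
  by rewrite xP /mkset; split=> /eqP.
have Sx : v (unk_s r) * meval xi S = 1.
  apply/eqP; rewrite -subr_eq0 -embv -mevalXU -mevalM -(meval1 v) -mevalB; apply/eqP.
  by apply: rel; rewrite rmorphB rmorphM Gs GE sgS rmorph1 subrr.
have Wx : W x.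
  split=> //; apply/xP'; apply: contra_eq_neq Sx => ->.
  by rewrite mulr0 eq_sym oner_neq0.
have v0 : v ord0 = meval xi y0.
  apply/eqP; rewrite -subr_eq0 -embv -mevalXU -mevalB; apply/eqP; apply: rel.
  by rewrite rmorphB GE Gt subrr.
have rx : rational_points D x := chart_rational ik ci aU pTC pT_surj Ux xP'.
have [e' e'x] := rational_value (U := U0) rx Ux.
have e'E f : e' (pe f) = meval xi f.
  have [e'k e'u] := e'x.
  apply: (@value_hom k r (e' \o pe) (meval xi)) => [a|a|g /= g0].
  - by rewrite /= pTC ik.
  - exact: mevalC.
  - by apply/eqP; apply: contrapT => /negP/xP'/e'u; rewrite /= g0 eqxx.
have Nx : N x := SN x Wx.
exists x; split=> //; first by exists e'; rewrite e'E v0.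
move=> eN eNx a1 b1; have [eV eVx] := rational_value rx Wx.
have [h Eh] := RP a1 b1; have := congr1 eV Eh; rewrite !rmorphM -/hW.
have eVE f : eV (res hW (pe f)) = meval xi f.
  rewrite -e'E; exact: (value_inj (value_res hW Wx eVx) e'x).
have -> : eV (res h (M a1 b1)) = eN (M a1 b1).
  exact: (value_inj (value_res h Wx eVx) eNx).
rewrite !eVE => Eab; rewrite mxE mevalM mevalXU embv v0.
rewrite -[LHS]mul1r -Sx -mulrA Eab; ring.
Qed.

End ChartSystem.

Lemma ps_system_lshift (k : fieldType) m d (c : 'I_m -> k) (p : 'I_m -> {mpoly k[m]})
    (c' : 'I_(m + d) -> k) (p' : 'I_(m + d) -> {mpoly k[m + d]}) z :
  (forall i, c' (lshift d i) = c i) ->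
  (forall i, p' (lshift d i) =
    mmap (mpolyC (m + d) (R := k)) (fun j => 'X_(lshift d j)) (p i)) ->
  ps_system c' p' z -> ps_system c p (fun j => z (lshift d j)).
Proof.
move=> cE pE zs j; rewrite zs cE pE; congr (_ + _ * _).
apply: (rmorph_mmap (f := mpolyC (m + d) (R := k)) (g := mmap (ps_C k) z)) => [a|l].
  exact: mmapC.
exact: mmap_XU.
Qed.

Lemma sys_point_lshift (k : fieldType) m d (z : 'I_(m.+1 + d) -> pser k) v :
  sys_point (n := m + d) z v ->
  sys_point (n := m) (fun j => z (lshift d j)) (fun j => v (lshift d j)).
Proof.
move=> vP q zq; rewrite -(@meval_mmapX k m.+1 (m.+1 + d) v (@lshift m.+1 d)).
apply: vP.
apply: etrans zq.
apply: (rmorph_mmap (f := mpolyC (m.+1 + d) (R := k)) (g := mmap (ps_C k) z)) => [a|l].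
  exact: mmapC.
exact: mmap_XU.
Qed.

(** * Points missed by a finite morphism *)

Section Main.
Variables (k : fieldType) (C D : kscheme k) (f : morphism C D).
Hypotheses (kperf : perfect_field k) (klarge : large_field k).
Hypotheses (hD : normal_projective_curve D) (fk : over_k f) (ffin : finite_morphism f).

(* The relation T is the graph of the value of a uniformizer at the missed point. *)
Lemma missed_points_ratio P : rational_points D P ->
  ~ (f @` rational_points C) P ->
  exists T : D -> k -> Prop, (forall x a b, T x a -> T x b -> a = b) /\
    forall d, exists x x' a,
      [/\ (rational_points D `\` f @` rational_points C) x,
          (rational_points D `\` f @` rational_points C) x', a != 0,
          T x a & T x' (d * a)].
Proof.
move=> rP nP; have [iD nD [n [Y [i [pY ik ci]]]] dD] := hD.
have [U [pT [cov aff pTC pTs]]] := proj_space_generated pY.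
have [j UP] := cov (i P).
have [V [aV VP]] := scheme_affine P.
have [eV eVP] := rational_value rP VP; have [eVk eVu] := eVP.
have [aB fV] := ffin aV.
have kinf := large_field_infinite klarge.
have chart := @chart_system k D Y i (U j) ik ci (aff j) n.+1 (pT j) (pTC j) (pTs j)
  iD dD P UP rP (nD P).
have missed (psi : {rmorphism sec C (mpreim f V) -> k}) :
    ~ forall a, psi (comor f V a) = eV a.
  move=> psiE; have [|Q [VQ rQ Qpsi]] := affine_rational_point (e := psi) aB.
    by move=> c; rewrite -(fk V c) psiE eVk.
  apply: nP; exists Q => //; apply: (affine_point_inj aV VQ VP) => s.
  by rewrite -(comor_unit s VQ) -(Qpsi.2 (comor f V s)) psiE eVu.
have [[s [es fs]]|] := @fibre_certificate k _ _ (comor f V) eV (kconstr V) kinf kperf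
    eVk fV missed.
  have sP : basic_open s P by split=> //; apply/eVu; rewrite es oner_neq0.
  (* The fibre is empty: D(s) is missed altogether because s pulls back to 0, so an empty matrix
     suffices. *)
  have [|c [q [L [T [c0 q0 Tfun H]]]]] := chart (basic_open s) sP 0%N 0; first by case.
  exists T; split=> // d; have [z zs] := ps_system_exists c q.
  have [v [v' [vP vP' v0 v'E]]] := large_system_ratio c0 q0 zs d klarge.
  have [x [sx rx Tx _]] := H z zs v vP; have [x' [sx' rx' Tx' _]] := H z zs v' vP'.
  have nfs y : basic_open s y -> ~ (f @` rational_points C) y.
    move=> [_ sy] [Q _ Qy]; have VQ : V (f Q) by rewrite Qy; exact: germ_unit_dom sy.
    move: sy; rewrite -Qy -(comor_unit s VQ) fs.
    exact: (germ_nonunit0 (U := mpreim f V)).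
  exists x, x', (v ord0); split=> //.
  - by split=> //; exact: nfs.
  - by split=> //; exact: nfs.
  - by rewrite -v'E.
move=> [m [M [b [h [M0 [hsep hmon [sh M00] hroot [Mev cert]]]]]]].
have MP a a' : ~ germ_unit (M a a') P by move=> /eVu; rewrite Mev eqxx.
have [c [q [L [T [c0 q0 Tfun H]]]]] := chart V VP m M MP.
have [c' [q' [cE qE W]]] := weil_system c0 q0 (L *m L) hsep hmon sh M00 hroot.
move: (weil_deg _ _ _) c' q' cE qE W => d c' q' cE qE W.
have l0 : lshift d (ord0 : 'I_n.+3) = ord0 by exact: val_inj.
have c0' : c' ord0 = 0 by rewrite -l0 cE.
have q0' : q' ord0 = 1 by rewrite -l0 qE q0 rmorph1.
have [z zs] := ps_system_exists c' q'.
have zs0 := ps_system_lshift cE qE zs.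
exists T; split=> // a; have [v [v' [vP vP' v0 v'E]]] :=
  @large_system_ratio k (n.+2 + d) c' q' c0' q0' z zs a klarge.
have good w : sys_point (n := n.+2 + d) z w -> exists x,
    (rational_points D `\` f @` rational_points C) x /\ T x (w ord0).
  move=> wP; have [x [Vx rx Tx Mx]] := H _ zs0 _ (sys_point_lshift wP).
  rewrite l0 in Tx Mx; exists x; split=> //; split=> // -[Q rQ Qx].
  have VQ : V (f Q) by rewrite Qx.
  have [psi psiQ] := rational_value (U := mpreim f V) rQ VQ.
  have eQ := morphism_value fk VQ psiQ; rewrite Qx in eQ.
  (* A preimage in C(k) would evaluate b to a root of chi at the new point, which [weil_system]
     excludes. *)
  have := W z zs w wP (psi b); rewrite l0 => /negP; apply; apply/eqP.
  rewrite -[RHS](cert psi); last by move=> e; rewrite (fk V e); case: psiQ.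
  congr (\det (_ - _)); rewrite !map_mxM.
  have -> : map_mx (psi \o comor f V) M =
      w ord0 *: map_mx (meval (fun l : 'I_n.+3 => w (lshift d l))) L.
    by apply/matrixP => a1 a2; rewrite !mxE; exact: (Mx (psi \o comor f V)).
  by rewrite -scalemxAl -scalemxAr scalerA.
have [x [Sx Tx]] := good v vP; have [x' [Sx' Tx']] := good v' vP'.
by exists x, x', (v ord0); rewrite -v'E.
Qed.

End Main.

Local Open Scope card_scope.

Theorem theorem1p3 (k : fieldType) (hperfect : perfect_field k)
    (hlarge : large_field k) (C D : kscheme k)
    (hC : normal_projective_curve C) (hD : normal_projective_curve D)
    (f : morphism C D) (hf : over_k f) (hfin : finite_morphism f)
    (hns : ~ set_surj (rational_points C) (rational_points D) f) :
  rational_points D `\` f @` rational_points C #= [set: k].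
Proof.
have kinf := large_field_infinite hlarge.
have /existsNP[P /not_implyP[rP nP]] := hns.
have [T [Tfun ratio]] := missed_points_ratio hperfect hlarge hD hf hfin rP nP.
set S := _ `\` _ in ratio *.
have kS2 : embeds [set: k] (S `*` S).
  apply: (@graph_embeds _ _ _ _ (fun w => exists a, [/\ a != 0, T w.2.1 a &
    T w.2.2 (w.1 * a)])).
  - move=> d _; have [x [x' [a [Sx Sx' a0 Tx Tx']]]] := ratio d.
    by exists (x, x') => //; exists a.
  - move=> d d' [x x'] [a [a0 /= Tx Tx']] [a' [_ /= Ty Ty']].
    by apply: (mulIf a0); rewrite (Tfun _ _ _ Tx Ty) in Tx' *; exact: Tfun Tx' Ty'.
  - exact: (P, P).
have Sinf : infinite_set S.
  move=> Sfin; apply: kinf; have := embeds_card_le kS2.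
  move=> /card_le_finite; apply.
  exact: finite_setX.
have kS := embeds_trans kS2 (embeds_square Sinf).
have Sk : embeds S [set: k].
  have [_ _ pD _] := hD; have [g [gk gI]] := rational_points_embeds kinf pD.
  exists g; split=> [x [rx _]|x y [rx _] [ry _]]; first exact: gk.
  exact: gI.
by rewrite card_eq_le; apply/andP; split; exact: embeds_card_le.
Qed.
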